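(* For any $\beta,\gamma\ge0$, the joint distribution of $H_{\mathcal I}^2$ and $R_{\mathcal I}^2$ under the Palm probability of $\mathcal V_{\mathcal I}$ is given by the joint Laplace transform $$\mathbb E^0_{\mathcal V_{\mathcal I}}\left[e^{-\gamma H_{\mathcal I}^2-\beta R_{\mathcal I}^2}\right]=\frac{2\lambda\pi}{3\beta}\left[\left(1+\frac{\gamma}{\lambda\pi}\right)^{-3/2}-\left(1+\frac{\gamma+\beta}{\lambda\pi}\right)^{-3/2}\right],$$ where for $\beta=0$ the right-hand side is understood as its limit as $\beta\downarrow0$.
   Context: Model. Let $\lambda,v>0$. $\Phi=\sum_i\delta_{X_i}$ is a homogeneous Poisson point process of intensity $\lambda$ on $\mathbb R^2$ and $(\Theta_i)$ are i.i.d. uniform angles on $[-\pi,\pi)$, independent of $\Phi$. Base station (BS) $i$ is at $X_i^t=X_i+vt(\cos\Theta_i,\sin\Theta_i)$ at time $t\in\mathbb R$; $d_i(t)=\|X_i^t\|$ is its distance to the user at the origin. The tropical interference handover point process $\mathcal V_{\mathcal I}$ on $\mathbb R$ consists of the times $s$ for which there is a pair $i\neq j$ with $d_i(s)=d_j(s)=h$ and exactly one BS $l$ with $d_l(s)<h$. At such a time, $H_{\mathcal I}=h$ and $R_{\mathcal I}=d_l(s)$ (distance of the serving BS). Palm expectation: for a stationary point process $N$ on $\mathbb R$ with intensity $\lambda_N\in(0,\infty)$, built time-shift-compatibly from the moving configuration, $\mathbb E^0_N[f]=\lambda_N^{-1}\,\mathbb E\big[\sum_{t\in N\cap[0,1]}f_t\big]$,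 where $f_t$ is the quantity $f$ observed at time $t$. *)

(* Defs.v *)
From HB Require Import structures.
From mathcomp Require Import all_boot all_order all_algebra.
From mathcomp Require Import all_classical all_reals all_analysis.

Set Implicit Arguments.
Unset Strict Implicit.
Unset Printing Implicit Defensive.

Import Order.TTheory GRing.Theory Num.Theory.
Import numFieldNormedType.Exports.

Local Open Scope classical_set_scope.
Local Open Scope ring_scope.

Notation plane R := (measurableTypeR R * measurableTypeR R)%type.

Section poisson_point_process.
Context d (T : measurableType d) (R : realType) (P : probability T R).

Definition area : set (plane R) -> \bar R :=
  (@lebesgue_measure R \x @lebesgue_measure R)%E.

(* The library's [poisson_pmf] is not used because it is identically 1 at mean
   0; here 0 ^+ 0 = 1 makes mean 0 the Dirac mass at 0. *)
Definition poisson_weight (m : R) (k : nat) : R :=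
  expR (- m) * m ^+ k / k`!%:R.

(* The point process sum_i delta_{X_i}; the points are counted by index, hence
   with multiplicity. *)
Definition point_count (X : nat -> T -> plane R) (A : set (plane R)) (w : T) :
  \bar R := counting [set i | A (X i w)].

Definition homogeneous_poisson (lambda : R) (X : nat -> T -> plane R) : Prop :=
  forall (n : nat) (A : 'I_n -> set (plane R)) (k : 'I_n -> nat),
    (forall i, measurable (A i)) -> (forall i, (area (A i) < +oo)%E) ->
    trivIset setT A ->
    P [set w | forall i, point_count X (A i) w = (k i)%:R%:E] =
    (\prod_(i < n) poisson_weight (lambda * fine (area (A i))) (k i))%:E.

End poisson_point_process.

Section independence.
Context d (T : measurableType d) (R : realType) (P : probability T R).

Definition sigma_of d' (U : measurableType d') (Y : nat -> T -> U) :
  set (set T) := <<s [set E | exists i B, measurable B /\ E = Y i @^-1` B] >>.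

Definition independent_sequences d1 (U1 : measurableType d1)
    d2 (U2 : measurableType d2) (Y : nat -> T -> U1) (Z : nat -> T -> U2) :
  Prop := forall E F, sigma_of Y E -> sigma_of Z F ->
    P (E `&` F) = (P E * P F)%E.

Definition mutually_independent d' (U : measurableType d')
    (Y : nat -> T -> U) : Prop :=
  forall (I : seq nat) (B : nat -> set U), uniq I ->
    (forall i, measurable (B i)) ->
    P [set w | forall i, i \in I -> B i (Y i w)] =
    (\prod_(i <- I) P (Y i @^-1` B i))%E.

End independence.

Lemma ltNpi (R : realType) : - pi < pi :> R.
Proof. by rewrite gtrN// pi_gt0. Qed.

(* [uniform_prob] has a density on the closed interval; this is the same measure
   as the uniform law on [-pi, pi). *)
Definition iid_uniform_angles d (T : measurableType d) (R : realType)
    (P : probability T R) (Theta : nat -> {RV P >-> measurableTypeR R}) :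
  Prop :=
  (forall i B, measurable B ->
     distribution P (Theta i) B = uniform_prob (ltNpi R) B) /\
  mutually_independent P (fun i => Theta i : T -> measurableTypeR R).

Section handovers.
Context (R : realType).

Definition position (v : R) (x : plane R) (theta t : R) : plane R :=
  (x.1 + v * t * cos theta, x.2 + v * t * sin theta).

(* Euclidean; the library's norm on a product is the sup norm. *)
Definition dist_origin (x : plane R) : R := Num.sqrt (x.1 ^+ 2 + x.2 ^+ 2).

Definition bs_dist (v : R) (x : nat -> plane R) (theta : nat -> R)
    (i : nat) (t : R) : R :=
  dist_origin (position v (x i) (theta i) t).

Variable dist : nat -> R -> R.

Definition interference_handover (s h r : R) : Prop :=
  (exists i j, i <> j /\ dist i s = h /\ dist j s = h) /\
  (exists l, unique (fun k => dist k s < h) l /\ dist l s = r).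

Lemma interference_handover_unique (s h r h' r' : R) :
  interference_handover s h r -> interference_handover s h' r' ->
  h = h' /\ r = r'.
Proof.
have lt_absurd a b c e : interference_handover s a b ->
    interference_handover s c e -> a < c -> False.
  move=> [[i [j [nij [ia ja]]]] _] [_ [l [[_ ul] _]]] ac.
  by apply: nij; rewrite -(ul i) ?ia// -(ul j) ?ja.
move=> H H'; have hh' : h = h'.
  by apply/eqP; case: ltgtP => // hh'; exfalso;
    [exact: lt_absurd H H' hh'|exact: lt_absurd H' H hh'].
split=> //; rewrite -{}hh' in H'.
case: H H' => _ [l [[lh ul] <-]] [_ [l' [[lh' _] <-]]].
by rewrite (ul _ lh').
Qed.

Definition interference_times : set R :=
  [set s | exists h r, interference_handover s h r].

(* The values are determined by [interference_handover_unique]; outside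
   [interference_times] they are 0 and irrelevant. *)
Definition handover_dist (s : R) : R :=
  xget 0 [set h | exists r, interference_handover s h r].
Definition serving_dist (s : R) : R :=
  xget 0 [set r | exists h, interference_handover s h r].

End handovers.

Section palm.
Context d (T : measurableType d) (R : realType) (P : probability T R).
Local Open Scope ereal_scope.

Definition mean_sum (N : T -> set R) (f : T -> R -> R) : \bar R :=
  \int[P]_w \esum_(t in N w `&` `[0%R, 1%R]) (f w t)%:E.

Definition intensity (N : T -> set R) : \bar R := mean_sum N (fun _ _ => 1%R).

(* If the intensity is 0 or +oo then the normalizing factor, hence the value, is
   0, so a nonzero value entails that the intensity lies in ]0, +oo[. *)
Definition palm_expectation (N : T -> set R) (f : T -> R -> R) : \bar R :=
  ((fine (intensity N))^-1)%:E * mean_sum N f.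

End palm.

Definition laplace_pos (R : realType) (lambda gamma beta : R) : R :=
  2 * lambda * pi / (3 * beta) *
  ((1 + gamma / (lambda * pi)) `^ (- (3 / 2)) -
   (1 + (gamma + beta) / (lambda * pi)) `^ (- (3 / 2))).

Definition joint_laplace (R : realType) (lambda gamma beta : R) : R :=
  if beta == 0 then lim (laplace_pos lambda gamma b @[b --> 0^'+])
  else laplace_pos lambda gamma beta.

(* Main.v *)
Require Import Defs.
From HB Require Import structures.
From mathcomp Require Import all_boot all_order all_algebra.
From mathcomp Require Import all_classical all_reals all_analysis measurable_realfun ring lra.
Set Implicit Arguments.
Unset Strict Implicit.
Unset Printing Implicit Defensive.
Import Order.TTheory GRing.Theory Num.Theory.
Import numFieldNormedType.Exports.
Local Open Scope classical_set_scope.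
Local Open Scope ring_scope.

(** * P1 *)
Section distinct_sum.
Context {R : realType}.
Local Open Scope ereal_scope.
Implicit Types (G H : seq nat -> \bar R) (I : seq nat).

Fixpoint nsum n I G : \bar R :=
  match n with
  | 0 => G [::]
  | n'.+1 => \sum_(i <oo) (if i \in I then 0 else nsum n' (i :: I) (fun s => G (i :: s)))
  end.

Lemma nsum_ge0 n I G : (forall s, 0 <= G s) -> 0 <= nsum n I G.
Proof.
elim: n I G => [|n IH] I G G0 //=.
by apply: nneseries_ge0 => i _ _; case: ifP => // _; exact: IH.
Qed.

Lemma eq_nsum n I G H :
  (forall s, size s = n -> uniq s -> (forall i, i \in s -> i \notin I) -> G s = H s) ->
  nsum n I G = nsum n I H.
Proof.
elim: n I G H => [|n IH] I G H GH /=; first by apply: GH.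
apply: eq_eseriesr => i _; case: ifPn => // iI; apply: IH => s ss us sI.
apply: GH => /=; first by rewrite ss.
- by rewrite us andbT; apply/negP => /sI; rewrite inE eqxx.
- move=> j; rewrite inE => /orP[/eqP ->//|/sI]; rewrite inE negb_or => /andP[] //.
Qed.

Lemma nsumZl n I G (c : R) : (forall s, 0 <= G s) ->
  nsum n I (fun s => c%:E * G s) = c%:E * nsum n I G.
Proof.
elim: n I G => [|n IH] I G G0 //=.
rewrite -nneseriesZl; last by move=> i _; case: ifP => // _; exact: nsum_ge0.
by apply: eq_eseriesr => i _; case: ifP => // _; rewrite ?mule0// IH.
Qed.

Lemma nsum_nneseries n I (G : nat -> seq nat -> \bar R) :
  (forall k s, 0 <= G k s) ->
  nsum n I (fun s => \sum_(k <oo) G k s) = \sum_(k <oo) nsum n I (G k).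
Proof.
elim: n I G => [|n IH] I G G0 //=.
rewrite nneseries_interchange; last first.
  by move=> k i; case: ifP => // _; exact: nsum_ge0.
apply: eq_eseriesr => i _; case: ifPn => // iI; first by rewrite eseries0.
by rewrite IH.
Qed.

Lemma nsum_sum n I (J : Type) (r : seq J) (G : J -> seq nat -> \bar R) :
  (forall k s, 0 <= G k s) ->
  nsum n I (fun s => \sum_(k <- r) G k s) = \sum_(k <- r) nsum n I (G k).
Proof.
elim: n I G => [|n IH] I G G0 //=.
rewrite -(@nneseries_sum J r xpredT R (fun k i => if i \in I then 0
  else nsum n (i :: I) (fun s => G k (i :: s))) 0%N); last first.
  by move=> k i _; case: ifP => // _; exact: nsum_ge0.
apply: eq_eseriesr => i _; case: ifPn => // iI; first by rewrite big1.
by rewrite IH.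
Qed.

Lemma nsum_cat p q I G :
  nsum (p + q) I G = nsum p I (fun s => nsum q (catrev s I) (fun s' => G (s ++ s'))).
Proof.
elim: p I G => [|p IH] I G //=.
by apply: eq_eseriesr => i _; case: ifPn => // iI; rewrite IH.
Qed.

Lemma nsum_eq0 n I G : (forall s, 0 <= G s) -> nsum n I G = 0 ->
  forall s, size s = n -> uniq s -> (forall i, i \in s -> i \notin I) -> G s = 0.
Proof.
elim: n I G => [|n IH] I G G0 /=; first by move=> H [].
pose u i := if i \in I then 0 else nsum n (i :: I) (fun s => G (i :: s)).
have u0 i : 0 <= u i by rewrite /u; case: ifP => // _; exact: nsum_ge0.
move=> H; change (\sum_(i <oo) u i = 0) in H; move=> [|i s] //= [ss] /andP[is_ us] sI.
have ui : u i = 0.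
  apply/eqP; rewrite eq_le u0 andbT -H (@nneseriesD1 _ u i)//.
  by rewrite leeDl// nneseries_ge0.
move: ui; rewrite /u ifN; last by apply: sI; rewrite mem_head.
move=> /IH; apply => // j js; rewrite inE negb_or sI ?andbT; last by rewrite inE js orbT.
by apply: contraNneq is_ => <-.
Qed.

Lemma measurable_nsum d (T : measurableType d) n I (G : seq nat -> T -> \bar R) :
  (forall s w, 0 <= G s w) -> (forall s, measurable_fun setT (G s)) ->
  measurable_fun setT (fun w => nsum n I (G ^~ w)).
Proof.
elim: n I G => [|n IH] I G G0 mG //=.
apply: ge0_emeasurable_sum => [i w _ _|i _].
  by case: ifP => // _; exact: nsum_ge0.
by rewrite /=; case: (i \in I) => //; apply: (IH _ (fun s => G (i :: s))).
Qed.

Lemma integral_nsum d (T : measurableType d) (m : {measure set T -> \bar R}) n I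
    (G : seq nat -> T -> \bar R) :
  (forall s w, 0 <= G s w) -> (forall s, measurable_fun setT (G s)) ->
  \int[m]_w nsum n I (G ^~ w) = nsum n I (fun s => \int[m]_w G s w).
Proof.
elim: n I G => [|n IH] I G G0 mG //=.
rewrite (@integral_nneseries _ _ _ m _ measurableT (fun i w => if i \in I then 0
  else nsum n (i :: I) (fun s => G (i :: s) w))).
- apply: eq_eseriesr => i _; case: ifPn => iI; first by rewrite integral0.
  by rewrite (IH _ (fun s => G (i :: s))).
- move=> i; case: (i \in I) => //; apply: (measurable_nsum n (i :: I) (G := fun s => G (i :: s))) => //.
- by move=> i w _; case: ifP => // _; exact: nsum_ge0.
Qed.

End distinct_sum.

Section distinct_sum_measure.
Context d (Y : measurableType d) (R : realType).
Local Open Scope ereal_scope.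

Fixpoint nmeasure n (I : seq nat) (m : seq nat -> {measure set Y -> \bar R}) :
    {measure set Y -> \bar R} :=
  match n with
  | 0 => m [::]
  | n'.+1 => mseries (fun i => if i \in I then [the measure Y R of mzero]
       else nmeasure n' (i :: I) (fun s => m (i :: s))) 0
  end.

Lemma nmeasureE n I m A : nmeasure n I m A = nsum n I (fun s => m s A).
Proof.
elim: n I m => [|n IH] I m //=; rewrite /mseries.
by apply: eq_eseriesr => i _; case: ifP => // _; rewrite IH.
Qed.

Lemma integral_nmeasure n I m (f : Y -> \bar R) :
  (forall y, 0 <= f y) -> measurable_fun setT f ->
  \int[nmeasure n I m]_y f y = nsum n I (fun s => \int[m s]_y f y).
Proof.
move=> f0 mf; elim: n I m => [|n IH] I m //=.
rewrite ge0_integral_measure_series//; apply: eq_eseriesr => i _.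
by case: ifP => // _; rewrite ?integral_measure_zero// IH.
Qed.

End distinct_sum_measure.

(** * P2 *)
Section finite_product.
Context d1 d2 (T1 : measurableType d1) (T2 : measurableType d2) (R : realType).
Variables (m1 : {finite_measure set T1 -> \bar R})
  (m2 : {finite_measure set T2 -> \bar R}).
Local Open Scope ereal_scope.

Definition finprod : set (T1 * T2) -> \bar R := m1 \x m2.

HB.instance Definition _ := Measure.on finprod.

Lemma finprodE A B : measurable A -> measurable B -> finprod (A `*` B) = m1 A * m2 B.
Proof. exact: product_measure1E. Qed.

Let finprod_fin : fin_num_fun finprod.
Proof.
have : finprod setT < +oo.
  rewrite -setXTT finprodE// -ge0_fin_numE ?mule_ge0//.
  by rewrite fin_numM// fin_num_measure.
exact: lty_fin_num_fun.
Qed.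

HB.instance Definition _ := Measure_isFinite.Build _ _ _ finprod finprod_fin.

Lemma prod_measure_uniqueZ (m' : {measure set (T1 * T2)%type -> \bar R}) (c : \bar R) :
  0 <= c -> c \is a fin_num ->
  (forall A B, measurable A -> measurable B -> m' (A `*` B) = c * (m1 A * m2 B)) ->
  forall X, measurable X -> m' X = c * finprod X.
Proof.
move=> c0 cfin m'E X mX.
pose cn : {nonneg R} := NngNum (fine_ge0 c0).
rewrite -[c]fineK// -[fine c]/(cn%:num) -[RHS]/(mscale cn finprod X).
pose C : set (set (T1 * T2)) :=
  [set C | exists A, measurable A /\ exists B, measurable B /\ C = A `*` B].
apply: (measure_unique C (fun=> setT)) => //.
- rewrite measurable_prod_measurableType //; congr (<<s _ >>).
  rewrite predeqE; split => [[A mA [B mB <-]]|[A [mA [B [mB ->]]]]].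
    by exists A; split => //; exists B.
  by exists A => //; exists B.
- move=> _ _ [A1 [mA1 [B1 [mB1 ->]]]] [A2 [mA2 [B2 [mB2 ->]]]].
  rewrite -setXI; exists (A1 `&` A2); split; first exact: measurableI.
  by exists (B1 `&` B2); split => //; exact: measurableI.
- move=> _; exists setT; split => //; exists setT; split => //; by rewrite setXTT.
- by rewrite bigcup_const//; exists 0%N.
- move=> _ [A1 [mA1 [B1 [mB1 ->]]]]; rewrite m'E//= /mscale/= fineK//.
  by rewrite finprodE.
- move=> _; rewrite -setXTT m'E// -ge0_fin_numE ?mule_ge0//.
  by rewrite !fin_numM// fin_num_measure.
Qed.

End finite_product.

Section power_space.
Context d (Z : measurableType d).

Fixpoint powd n : measure_display :=
  match n with 0 => default_measure_display | n'.+1 => (d, powd n').-prod%mdisp end.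

Fixpoint powT n : measurableType (powd n) :=
  match n return measurableType (powd n) with
  | 0 => unit
  | n'.+1 => (Z * powT n')%type
  end.

Fixpoint powpt (z : nat -> Z) n (s : seq nat) : powT n :=
  match n return powT n with
  | 0 => tt
  | n'.+1 => (z (head 0%N s), powpt z n' (behead s))
  end.

Definition unit_dirac (R : realType) : {finite_measure set unit -> \bar R} := dirac tt.

Fixpoint powmeas (R : realType) (nu : {finite_measure set Z -> \bar R}) n :
    {finite_measure set (powT n) -> \bar R} :=
  match n return {finite_measure set (powT n) -> \bar R} with
  | 0 => unit_dirac R
  | n'.+1 => finprod nu (powmeas nu n')
  end.

Lemma measurable_powpt d' (T : measurableType d') (z : nat -> T -> Z) n s :
  (forall i, measurable_fun setT (z i)) ->
  measurable_fun setT (fun w => powpt (z ^~ w) n s).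
Proof.
move=> mz; elim: n s => [|n IH] s //=.
by apply: measurable_fun_pair; [exact: mz|exact: IH].
Qed.

End power_space.

Section power_unique.
Context d1 d2 (Z1 : measurableType d1) (Z2 : measurableType d2) (R : realType).
Variables (nu1 : {finite_measure set Z1 -> \bar R})
  (nu2 : {finite_measure set Z2 -> \bar R}).
Let Z := (Z1 * Z2)%type.
Let nu := finprod nu1 nu2.
Local Open Scope ereal_scope.

Fixpoint box n (A : nat -> set Z1) (D : nat -> set Z2) : set (powT Z n) :=
  match n return set (powT Z n) with
  | 0 => setT
  | n'.+1 => (A 0%N `*` D 0%N) `*` box (A \o S) (D \o S)
  end.
Arguments box : clear implicits.

Lemma measurable_box n A D : (forall k, measurable (A k)) ->
  (forall k, measurable (D k)) -> measurable (box n A D).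
Proof.
elim: n A D => [|n IH] A D mA mD /=; first exact: measurableT.
by apply: measurableX; [exact: measurableX|apply: IH => k; [exact: mA|exact: mD]].
Qed.

Lemma box_powpt n A D (z : nat -> Z) s : size s = n ->
  box n A D (powpt z n s) <-> (forall k, (k < n)%N ->
    A k (z (nth 0%N s k)).1 /\ D k (z (nth 0%N s k)).2).
Proof.
elim: n A D s => [|n IH] A D [|i s] //= [ss].
split=> [[[? ?] /(IH _ _ _ ss) H] [|k] //|H].
  by rewrite ltnS => kn; exact: H.
split; first exact: (H 0%N).
by apply/IH => // k kn; exact: (H k.+1).
Qed.

Lemma powmeas_unique n (c : \bar R) (m : {measure set (powT Z n) -> \bar R}) :
  0 <= c -> c \is a fin_num ->
  (forall A D, (forall k, measurable (A k)) -> (forall k, measurable (D k)) ->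
    m (box n A D) = c * \prod_(k < n) (nu1 (A k) * nu2 (D k))) ->
  forall Y, measurable Y -> m Y = c * powmeas nu n Y.
Proof.
elim: n c m => [|n IH] c m c0 cfin mE Y mY.
  have [->|->] : Y = set0 \/ Y = setT.
  - have [Ytt|Ytt] := pselect (Y tt); [right|left].
      by apply/seteqP; split=> // t _; case: t.
    by apply/seteqP; split=> // t; case: t.
  - by rewrite !measure0 mule0.
  - rewrite /= diracT mule1.
    by have := mE (fun=> setT) (fun=> setT); rewrite big_ord0 mule1; apply.
have mes2 : measurable_fun setT (snd : Z * powT Z n -> powT Z n) by exact: measurable_snd.
have mes1 : measurable_fun setT (fst : Z * powT Z n -> Z) by exact: measurable_fst.
(* sections over a fixed first coordinate *)
have slice (E : set Z) (mET : measurable (E `*` [set: powT Z n])) (B : set (powT Z n)) :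
    pushforward (mrestr m mET) snd B = m (E `*` B).
  rewrite /pushforward /mrestr; congr (m _).
  by apply/seteqP; split=> [[x y] [/= ? [/= ? ?]]|[x y] [/= ? ?]].
have mprod (A1 : set Z1) (D1 : set Z2) (B : set (powT Z n)) :
    measurable A1 -> measurable D1 -> measurable B ->
    m ((A1 `*` D1) `*` B) = c * (nu1 A1 * nu2 D1) * powmeas nu n B.
  move=> mA1 mD1 mB.
  have mET : measurable ((A1 `*` D1) `*` [set: powT Z n]).
    by apply: measurableX => //; exact: measurableX.
  pose m' : {measure set (powT Z n) -> \bar R} :=
    measure_function_pushforward__canonical__measure_function_Measure
     (mrestr m mET) mes2.
  rewrite -(slice _ mET) -[LHS]/(m' B); apply: IH => //.
  - by rewrite !mule_ge0.
  - by rewrite !fin_numM// fin_num_measure.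
  - move=> A D mA mD; rewrite /m' /= slice.
    pose A' k := if k is k'.+1 then A k' else A1.
    pose D' k := if k is k'.+1 then D k' else D1.
    have := mE A' D'; rewrite /= -[A' \o S]/A -[D' \o S]/D => ->.
    + by rewrite big_ord_recl/= muleA.
    + by case.
    + by case.
have mET (B : set (powT Z n)) : measurable B -> measurable ([set: Z] `*` B).
  by move=> mB; exact: measurableX.
apply: (prod_measure_uniqueZ (m1 := nu)) => // E B mE' mB.
pose m' : {measure set Z -> \bar R} :=
  measure_function_pushforward__canonical__measure_function_Measure
   (mrestr m (mET B mB)) mes1.
have -> : m (E `*` B) = m' E.
  rewrite /m' /= /pushforward /mrestr; congr (m _).
  by apply/seteqP; split=> [[x y] [/= ? ?]|[x y] [/= ? [/= ? ?]]].
rewrite [nu E * _]muleC muleA; apply: (prod_measure_uniqueZ (m1 := nu1)) => //.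
- by rewrite mule_ge0.
- by rewrite fin_numM// fin_num_measure.
- move=> A D mA mD; rewrite /m' /= /pushforward /mrestr.
  rewrite -muleA [X in _ * X]muleC muleA -mprod//; congr (m _).
  by apply/seteqP; split=> [[[a b] y] [/= [? ?] [/= ? ?]]|[[a b] y] [/= [? ?] ?]].
Qed.

End power_unique.
Arguments box {d1 d2 Z1 Z2} n A D.

(** * P3 *)
Section counting_lists.
Context {R : realType}.
Local Open Scope ereal_scope.

Lemma counting_seqP (S : set nat) n : @counting nat R S = n%:R%:E <->
  exists L : seq nat, [/\ uniq L, forall i, i \in L <-> S i & size L = n].
Proof.
rewrite /counting; split.
  case: ifPn => [/asboolP finS|_] // -[/eqP]; rewrite eqr_nat => /eqP <-.
  exists (finmap.enum_fset (fset_set S)); split=> [|i|//]; first exact: finmap.fset_uniq.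
  by rewrite in_fset_set// inE.
move=> [L [uL LS <-]].
have -> : S = [set` L] by apply/seteqP; split=> i /= /LS.
rewrite asboolT; last exact: finite_seq.
congr (_%:R%:E); apply: perm_size; apply: uniq_perm => [|//|i].
  exact: finmap.fset_uniq.
rewrite in_fset_set; last exact: finite_seq.
by apply/idP/idP; rewrite inE.
Qed.

Lemma nneseries_seq (L : seq nat) (f : nat -> \bar R) : uniq L ->
  (forall i, 0 <= f i) -> (forall i, i \notin L -> f i = 0) ->
  \sum_(i <oo) f i = \sum_(i <- L) f i.
Proof.
move=> uL f0 fL; rewrite nneseries_esumT//.
transitivity (\esum_(i in [set` L]) f i).
  rewrite [RHS]esum_mkcond; apply: eq_esum => i _.
  by case: ifPn => //; rewrite notin_setE => /negP/fL.
by rewrite esum_fset//= -?fsbig_seq//; exact: finite_seq.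
Qed.

Lemma nneseries_count (b : pred nat) (L I : seq nat) (x : \bar R) : 0 <= x ->
  uniq L -> uniq I -> (forall i, (i \in L) = b i) ->
  \sum_(i <oo) (if i \in I then 0 else if b i then x else 0) =
  (size L - count b I)%:R%:E * x.
Proof.
move=> x0 uL uI bL; rewrite (@nneseries_seq L)//; last 2 first.
- by move=> i; case: (i \in I) => //; case: (b i).
- by move=> i; rewrite bL => /negbTE ->; rewrite if_same.
have cE : count b I = count (mem I) L.
  rewrite -!size_filter; apply: perm_size; apply: uniq_perm; rewrite ?filter_uniq//.
  by move=> i; rewrite !mem_filter bL andbC.
rewrite cE -(count_predC (mem I) L) addKn -size_filter.
rewrite (eq_bigr (fun i => if i \in I then 0 else if i \in L then x else 0)); last first.
  by move=> i _; rewrite bL.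
rewrite big_seq (eq_bigr (fun i => if predC (mem I) i then x else 0)); last first.
  by move=> i iL /=; rewrite iL; case: (i \in I).
rewrite -big_seq -big_mkcond/= -big_filter.
elim: [seq i <- L | _] => [|i s IH]; first by rewrite big_nil mul0e.
by rewrite big_cons IH/= -natr1 EFinD addeC ge0_muleDl// mul1e addeC.
Qed.

Section fallings.
Local Open Scope nat_scope.
Context (J : finType) (n : J -> nat).

Fixpoint falling (l : seq J) (j : J -> nat) : nat :=
  if l is c :: l' then (n c - j c) * falling l' (fun c' => (c' == c) + j c')
  else 1.

Lemma falling_full l j : (forall c, n c = count_mem c l + j c)%N ->
  falling l j = (\prod_c (count_mem c l)`!)%N.
Proof.
elim: l j => [|c l IH] j nE /=; first by rewrite big1.
rewrite IH => [|c']; last by rewrite nE /= addnCA addnA eq_sym.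
rewrite [RHS](bigD1 c)//= eqxx add1n factS -mulnA; congr muln.
  by rewrite nE/= eqxx add1n addnK.
rewrite [LHS](bigD1 c)//=; congr muln; apply: eq_bigr => c' cc'.
by rewrite eq_sym (negbTE cc').
Qed.

Lemma falling_short l j c : (j c <= n c < count_mem c l + j c)%N ->
  falling l j = 0%N.
Proof.
elim: l j => [|c0 l IH] j /=; first by case/andP => ?; rewrite ltnNge => /negP.
have [->|cc0] := eqVneq c0 c => /andP[jn nl].
  have [jn'|nj] := ltnP (j c) (n c); last by rewrite (eqP nj) mul0n.
  rewrite (IH (fun c' => (c' == c) + j c')%N) ?muln0// eqxx add1n jn'/=.
  by rewrite addnS -addSn -add1n.
rewrite (IH (fun c' => (c' == c0) + j c')%N) ?muln0// eq_sym (negbTE cc0) add0n jn/=.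
by rewrite add0n in nl.
Qed.

Lemma sum_count_mem (l : seq J) : (\sum_c count_mem c l = size l)%N.
Proof.
elim: l => [|c l IH] /=; first by rewrite big1.
rewrite big_split/= IH (bigD1 c)//= eqxx big1// => c' cc'.
by rewrite eq_sym (negbTE cc').
Qed.

Lemma falling_exact l : (\sum_c n c = size l)%N ->
  falling l (fun=> 0%N) =
  if [forall c, n c == count_mem c l] then (\prod_c (count_mem c l)`!)%N else 0%N.
Proof.
move=> nl; case: ifPn => [/forallP nE|].
  by apply: falling_full => c; rewrite addn0; exact/eqP.
rewrite negb_forall => /existsP[c0 nc0].
have [/existsP[c nc]|] := boolP [exists c, n c < count_mem c l].
  by apply: (@falling_short _ _ c); rewrite addn0.
rewrite negb_exists => /forallP ln.
have : (\sum_c count_mem c l <= \sum_c n c ?= iff [forall c, count_mem c l == n c])%N.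
  by apply: leqif_sum => c _; split=> //; rewrite leqNgt.
case=> _; rewrite nl sum_count_mem eqxx => /esym/forallP/(_ c0).
by rewrite eq_sym (negbTE nc0).
Qed.

End fallings.

Lemma nsum_all2 (J : finType) (b : J -> pred nat) (L : J -> seq nat) l I :
  (forall i c c', b c i -> b c' i -> c = c') ->
  (forall c, uniq (L c)) -> (forall c i, (i \in L c) = b c i) -> uniq I ->
  nsum (size l) I (fun s => (all2 b l s)%:R%:E) =
  (falling (fun c => size (L c)) l (fun c => count (b c) I))%:R%:E :> \bar R.
Proof.
move=> bdisj uL Lb; elim: l I => [|c0 l IH] I uI /=; first by [].
set F := falling _ l _.
rewrite (eq_eseriesr (g := fun i => if i \in I then 0 else
    if b c0 i then F%:R%:E else 0)); last first.
  move=> i _; case: ifPn => // iI; case: ifPn => bi; last first.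
    transitivity (nsum (size l) (i :: I) (fun=> 0%:E * (0 : \bar R))).
      by apply: eq_nsum => s _ _ _; rewrite mul0e.
    by rewrite nsumZl// mul0e.
  rewrite -[RHS](_ : nsum (size l) (i :: I) (fun s => (all2 b l s)%:R%:E) = _)//.
  rewrite IH/=; last by rewrite iI.
  congr ((falling _ _ _)%:R%:E); apply/funext => c /=; congr (_ + _)%N.
  congr nat_of_bool; apply/idP/eqP => [bc|->//]; exact: bdisj bc bi.
by rewrite (@nneseries_count (b c0) (L c0))// -EFinM -natrM.
Qed.

Lemma nsum_all (b : pred nat) (L I : seq nat) q :
  uniq L -> (forall i, (i \in L) = b i) -> uniq I ->
  (size L <= q + count b I)%N ->
  nsum q I (fun s => (all b s)%:R%:E) =
  (if size L == (q + count b I)%N then q`! else 0%N)%:R%:E :> \bar R.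
Proof.
move=> uL Lb uI Lq.
rewrite (@eq_nsum _ q I _ (fun s => (all2 (fun=> b) (nseq q tt) s)%:R%:E)); last first.
  move=> s <- _ _; congr (_%:R%:E); congr nat_of_bool.
  by elim: s {Lq} => //= i s ->.
have := @nsum_all2 unit (fun=> b) (fun=> L) (nseq q tt) I.
rewrite size_nseq => -> //; last by move=> i [] [].
congr (_%:R%:E).
have cq : count_mem tt (nseq q tt) = q by rewrite count_nseq mul1n.
case: ifPn => [/eqP LE|LE].
  rewrite falling_full; last by case; rewrite cq.
  by rewrite (bigD1 tt)//= cq big1 ?muln1// => -[].
apply: (@falling_short _ _ _ _ tt); rewrite cq ltn_neqAle LE Lq andbT.
by rewrite andbT -size_filter uniq_leq_size ?filter_uniq// => i; rewrite mem_filter Lb => /andP[].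
Qed.

End counting_lists.

(** * P4 *)
HB.instance Definition _ (R : realType) := Measure.on (@area R).

Lemma area_setX (R : realType) (A B : set (measurableTypeR R)) :
  measurable A -> measurable B ->
  (area (A `*` B) = lebesgue_measure A * lebesgue_measure B)%E.
Proof. exact: product_measure1E. Qed.

Section counts.
Context d (T : measurableType d) (R : realType).
Local Open Scope ereal_scope.

Lemma point_countE (X : nat -> T -> plane R) A w :
  point_count X A w = \sum_(i <oo) (\1_A (X i w) : R)%:E.
Proof.
rewrite /point_count counting_dirac; apply: eq_eseriesr => i _.
by rewrite diracE indicE; congr ((nat_of_bool _)%:R%:E); apply/idP/idP; rewrite !inE.
Qed.

Lemma measurable_point_count (X : nat -> T -> plane R) A (k : nat) :
  (forall i, measurable_fun setT (X i)) -> measurable A ->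
  measurable [set w | point_count X A w = k%:R%:E].
Proof.
move=> mX mA.
have -> : [set w | point_count X A w = k%:R%:E] =
    setT `&` (fun w => \sum_(i <oo) (\1_A (X i w) : R)%:E) @^-1` [set (k%:R : R)%:E].
  by apply/seteqP; split=> w /=; rewrite point_countE; [move=> ->|case].
have : measurable_fun setT (fun w => \sum_(i <oo) (\1_A (X i w) : R)%:E).
  apply: (ge0_emeasurable_sum (h := fun i w => (\1_A (X i w) : R)%:E) (P := xpredT)).
    by move=> i w _ _; rewrite lee_fin.
  by move=> i _; apply/measurable_EFinP; apply: measurableT_comp.
by apply => //; exact: emeasurable_set1.
Qed.

End counts.

Section sigma_of_measurable.
Context d (T : measurableType d) d' (U : measurableType d').

Definition sigma_of_gen (Y : nat -> T -> U) : set (set T) :=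
  [set E | exists i B, measurable B /\ E = Y i @^-1` B].

Lemma measurable_sigma_of (Y : nat -> T -> U) i :
  measurable_fun (setT : set (g_sigma_algebraType (sigma_of_gen Y))) (Y i).
Proof.
move=> _ B mB; rewrite setTI; apply: sub_sigma_algebra.
by exists i, B.
Qed.

End sigma_of_measurable.

Lemma measurable_all2 d (T : measurableType d) (R : realType) (U : Type)
    (r : U -> nat -> T -> bool) l s :
  (forall c i, measurable [set w | r c i w]) ->
  measurable_fun setT (fun w => (all2 (fun c i => r c i w) l s)%:R : R).
Proof.
move=> mr; elim: l s => [|c l IH] [|i s] //=.
rewrite (_ : (fun w => _) = (\1_[set w | r c i w] : T -> R) \*
    (fun w => (all2 (fun c i => r c i w) l s)%:R)).
  by apply: measurable_funM => //; exact: measurable_indic.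
apply/funext => w /=; rewrite indicE -mulnb natrM; congr ((nat_of_bool _)%:R * _).
by apply/idP/idP; rewrite inE.
Qed.

Section unmarked_janossy.
Context d (T : measurableType d) (R : realType) (P : probability T R).
Variables (lambda : R) (X : nat -> T -> plane R).
Hypothesis mX : forall i, measurable_fun setT (X i).
Hypothesis poisX : homogeneous_poisson P lambda X.
Local Open Scope ereal_scope.

Lemma poisson_finType (J : finType) (C : J -> set (plane R)) (k : J -> nat) :
  (forall c, measurable (C c)) -> (forall c, area (C c) < +oo) ->
  trivIset setT C ->
  P [set w | forall c, point_count X (C c) w = (k c)%:R%:E] =
  (\prod_c poisson_weight (lambda * fine (area (C c))) (k c))%:E.
Proof.
move=> mC fC tC.
have := poisX (A := fun i : 'I_#|J| => C (enum_val i)) (fun i => k (enum_val i)).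
rewrite -(big_enum_val (fun c => poisson_weight (lambda * fine (area (C c))) (k c))).
rewrite (eq_bigl xpredT)// => <-//; last first.
  move=> i j _ _ /= CC; apply: enum_val_inj; exact: tC CC.
congr (P _); apply/seteqP; split=> w /= H => [i|c]; first exact: H.
by have := H (enum_rank c); rewrite enum_rankK.
Qed.

Lemma point_count_sum (J : finType) (C : J -> set (plane R)) (W : set (plane R)) w :
  trivIset setT C -> (forall x, W x <-> exists c, C c x) ->
  point_count X W w = \sum_c point_count X (C c) w.
Proof.
move=> tC WC; rewrite point_countE.
under eq_bigr do rewrite point_countE.
rewrite -nneseries_sum//.
apply: eq_eseriesr => i _; rewrite !indicE.
have [/set_mem/WC[c Cc]|] := boolP (_ \in W).
  rewrite (bigD1 c)//= indicE mem_set// big1 ?adde0// => c' c'c.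
  rewrite indicE memNset// => Cc'; move/eqP : c'c; apply.
  by apply: tC => //; exists (X i w).
rewrite notin_setE => nW; rewrite big1// => c _.
by rewrite indicE memNset// => Cc; apply: nW; apply/WC; exists c.
Qed.

Lemma prod_count_mem (J : finType) (l : seq J) (a : J -> R) :
  (\prod_c a c ^+ count_mem c l = \prod_(c <- l) a c)%R.
Proof.
elim: l => [|c l IH] /=; first by rewrite big_nil big1.
rewrite big_cons -IH (bigD1 c)//= eqxx exprS -mulrA; congr (_ * _)%R.
rewrite [RHS](bigD1 c)//=; congr (_ * _)%R; apply: eq_bigr => c' cc'.
by rewrite eq_sym (negbTE cc').
Qed.

Lemma janossy_cells (J : finType) (C : J -> set (plane R)) (W : set (plane R)) (l : seq J) :
  (forall c, measurable (C c)) -> (forall c, area (C c) < +oo) ->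
  trivIset setT C -> (forall x, W x <-> exists c, C c x) ->
  \int[P]_w ((\1_[set w | point_count X W w = (size l)%:R%:E] w : R)%:E *
    nsum (size l) [::]
      (fun s => (all2 (fun c i => X i w \in C c) l s)%:R%:E)) =
  (expR (- (lambda * \sum_c fine (area (C c)))) *
   \prod_(c <- l) (lambda * fine (area (C c))))%:E.
Proof.
move=> mC fC tC WC.
pose F := [set w | forall c, point_count X (C c) w = (count_mem c l)%:R%:E].
have mF : measurable F.
  have -> : F = \bigcap_(c in [set: J]) [set w | point_count X (C c) w = (count_mem c l)%:R%:E].
    by apply/seteqP; split=> w /= H c => [_|]; exact: H.
  apply: fin_bigcap_measurable; first exact: finite_finset.
  by move=> c _; exact: measurable_point_count.
have PF : P F =
    (\prod_c poisson_weight (lambda * fine (area (C c))) (count_mem c l))%:E.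
  exact: poisson_finType.
pose N := (\prod_c (count_mem c l)`!)%N.
transitivity (\int[P]_w (N%:R%:E * (\1_F w : R)%:E)); last first.
  rewrite ge0_integralZl//; last by apply/measurable_EFinP; exact: measurable_indic.
  rewrite integral_indic// setIT// [X in _ * X]PF -EFinM; congr EFin.
  transitivity (\prod_c ((count_mem c l)`!%:R *
      poisson_weight (lambda * fine (area (C c))) (count_mem c l)))%R.
    by rewrite [RHS]big_split/= /N natr_prod.
  transitivity (\prod_c (expR (- (lambda * fine (area (C c)))) *
      (lambda * fine (area (C c))) ^+ count_mem c l))%R; last first.
    by rewrite [LHS]big_split/= prod_count_mem mulr_sumr -sumrN expR_sum.
  apply: eq_bigr => c _.
  rewrite /poisson_weight mulrC divfK//.
apply: eq_integral => w _; rewrite [X in (X)%:E * _]indicE [in RHS]indicE.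
have sumC := point_count_sum w tC WC.
have [/set_mem/= Wn|/negP nWn] := boolP (_ \in _); last first.
  rewrite mul0e memNset ?mule0// => Fw; apply: nWn; apply/mem_set => /=.
  rewrite sumC; under eq_bigr do rewrite Fw.
  by rewrite sumEFin -natr_sum sum_count_mem.
have /counting_seqP[L [uL LW sL]] := Wn.
pose Lc c := [seq i <- L | X i w \in C c].
have LcE c i : (i \in Lc c) = (X i w \in C c).
  rewrite mem_filter; have [/set_mem Cc|//] := boolP (X i w \in C c).
  by apply/LW/WC; exists c.
have pcC c : point_count X (C c) w = (size (Lc c))%:R%:E.
  apply/counting_seqP; exists (Lc c); split=> //; first exact: filter_uniq.
  by move=> i; rewrite LcE; split => [/set_mem|/mem_set].
rewrite mul1e (@nsum_all2 _ _ _ Lc)//.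
- rewrite falling_exact; last first.
    have : (size l)%:R%:E = \sum_c (size (Lc c))%:R%:E :> \bar R.
      by rewrite -Wn sumC; apply: eq_bigr => c _; rewrite pcC.
    by rewrite sumEFin -natr_sum => -[/eqP]; rewrite eqr_nat => /eqP ->.
  case: ifPn => [/forallP H|].
    rewrite mem_set ?mule1// => c; rewrite pcC; congr (_%:R%:E); exact/eqP.
  rewrite negb_forall => /existsP[c /eqP nc]; rewrite memNset ?mule0// => /(_ c).
  by rewrite pcC => -[/eqP]; rewrite eqr_nat => /eqP.
- move=> i c c' /set_mem Cc /set_mem Cc'; apply: tC => //.
  by exists (X i w).
- by move=> c; exact: filter_uniq.
Qed.

Lemma janossy_unmarked n (A : nat -> set (plane R)) (W : set (plane R)) :
  measurable W -> area W < +oo -> (forall k, measurable (A k)) ->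
  \int[P]_w ((\1_[set w | point_count X W w = n%:R%:E] w : R)%:E *
    nsum n [::] (fun s => (all2 (fun k i => X i w \in A k `&` W) (iota 0 n) s)%:R%:E)) =
  (expR (- (lambda * fine (area W))) *
   \prod_(k < n) (lambda * fine (area (A k `&` W))))%:E.
Proof.
move=> mW fW mA.
pose J := {ffun 'I_n -> bool}.
pose atom (x : plane R) : J := [ffun k : 'I_n => x \in A k].
pose C (c : J) := [set x | W x /\ atom x = c].
have mC c : measurable (C c).
  have -> : C c = W `&` \bigcap_(k in [set: 'I_n]) (if c k then A k else ~` A k).
    apply/seteqP; split=> x /= [Wx].
      move=> <-; split=> // k _; rewrite ffunE; case: ifPn => [/set_mem//|].
      by rewrite notin_setE.
    move=> H; split=> //; apply/ffunP => k; rewrite ffunE.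
    by have := H k I; case: (c k) => ?; [exact: mem_set|exact: memNset].
  apply: measurableI => //; apply: fin_bigcap_measurable; first exact: finite_finset.
  by move=> k _; case: ifP => // _; exact: measurableC.
have CW c : C c `<=` W by move=> x [].
have fC c : area (C c) < +oo.
  by apply: le_lt_trans fW; apply: le_measure; rewrite ?inE.
have tC : trivIset setT C.
  by move=> c c' _ _ [x [[_ H1] [_ H2]]]; rewrite -H1 -H2.
have WC x : W x <-> exists c, C c x.
  by split=> [Wx|[c []]//]; exists (atom x).
have areaU (Q : pred J) : \sum_(c | Q c) area (C c) = area [set x | W x /\ Q (atom x)].
  have -> : [set x | W x /\ Q (atom x)] =
      \bigcup_(c in [set` [seq c <- index_enum J | Q c]]) C c.
    apply/seteqP; split=> x /=.
      move=> [Wx Qx]; exists (atom x) => //=.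
      by rewrite mem_filter Qx mem_index_enum.
    by move=> [c /=]; rewrite mem_filter => /andP[Qc _] [Wx cE]; rewrite cE.
  rewrite measure_fin_bigcup//; last by apply: sub_trivIset tC.
  by rewrite -fsbig_seq ?filter_uniq ?index_enum_uniq// big_filter.
pose a c := fine (area (C c)).
have aE (Q : pred J) (B : set (plane R)) :
    B = [set x | W x /\ Q (atom x)] -> (\sum_(c | Q c) a c)%R = fine (area B).
  move=> ->; rewrite -areaU -sum_fine// => c _.
  by rewrite ge0_fin_numE// measure_ge0.
have aW : (\sum_c a c)%R = fine (area W).
  by apply: aE; apply/seteqP; split=> x //= [].
have aA (k : 'I_n) : (\sum_(c : J | c k) a c)%R = fine (area (A k `&` W)).
  apply: aE; apply/seteqP; split=> x /=; rewrite ffunE.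
    by move=> [Ax Wx]; split=> //; exact/mem_set.
  by move=> [Wx /set_mem].
pose en (f : {ffun 'I_n -> J}) := [seq f k | k <- enum 'I_n].
have sz_en (f : {ffun 'I_n -> J}) : size (en f) = n by rewrite size_map size_enum_ord.
pose Q (f : {ffun 'I_n -> J}) := [forall k : 'I_n, f k k].
pose rQ := [seq f <- index_enum {ffun 'I_n -> J} | Q f].
have ptw w s : size s = n ->
    (all2 (fun k i => X i w \in A k `&` W) (iota 0 n) s)%:R%:E =
    \sum_(f <- rQ) (all2 (fun c i => X i w \in C c) (en f) s)%:R%:E :> \bar R.
  move=> ss.
  have all2Pn (U : Type) (u0 : U) (r : U -> nat -> bool) l : size l = n ->
      reflect (forall k : 'I_n, r (nth u0 l k) (nth 0%N s k)) (all2 r l s).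
    move=> sl; apply: (iffP idP).
      rewrite all2E sl ss eqxx /= => /(all_nthP (u0, 0%N)) H k.
      by have := H k; rewrite size_zip sl ss minnn nth_zip ?sl ?ss//=; apply.
    move=> H; rewrite all2E sl ss eqxx /=; apply/(all_nthP (u0, 0%N)) => k.
    rewrite size_zip sl ss minnn => kn; rewrite nth_zip ?sl ?ss//=.
    exact: (H (Ordinal kn)).
  have nth_en (f : {ffun 'I_n -> J}) (k : 'I_n) : nth ([ffun=> false] : J) (en f) k = f k.
    by rewrite (nth_map k) ?size_enum_ord// nth_ord_enum.
  have enP (f : {ffun 'I_n -> J}) : reflect (forall k : 'I_n, C (f k) (X (nth 0%N s k) w))
      (all2 (fun c i => X i w \in C c) (en f) s).
    apply: (iffP (all2Pn J [ffun=> false] _ _ (sz_en f))) => H k; have := H k.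
      by rewrite nth_en => /set_mem.
    by rewrite nth_en => /mem_set.
  have AP : reflect (forall k : 'I_n, (A k `&` W) (X (nth 0%N s k) w))
      (all2 (fun k i => X i w \in A k `&` W) (iota 0 n) s).
    apply: (iffP (all2Pn _ 0%N _ _ (size_iota 0 n))) => H k; have := H k.
      by rewrite nth_iota// => /set_mem.
    by rewrite nth_iota// => /mem_set.
  have [sW|sW] := pselect (forall k : 'I_n, W (X (nth 0%N s k) w)); last first.
    rewrite big1; last first.
      move=> f _; case: enP => // H; exfalso; apply: sW => k.
      exact: CW (H k).
    by case: AP => // H; exfalso; apply: sW => k; have [] := H k.
  pose f0 : {ffun 'I_n -> J} := [ffun k : 'I_n => atom (X (nth 0%N s k) w)].
  have enE (f : {ffun 'I_n -> J}) : all2 (fun c i => X i w \in C c) (en f) s = (f == f0).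
    apply/enP/eqP => [H|-> k]; last by rewrite ffunE; split=> //; exact: sW.
    by apply/ffunP => k; rewrite ffunE; have [_ ->] := H k.
  have QE : all2 (fun k i => X i w \in A k `&` W) (iota 0 n) s = Q f0.
    apply/AP/forallP => H k.
      by have [Ak _] := H k; rewrite !ffunE; exact/mem_set.
    split; last exact: sW.
    by have := H k; rewrite !ffunE => /set_mem.
  rewrite QE; under eq_bigr do rewrite enE.
  rewrite big_filter big_mkcond (bigD1 f0)//= eqxx big1 ?adde0; first by case: ifP.
  by move=> f /negbTE ->; rewrite if_same.
transitivity (\sum_(f <- rQ) \int[P]_w ((\1_[set w | point_count X W w = n%:R%:E] w : R)%:E *
    nsum n [::] (fun s => (all2 (fun c i => X i w \in C c) (en f) s)%:R%:E))).
  rewrite -ge0_integral_sum//.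
  - apply: eq_integral => w _; rewrite -ge0_sume_distrr; last first.
      by move=> f _; exact: nsum_ge0.
    congr (_ * _); rewrite -nsum_sum//.
    by apply: eq_nsum => s ss _ _; rewrite ptw.
  - move=> f; apply: emeasurable_funM.
      by apply/measurable_EFinP; apply: measurable_indic; exact: measurable_point_count.
    apply: (measurable_nsum n [::] (G := fun s w =>
      (all2 (fun c i => X i w \in C c) (en f) s)%:R%:E)) => // s.
    apply/measurable_EFinP.
    apply: (measurable_all2 (r := fun c i w => X i w \in C c)) => c i.
    have := mX i measurableT (mC c); rewrite setTI => mXC.
    rewrite (_ : [set w | _] = X i @^-1` C c)//.
    by apply/seteqP; split=> w /=; rewrite inE.
  - by move=> f w _; apply: mule_ge0; [rewrite lee_fin|exact: nsum_ge0].
transitivity (\sum_(f <- rQ) (expR (- (lambda * fine (area W))) *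
    \prod_(k < n) (lambda * a (f k)))%R%:E).
  apply: eq_bigr => f _; rewrite -{1 2}(sz_en f) janossy_cells// aW.
  by rewrite big_map -big_enum.
rewrite sumEFin -mulr_sumr big_filter; congr (_ * _)%R%:E.
under [RHS]eq_bigr do rewrite -aA mulr_sumr.
by rewrite bigA_distr_big_dep; apply: eq_bigl => f; apply/forallP/familyP.
Qed.

End unmarked_janossy.

(** * P5 *)
Section window_area.
Context (R : realType).
Variables (W : set (plane R)) (mW : measurable W) (fW : (area W < +oo)%E).

Definition warea := let _ := fW in mrestr (@area R) mW.

HB.instance Definition _ := Measure.on warea.

Let warea_fin : fin_num_fun warea.
Proof.
have : (warea setT < +oo)%E by rewrite /warea /mrestr setTI.
exact: lty_fin_num_fun.
Qed.

HB.instance Definition _ := Measure_isFinite.Build _ _ _ warea warea_fin.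

End window_area.

Notation mark R := (measurableTypeR R).
Notation site R := (plane R * mark R)%type.

Section marked_janossy.
Context d (T : measurableType d) (R : realType) (P : probability T R).
Variables (lambda : R) (X : nat -> {RV P >-> plane R})
  (Theta : nat -> {RV P >-> measurableTypeR R}).
Hypothesis lambda0 : 0 <= lambda.
Hypothesis poisX : homogeneous_poisson P lambda X.
Hypothesis unifTheta : iid_uniform_angles Theta.
Hypothesis indXTheta : independent_sequences P X Theta.
Variables (W : set (plane R)) (mW : measurable W) (fW : (area W < +oo)%E).
Local Open Scope ereal_scope.

Definition angle_law : {finite_measure set (mark R) -> \bar R} :=
  uniform_prob (ltNpi R).

Definition site_law : {finite_measure set (site R) -> \bar R} :=
  finprod (warea mW fW) angle_law.

Definition marked i w : site R := (X i w, Theta i w).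

Lemma measurable_marked i : measurable_fun setT (marked i).
Proof. exact: measurable_fun_pair. Qed.

Definition in_window n s : set T :=
  [set w | point_count X W w = n%:R%:E /\ all (fun i => X i w \in W) s].

Lemma measurable_in_window n s : measurable (in_window n s).
Proof.
have -> : in_window n s = [set w | point_count X W w = n%:R%:E] `&`
    \big[setI/setT]_(i <- s) (X i @^-1` W).
  apply/seteqP; split=> w /= [wn H]; split=> //.
    elim: s H => [|i s IH] /=; first by rewrite big_nil.
    by rewrite big_cons => /andP[/set_mem ? /IH].
  elim: s H => [|i s IH] //=; rewrite big_cons => -[/mem_set ? /IH ?].
  exact/andP.
apply: measurableI; first by apply: measurable_point_count.
apply: bigsetI_measurable => i _.
by rewrite -[_ @^-1` _]setTI; exact: measurable_funPT.
Qed.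

Definition tuple_law n s : {measure set (powT (site R) n) -> \bar R} :=
  measure_function_pushforward__canonical__measure_function_Measure
    (mrestr P (@measurable_in_window n s))
    (@measurable_powpt _ (site R) _ _ _ n s measurable_marked).

Lemma angles_independent n (D : nat -> set (mark R)) s :
  (forall k, measurable (D k)) -> size s = n -> uniq s ->
  P [set w | forall k, (k < n)%N -> D k (Theta (nth 0%N s k) w)] =
  \prod_(k < n) angle_law (D k).
Proof.
move=> mD ss us.
have [ident indep] := unifTheta.
have := indep s (fun i => D (index i s)) us (fun i => mD _).
rewrite (big_nth 0%N) big_mkord ss => H.
transitivity (P [set w | forall i, i \in s -> D (index i s) (Theta i w)]).
  congr (P _); apply/seteqP; split=> w /= Dw.
    move=> i is_; have := Dw (index i s).
    by rewrite nth_index// -ss index_mem; apply.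
  by move=> k kn; have := Dw (nth 0%N s k); rewrite index_uniq ?ss//; apply; rewrite mem_nth ?ss.
rewrite H; apply: eq_bigr => k _.
rewrite index_uniq ?ss//; exact: ident.
Qed.

Let gX := g_sigma_algebraType (sigma_of_gen (fun i => X i : T -> plane R)).
Let gTh := g_sigma_algebraType (sigma_of_gen (fun i => Theta i : T -> mark R)).

Definition points_event n (A : nat -> set (plane R)) s : set T :=
  [set w | point_count X W w = n%:R%:E /\
     all2 (fun k i => X i w \in A k `&` W) (iota 0 n) s].

Lemma measurable_points_event d' (T' : measurableType d') (Y : nat -> T' -> plane R) n
    (A : nat -> set (plane R)) s : (forall i, measurable_fun setT (Y i)) ->
  (forall k, measurable (A k)) ->
  measurable [set w | point_count Y W w = n%:R%:E /\
     all2 (fun k i => Y i w \in A k `&` W) (iota 0 n) s].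
Proof.
move=> mY mA; apply: (@measurableI _ _ [set w | point_count Y W w = n%:R%:E]
  [set w | is_true (all2 (fun k i => Y i w \in A k `&` W) (iota 0 n) s)]).
  exact: measurable_point_count.
have := @measurable_all2 _ T' R nat (fun k i w => Y i w \in A k `&` W) (iota 0 n) s.
set f := (fun w => _); move=> mf.
rewrite (_ : [set w | _] = setT `&` f @^-1` [set 1%R]).
  apply: mf => // k i; rewrite (_ : [set w | _] = setT `&` Y i @^-1` (A k `&` W)).
    by apply: mY => //; exact: measurableI.
  by apply/seteqP; split=> w /=; [move=> /set_mem|move=> [_ ?]; apply/mem_set].
apply/seteqP; split=> w /=; rewrite /f; first by move=> ->.
by case: all2 => // -[_ /eqP]; rewrite eq_sym oner_eq0.
Qed.

Lemma tuple_law_box n (A : nat -> set (plane R)) D s :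
  (forall k, measurable (A k)) -> (forall k, measurable (D k)) ->
  size s = n -> uniq s ->
  tuple_law n s (box n A D) =
  (\prod_(k < n) angle_law (D k)) * P (points_event n A s).
Proof.
move=> mA mD ss us.
pose Eth := [set w | forall k, (k < n)%N -> D k (Theta (nth 0%N s k) w)].
transitivity (P (points_event n A s `&` Eth)).
  rewrite /tuple_law/= /pushforward /mrestr; congr (P _).
  have allE w : all2 (fun k i => X i w \in A k `&` W) (iota 0 n) s <->
      forall k, (k < n)%N -> (A k `&` W) (X (nth 0%N s k) w).
    rewrite all2E size_iota ss eqxx /=; split.
      move=> /(all_nthP (0%N, 0%N)) H k kn.
      have := H k; rewrite size_zip size_iota ss minnn nth_zip ?size_iota ?ss//=.
      by rewrite nth_iota// => /(_ kn)/set_mem.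
    move=> H; apply/(all_nthP (0%N, 0%N)) => k.
    rewrite size_zip size_iota ss minnn => kn.
    rewrite nth_zip ?size_iota ?ss//= nth_iota//; exact/mem_set/H.
  apply/seteqP; split=> w /=.
    move=> [/(box_powpt A D (fun i => marked i w) ss) H [wn /(all_nthP 0%N) sW]].
    split; [split=> //; apply/allE => k kn; split|].
    - by have [] := H k kn.
    - by apply/set_mem/sW; rewrite ss.
    - by move=> k kn; have [] := H k kn.
  move=> [[wn /allE sA] sD]; split.
    apply/(box_powpt A D (fun i => marked i w) ss) => k kn; split; last exact: sD.
    by have [] := sA k kn.
  split=> //; apply/(all_nthP 0%N) => k; rewrite ss => kn.
  by apply/mem_set; have [] := sA k kn.
rewrite (indXTheta (E := points_event n A s) (F := Eth)).
- by rewrite muleC; congr (_ * _); exact: angles_independent.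
- apply: (@measurable_points_event _ gX) => // i.
  exact: measurable_sigma_of.
- have -> : Eth = \bigcap_(k in `I_n) (Theta (nth 0%N s k) @^-1` D k).
    by apply/seteqP; split=> w /= H k /= kn; exact: H.
  rewrite -[sigma_of _ _]/(measurable (_ : set gTh)).
  apply: fin_bigcap_measurable; first exact: finite_II.
  move=> k _; rewrite -[_ @^-1` _]setTI; exact: measurable_sigma_of.
Qed.

Lemma janossy n (Y : set (powT (site R) n)) : measurable Y ->
  nmeasure n [::] (tuple_law n) Y =
  (expR (- (lambda * fine (area W))) * lambda ^+ n)%:E * powmeas site_law n Y.
Proof.
apply: powmeas_unique => [||A D mA mD].
- by rewrite lee_fin mulr_ge0 ?expR_ge0 ?exprn_ge0.
- by [].
rewrite nmeasureE (@eq_nsum _ n _ _ (fun s => (\prod_(k < n) fine (angle_law (D k)))%R%:E *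
    P (points_event n A s))); last first.
  move=> s ss us _; rewrite tuple_law_box// -prodEFin; congr (_ * _).
  by apply: eq_bigr => k _; rewrite fineK//; exact: fin_num_measure.
rewrite nsumZl; last by [].
pose g s w : \bar R := (\1_[set w | point_count X W w = n%:R%:E] w : R)%:E *
  (all2 (fun k i => X i w \in A k `&` W) (iota 0 n) s)%:R%:E.
have gE s w : g s w = (\1_(points_event n A s) w)%:E.
  rewrite /g !indicE -EFinM -natrM mulnb; congr (_%:R%:E); congr nat_of_bool.
  apply/andP/idP; rewrite !inE => -[] //.
have mpe s : measurable (points_event n A s) by exact: measurable_points_event.
rewrite (_ : (fun s => P (points_event n A s)) = (fun s => \int[P]_w g s w)); last first.
  apply/funext => s; under eq_integral do rewrite gE.
  by rewrite integral_indic// setIT.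
rewrite -integral_nsum; last 2 first.
- by move=> s w; rewrite gE lee_fin.
- move=> s; rewrite (_ : g s = EFin \o \1_(points_event n A s)).
    by apply/measurable_EFinP; exact: measurable_indic.
  by apply/funext => w; rewrite gE.
rewrite (eq_integral (fun w => (\1_[set w | point_count X W w = n%:R%:E] w : R)%:E *
    nsum n [::] (fun s =>
      (all2 (fun k i => X i w \in A k `&` W) (iota 0 n) s)%:R%:E))); last first.
  by move=> w _; rewrite /g nsumZl.
rewrite (@janossy_unmarked _ T R P lambda X _ poisX n A W mW fW mA)//.
have -> : \prod_(k < n) (warea mW fW (A k) * angle_law (D k)) =
    (\prod_(k < n) (fine (area (A k `&` W)) * fine (angle_law (D k))))%R%:E.
  rewrite -prodEFin; apply: eq_bigr => k _; rewrite EFinM !fineK//; first last.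
    exact: (fin_num_measure (warea mW fW)).
  exact: fin_num_measure.
rewrite -!EFinM !big_split/= prodr_const card_ord; congr EFin.
by rewrite mulrC -!mulrA.
Qed.

End marked_janossy.

(** * P6 *)
Section integral_tools.
Context d (T : measurableType d) (R : realType).
Local Open Scope ereal_scope.

Lemma integral_mrestr (mu : {measure set T -> \bar R}) (D : set T) (mD : measurable D)
    (f : T -> \bar R) : (forall x, 0 <= f x) -> measurable_fun setT f ->
  \int[mrestr mu mD]_x f x = \int[mu]_x ((\1_D x : R)%:E * f x).
Proof.
move=> f0 mf; pose g x := (\1_D x : R)%:E * f x.
have g0 x : 0 <= g x by rewrite mule_ge0// lee_fin.
have mg : measurable_fun setT g.
  by apply: emeasurable_funM => //; apply/measurable_EFinP; exact: measurable_indic.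
have mCD : measurable (~` D) by exact: measurableC.
rewrite -/g [RHS](@eq_measure_integral _ _ _ _ (measure_add (mrestr mu mD) (mrestr mu mCD))); last first.
  move=> A mA _; rewrite [RHS]measure_addE/= /mrestr -[in LHS](setIT A) -(setUv D) setIUr.
  rewrite measureU//; [exact: measurableI|exact: measurableI|].
  by rewrite setIACA setICr !setI0.
rewrite (@ge0_integral_measure_add _ _ _ _ _ setT measurableT g)//.
rewrite [X in _ + X](_ : _ = 0); last first.
  rewrite (ge0_negligible_integral (N := D))//; last by rewrite /= /mrestr setICr measure0.
  by apply: integral0_eq => x [_ nDx]; rewrite /g indicE memNset// mul0e.
rewrite adde0 (ge0_negligible_integral (N := ~` D) _ _ mf)//; last first.
  by rewrite /= /mrestr setICl measure0.
rewrite [RHS](ge0_negligible_integral (N := ~` D))//; last first.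
  by rewrite /= /mrestr setICl measure0.
apply: eq_integral => x; rewrite inE => -[_ /contrapT Dx].
by rewrite /g indicE mem_set// mul1e.
Qed.

Lemma nneseries_exp (x : R) : (0 <= x)%R ->
  \sum_(n <oo) (x ^+ n / n`!%:R)%:E = (expR x)%:E.
Proof.
move=> x0; rewrite /expR -EFin_lim; last exact: is_cvg_series_exp_coeff.
apply: congr_lim; apply/funext => n /=.
by rewrite sumEFin.
Qed.

End integral_tools.

Section power_products.
Context d (Z : measurableType d) d' (U : measurableType d') (R : realType).
Variables (nu : {finite_measure set Z -> \bar R}) (B : set (U * Z)).
Hypothesis mB : measurable B.
Local Open Scope ereal_scope.

Fixpoint avoid q (p : U) : powT Z q -> \bar R :=
  match q with
  | 0 => fun=> 1
  | q'.+1 => fun y => (\1_(~` B) (p, y.1) : R)%:E * avoid p y.2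
  end.
Arguments avoid : clear implicits.

Lemma avoid_ge0 q p y : 0 <= avoid q p y.
Proof. by elim: q y => [|q IH] y //=; rewrite mule_ge0// lee_fin. Qed.

Lemma measurable_avoid q :
  measurable_fun setT (fun py : U * powT Z q => avoid q py.1 py.2).
Proof.
elim: q => [|q IH] /=; first exact: measurable_cst.
apply: emeasurable_funM.
  apply/measurable_EFinP.
  apply: (measurableT_comp (f := \1_(~` B) : U * Z -> R)
    (g := fun py : U * (Z * powT Z q) => (py.1, py.2.1))).
    by apply: measurable_indic; exact: measurableC.
  apply: measurable_fun_pair; first exact: measurable_fst.
  by apply: measurableT_comp => //; exact: measurable_snd.
apply: (measurableT_comp (f := fun py : U * powT Z q => avoid q py.1 py.2)
  (g := fun py : U * (Z * powT Z q) => (py.1, py.2.2))) => //.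
apply: measurable_fun_pair; first exact: measurable_fst.
by apply: measurableT_comp => //; exact: measurable_snd.
Qed.

Lemma integral_avoid q p :
  \int[powmeas nu q]_y avoid q p y = nu (~` xsection B p) ^+ q.
Proof.
have mxB : measurable (xsection B p) by exact: measurable_xsection.
elim: q => [|q IH].
  by rewrite expe0 /= integral_cst// mul1e [LHS]diracT.
rewrite expeS -IH /= -[finprod _ _]/(nu \x powmeas nu q).
have ma r : measurable_fun setT (avoid r p).
  apply: (measurableT_comp (f := fun py : U * powT Z r => avoid r py.1 py.2)
    (g := fun y => (p, y))); first exact: measurable_avoid.
  exact: measurable_fun_pair.
rewrite fubini_tonelli1//; last 2 first.
- exact: (ma q.+1).
- by move=> y; exact: (@avoid_ge0 q.+1).
rewrite /fubini_F/=.
rewrite (eq_integral (fun x => (\1_(~` B) (p, x) : R)%:E *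
    \int[powmeas nu q]_y avoid q p y)); last first.
  move=> x _; rewrite ge0_integralZl//.
  by move=> y _; exact: avoid_ge0.
have m1 : measurable_fun setT (fun x => (\1_(~` B) (p, x) : R)%:E).
  apply/measurable_EFinP.
  apply: (measurableT_comp (f := \1_(~` B) : U * Z -> R) (g := fun x => (p, x))).
    by apply: measurable_indic; exact: measurableC.
  exact: measurable_fun_pair.
have i0 : 0 <= \int[powmeas nu q]_y avoid q p y.
  by apply: integral_ge0 => y _; exact: avoid_ge0.
rewrite ge0_integralZr//.
congr (_ * _).
rewrite (eq_integral (fun x => (\1_(~` xsection B p) x)%:E)).
  by rewrite integral_indic ?setIT//; exact: measurableC.
move=> x _; rewrite !indicE; congr ((nat_of_bool _)%:R%:E).
by rewrite !in_setC; congr (~~ _); rewrite [RHS]mem_xsection.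
Qed.

End power_products.
Arguments avoid {d Z d' U R} B q p y.

(** * P7 *)
Section finite_product_integral.
Context (R : realType).
Local Open Scope ereal_scope.

Lemma integral_finprod d1 d2 (T1 : measurableType d1) (T2 : measurableType d2)
    (m1 : {finite_measure set T1 -> \bar R})
    (m2 : {finite_measure set T2 -> \bar R}) (f : T1 * T2 -> \bar R) :
  (forall p, 0 <= f p) -> measurable_fun setT f ->
  \int[finprod m1 m2]_p f p = \int[m1]_x \int[m2]_y f (x, y).
Proof. by move=> f0 mf; rewrite /finprod (fubini_tonelli1 (m1 := m1) (m2 := m2)). Qed.

Lemma integral_powmeasS d (T : measurableType d)
    (m : {finite_measure set T -> \bar R}) n (f : powT T n.+1 -> \bar R) :
  (forall p, 0 <= f p) -> measurable_fun setT f ->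
  \int[powmeas m n.+1]_p f p = \int[m]_x \int[powmeas m n]_y f (x, y).
Proof. exact: integral_finprod. Qed.

End finite_product_integral.

Section mecke_window.
Context d (T : measurableType d) (R : realType) (P : probability T R).
Variables (lambda : R) (X : nat -> {RV P >-> plane R})
  (Theta : nat -> {RV P >-> measurableTypeR R}).
Hypothesis lambda0 : 0 <= lambda.
Hypothesis poisX : homogeneous_poisson P lambda X.
Hypothesis unifTheta : iid_uniform_angles Theta.
Hypothesis indXTheta : independent_sequences P X Theta.
Variables (W : set (plane R)) (mW : measurable W) (fW : (area W < +oo)%E).
Local Open Scope ereal_scope.

Let Z := (plane R * mark R)%type.
Let U := (Z * (Z * Z))%type.
Let z : nat -> T -> Z := marked X Theta.
Let nu : {finite_measure set Z -> \bar R} := site_law mW fW.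
Let inW s w := all (fun i => X i w \in W) s.
Let EN n : set T := [set w | point_count X W w = n%:R%:E].

Let mz i : measurable_fun setT (z i). Proof. exact: measurable_marked. Qed.

Let mEN n : measurable (EN n).
Proof. exact: measurable_point_count. Qed.

Lemma janossy_integral n (f : powT Z n -> \bar R) :
  (forall y, 0 <= f y) -> measurable_fun setT f ->
  \int[P]_w ((\1_(EN n) w : R)%:E *
     nsum n [::] (fun s => (inW s w)%:R%:E * f (powpt (z ^~ w) n s))) =
  (expR (- (lambda * fine (area W))) * lambda ^+ n)%:E * \int[powmeas nu n]_y f y.
Proof.
move=> f0 mf.
have c0 : (0 <= expR (- (lambda * fine (area W))) * lambda ^+ n)%R.
  by rewrite mulr_ge0 ?expR_ge0 ?exprn_ge0.
have mfz s : measurable_fun setT (fun w => f (powpt (z ^~ w) n s)).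
  by apply: (measurableT_comp (f := f)) => //; exact: measurable_powpt.
rewrite -[_%:E]/((NngNum c0)%:num%:E) -ge0_integral_mscale//.
rewrite (@eq_measure_integral _ _ _ _ (nmeasure n [::] (tuple_law X Theta mW n))); last first.
  by move=> A mA _; rewrite /= (janossy lambda0 poisX unifTheta indXTheta).
rewrite integral_nmeasure//.
pose g s w : \bar R := (\1_(in_window X W n s) w : R)%:E * f (powpt (z ^~ w) n s).
have mg s : measurable_fun setT (g s).
  apply: emeasurable_funM => //; apply/measurable_EFinP; apply: measurable_indic.
  exact: measurable_in_window.
have g0 s w : 0 <= g s w by rewrite mule_ge0// lee_fin.
transitivity (nsum n [::] (fun s => \int[P]_w g s w)); last first.
  apply: eq_nsum => s _ _ _; rewrite /tuple_law /=.
  rewrite ge0_integral_pushforward//; last exact: measurable_powpt.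
  rewrite preimage_setT integral_mrestr//; first by move=> w; exact: f0.
  exact: mfz.
rewrite -integral_nsum//; apply: eq_integral => w _.
rewrite -nsumZl; last by move=> s; rewrite mule_ge0// lee_fin.
apply: eq_nsum => s _ _ _; rewrite /g muleA; congr (_ * _).
rewrite !indicE -EFinM -natrM mulnb; congr ((nat_of_bool _)%:R%:E).
by apply/andP/idP; rewrite !inE => -[].
Qed.

Lemma point_count_ae : P (~` \bigcup_n EN n) = 0.
Proof.
have PEN n : P (EN n) = (poisson_weight (lambda * fine (area W)) n)%:E.
  have := @poisson_finType _ _ _ _ _ _ poisX unit (fun=> W) (fun=> n).
  rewrite (bigD1 tt)//= big1 ?mulr1; last by case.
  move=> <- //; last by move=> [] [].
  by congr (P _); apply/seteqP; split=> w /=; [move=> ? []|apply; exact: tt].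
have mU : measurable (\bigcup_n EN n) by exact: bigcupT_measurable.
have tEN : trivIset setT EN.
  move=> m n _ _ [w [wm wn]]; move: wm wn; rewrite /EN /= => -> [/eqP].
  by rewrite eqr_nat => /eqP.
rewrite probability_setC// measure_bigcup//.
rewrite (eq_eseriesl (Q := xpredT)); last by move=> n; rewrite in_setT.
rewrite (eq_eseriesr (g := fun n => (expR (- (lambda * fine (area W))))%:E *
    ((lambda * fine (area W)) ^+ n / n`!%:R)%:E)); last first.
  by move=> n _; rewrite [LHS]PEN /poisson_weight -EFinM mulrA.
have l0 : (0 <= lambda * fine (area W))%R by rewrite mulr_ge0// fine_ge0.
rewrite nneseriesZl; last by move=> n _; rewrite lee_fin mulr_ge0 ?exprn_ge0.
by rewrite nneseries_exp// -EFinM -expRD addNr expR0 subee.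
Qed.

Variables (u : U -> R) (B : set (U * Z)).
Hypotheses (u0 : forall p, (0 <= u p)%R) (mu : measurable_fun setT u) (mB : measurable B).

Definition triple s w : U :=
  (z (nth 0%N s 0) w, (z (nth 0%N s 1) w, z (nth 0%N s 2) w)).

Definition clear s : set T :=
  [set w | forall k, k \notin s -> W (X k w) -> ~ B (triple s w, z k w)].

Lemma measurable_triple s : measurable_fun setT (triple s).
Proof.
apply: measurable_fun_pair; first exact: mz.
by apply: measurable_fun_pair; exact: mz.
Qed.

Lemma measurable_clear s : measurable (clear s).
Proof.
have -> : clear s = \bigcap_k (if k \in s then setT else
    ~` (X k @^-1` W `&` (fun w => (triple s w, z k w)) @^-1` B)).
  apply/seteqP; split=> w /= H k.
    by move=> _; case: ifPn => // ks [Wk]; exact: H.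
  by move=> ks Wk BB; have := H k I; rewrite ifN//; apply.
apply: bigcapT_measurable => k; case: ifPn => // _.
apply/measurableC/measurableI.
  by rewrite -[_ @^-1` _]setTI; exact: measurable_funPT.
rewrite -[_ @^-1` _]setTI.
have : measurable_fun setT (fun w => (triple s w, z k w)).
  by apply: measurable_fun_pair; [exact: measurable_triple|exact: mz].
by apply.
Qed.

Definition mecke_sum w : \bar R :=
  nsum 3 [::] (fun s => (inW s w)%:R%:E * ((u (triple s w))%:E * (\1_(clear s) w)%:E)).

Let m3 : {finite_measure set U -> \bar R} := finprod nu (finprod nu nu).

Lemma mecke_sum_ge0 w : 0 <= mecke_sum w.
Proof. by apply: nsum_ge0 => s; rewrite mule_ge0 ?mule_ge0 ?lee_fin. Qed.

Lemma measurable_inW s : measurable_fun setT (fun w => (inW s w)%:R%:E : \bar R).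
Proof.
apply/measurable_EFinP; elim: s => [|i s IH]; first exact: measurable_cst.
rewrite (_ : (fun w => _) =
  (fun w => (\1_(X i @^-1` W) w : R) * (inW s w)%:R)%R).
  apply: measurable_funM => //; apply: measurable_indic.
  by rewrite -[_ @^-1` _]setTI; exact: measurable_funPT.
by apply/funext => w /=; rewrite indicE -natrM mulnb.
Qed.

Lemma measurable_mecke_sum : measurable_fun setT mecke_sum.
Proof.
apply: (measurable_nsum 3 [::] (G := fun s w =>
  (inW s w)%:R%:E * ((u (triple s w))%:E * (\1_(clear s) w)%:E))).
  by move=> s w; rewrite mule_ge0 ?mule_ge0 ?lee_fin.
move=> s; apply: emeasurable_funM; first exact: measurable_inW.
apply: emeasurable_funM; apply/measurable_EFinP.
  by apply: measurableT_comp => //; exact: measurable_triple.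
by apply: measurable_indic; exact: measurable_clear.
Qed.

Let split_pt q (y : powT Z (3 + q)) : U := (y.1, (y.2.1, y.2.2.1)).
Let Psi q (y : powT Z (3 + q)) : \bar R :=
  (u (split_pt y))%:E * avoid B q (split_pt y) y.2.2.2.

Lemma measurable_split_pt q : measurable_fun setT (@split_pt q).
Proof.
rewrite /split_pt; apply: measurable_fun_pair; first exact: measurable_fst.
apply: measurable_fun_pair.
  by apply: (measurableT_comp (f := fst)) => //; exact: measurable_snd.
apply: (measurableT_comp (f := fst) (g := fun y : powT Z (3 + q) => y.2.2)) => //.
apply: (measurableT_comp (f := snd) (g := fun y : powT Z (3 + q) => y.2)) => //.
exact: measurable_snd.
Qed.

Lemma measurable_Psi q : measurable_fun setT (@Psi q).
Proof.
apply: emeasurable_funM.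
  apply/measurable_EFinP; apply: measurableT_comp => //; exact: measurable_split_pt.
apply: (measurableT_comp (f := fun py : U * powT Z q => avoid B q py.1 py.2)
   (g := fun y : powT Z (3 + q) => (split_pt y, y.2.2.2))).
  exact: measurable_avoid.
apply: measurable_fun_pair; first exact: measurable_split_pt.
apply: (measurableT_comp (f := snd) (g := fun y : powT Z (3 + q) => y.2.2)) => //.
apply: (measurableT_comp (f := snd) (g := fun y : powT Z (3 + q) => y.2)) => //.
exact: measurable_snd.
Qed.

Lemma Psi_ge0 q y : 0 <= @Psi q y.
Proof. by rewrite mule_ge0 ?lee_fin//; exact: avoid_ge0. Qed.

Lemma mecke_sum_tuples q w : EN (3 + q) w ->
  q`!%:R%:E * mecke_sum w = nsum (3 + q) [::]
    (fun s => (inW s w)%:R%:E * Psi (powpt (z ^~ w) (3 + q) s)).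
Proof.
move=> /counting_seqP[L [uL LW sL]].
rewrite nsum_cat -nsumZl; last by move=> s; rewrite mule_ge0 ?mule_ge0 ?lee_fin.
apply: eq_nsum => s ss us _.
pose good k := (X k w \in W) && ~~ `[< B (triple s w, z k w) >].
have mW' k : (X k w \in W) = (k \in L).
  by apply/idP/idP => [/set_mem/LW|/LW/mem_set].
pose c : R := ((inW s w)%:R * u (triple s w))%R.
have c0 : (0 <= c)%R by rewrite mulr_ge0.
rewrite (@eq_nsum _ q _ _ (fun s' => c%:E * (all good s')%:R%:E)); last first.
  move=> s' ss' _ _.
  have avE : (inW s' w)%:R%:E * avoid B q (triple s w) (powpt (z ^~ w) q s') =
      (all good s')%:R%:E :> \bar R.
    elim: (q) (s') ss' => [|q' IH] [|k s''] //= ss''; first by rewrite mul1e.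
    move: ss'' => [ss''].
    have gE : (good k)%:R%:E =
        (X k w \in W)%:R%:E * (\1_(~` B) (triple s w, z k w))%:E :> \bar R.
      rewrite indicE -EFinM -natrM mulnb in_setC; congr ((nat_of_bool (_ && ~~ _))%:R%:E).
    rewrite -(mulnb (good k)) -(mulnb (X k w \in W)) !natrM !EFinM gE -(IH _ ss'').
    by rewrite -!muleA; congr (_ * _); rewrite muleCA.
  rewrite -avE /Psi /inW all_cat -/(inW s w) -/(inW s' w).
  have -> : split_pt (powpt (z ^~ w) (3 + q) (s ++ s')) = triple s w.
    by case: s ss us {good c c0 avE} => [|i [|j [|l []]]].
  have -> : (powpt (z ^~ w) (3 + q) (s ++ s')).2.2.2 = powpt (z ^~ w) q s'.
    by case: s ss us {good c c0 avE} => [|i [|j [|l []]]].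
  rewrite -mulnb natrM EFinM /c EFinM -!muleA; congr (_ * _).
  by rewrite muleCA.
rewrite nsumZl; last by move=> s'; rewrite lee_fin.
have -> : q`!%:R%:E * ((inW s w)%:R%:E * ((u (triple s w))%:E * (\1_(clear s) w)%:E)) =
    c%:E * (q`!%:R%:E * (\1_(clear s) w)%:E) :> \bar R.
  rewrite -!EFinM; congr EFin; rewrite mulrCA -mulrA; congr (_ * _)%R.
  exact: mulrCA.
have [sW|sW] := boolP (inW s w); last first.
  by rewrite /c (negbTE sW) mul0r !mul0e.
have sL' : {subset s <= L}.
  by move=> i is_; rewrite -mW'; exact: (allP sW).
pose Lg := [seq k <- L | good k].
have LgE k : (k \in Lg) = good k.
  by rewrite mem_filter /good mW' andbC andbA andbb.
have ucs : uniq (catrev s [::]) by rewrite catrevE cats0 rev_uniq.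
have countE (b : pred nat) : count b (catrev s [::]) = count b s.
  by rewrite catrevE cats0 count_rev.
have cL (b : pred nat) : count b L = (count b s + count (predI b (predC (mem s))) L)%N.
  have -> : count b s = count (predI b (mem s)) L.
    rewrite -!size_filter; apply: perm_size; apply: uniq_perm; rewrite ?filter_uniq//.
    move=> i; rewrite !mem_filter /=; have [is_|] := boolP (i \in s); last by rewrite !andbF.
    by rewrite (sL' _ is_) !andbT.
  rewrite -(count_predUI) [X in (_ + X)%N](_ : _ = 0)%N; last first.
    by apply/eqP; rewrite -leqn0 leqNgt -has_count; apply/hasPn => i _ /=; case: (i \in s); rewrite !andbF.
  by rewrite addn0; apply: eq_count => i /=; case: (b i); case: (i \in s).
have cq : count (predC (mem s)) L = q.
  have := cL predT; rewrite !count_predT sL ss => /eqP; rewrite eqn_add2l => /eqP ->.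
  by apply: eq_count => i.
rewrite (@nsum_all _ good Lg)//; last 2 first.
- exact: filter_uniq.
- rewrite size_filter countE cL addnC leq_add2r -cq; apply: sub_count => i /=.
  by case/andP.
rewrite size_filter countE cL addnC eqn_add2r.
congr (_ * _); rewrite indicE.
have -> : (count (predI good (predC (mem s))) L == q) = (w \in clear s).
  rewrite -cq; apply/idP/idP.
    rewrite -count_filter -(size_filter (predC (mem s)) L) -all_count => /allP aG.
    apply/mem_set => k ks Wk Bk.
    have /andP[_] : good k.
      by apply: aG; rewrite mem_filter /= ks -mW'; exact/mem_set.
    by move=> /asboolPn; apply.
  move=> /set_mem cl; apply/eqP; apply: eq_in_count => k kL /=.
  have [ks|] := boolP (k \in s); rewrite ?andbF// andbT /good mW' kL /=.
  move=> ks; apply/negP => /asboolP Bk; apply: (cl k) => //; apply/set_mem; by rewrite mW'.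
by case: (_ \in _); rewrite ?mule1 ?mule0.
Qed.

Lemma integral_Psi q : \int[powmeas nu (3 + q)]_y Psi y =
  \int[m3]_p ((u p)%:E * nu (~` xsection B p) ^+ q).
Proof.
have mav p : measurable_fun setT (fun y => avoid B q p y : \bar R).
  apply: (measurableT_comp (f := fun py : U * powT Z q => avoid B q py.1 py.2)
    (g := fun y => (p, y))); first exact: measurable_avoid.
  exact: measurable_fun_pair.
have inner p : \int[powmeas nu q]_y ((u p)%:E * avoid B q p y) =
    (u p)%:E * nu (~` xsection B p) ^+ q.
  rewrite ge0_integralZl ?lee_fin//; last by move=> y _; exact: avoid_ge0.
  by congr (_ * _); exact: integral_avoid.
have mH : measurable_fun setT (fun p => (u p)%:E * nu (~` xsection B p) ^+ q).
  apply: emeasurable_funM; first exact/measurable_EFinP.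
  have mk : measurable_fun setT (fun p => nu (~` xsection B p)).
    rewrite (_ : (fun p => _) = nu \o xsection (~` B)).
      by apply: measurable_fun_xsection; exact: measurableC.
    apply/funext => p' /=; congr (nu _).
    by apply/seteqP; split=> x; rewrite /= /xsection /= !inE.
  elim: (q) => [|n IH]; first exact: measurable_cst.
  by under eq_fun do rewrite expeS; exact: emeasurable_funM.
have H0 p : 0 <= (u p)%:E * nu (~` xsection B p) ^+ q.
  by rewrite mule_ge0 ?lee_fin// expe_ge0.
have mPsi1 z1 : measurable_fun setT (fun y : powT Z (2 + q) => Psi ((z1, y) : powT Z (3 + q))).
  by apply: (measurableT_comp (measurable_Psi (q := q))); exact: measurable_fun_pair.
have mPsi2 z1 z2 : measurable_fun setT (fun y : powT Z (1 + q) => Psi ((z1, (z2, y)) : powT Z (3 + q))).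
  by apply: (measurableT_comp (mPsi1 z1)); exact: measurable_fun_pair.
have mH1 z1 : measurable_fun setT (fun y => (u (z1, y))%:E * nu (~` xsection B (z1, y)) ^+ q).
  by apply: (measurableT_comp mH); exact: measurable_fun_pair.
rewrite (@integral_powmeasS R _ Z nu (2 + q) (@Psi q) (@Psi_ge0 q) (@measurable_Psi q)).
rewrite (integral_finprod _ _ H0 mH).
apply: eq_integral => z1 _.
have Psi1 (y : powT Z (2 + q)) : 0 <= Psi ((z1, y) : powT Z (3 + q)) by exact: Psi_ge0.
rewrite (@integral_powmeasS R _ Z nu (1 + q) _ Psi1 (mPsi1 z1)).
rewrite (integral_finprod _ _ (fun y => H0 (z1, y)) (mH1 z1)).
apply: eq_integral => z2 _.
have Psi2 (y : powT Z (1 + q)) : 0 <= Psi ((z1, (z2, y)) : powT Z (3 + q)) by exact: Psi_ge0.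
rewrite (@integral_powmeasS R _ Z nu q _ Psi2 (mPsi2 z1 z2)).
by apply: eq_integral => z3 _; rewrite -inner.
Qed.

Lemma mecke_sum_small n w : (n < 3)%N -> EN n w -> mecke_sum w = 0.
Proof.
move=> n3 /counting_seqP[L [uL LW sL]].
transitivity (nsum 3 [::] (fun=> 0%:E * (0 : \bar R))); last first.
  by rewrite nsumZl// mul0e.
apply: eq_nsum => s ss us _; rewrite mul0e.
have [/allP sW|] := boolP (inW s w); last by rewrite mul0e.
suff : (size s <= size L)%N by rewrite ss sL leqNgt n3.
by apply: uniq_leq_size => // i /sW /set_mem/LW.
Qed.

Lemma site_lawT : nu setT = area W.
Proof.
transitivity (warea mW fW setT * (@angle_law R : set (mark R) -> \bar R) setT).
  have := finprodE (warea mW fW) (@angle_law R) measurableT measurableT.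
  by rewrite setXTT => <-.
rewrite [X in _ * X]probability_setT mule1.
by rewrite -[LHS]/(area (setT `&` W)) setTI.
Qed.

(** The multivariate Mecke formula for three points of the marked process seen
    in the window W. *)
Lemma mecke_window : \int[P]_w mecke_sum w =
  (lambda ^+ 3)%:E * \int[m3]_p
    ((u p)%:E * (expR (- (lambda * fine (nu (xsection B p)))))%:E).
Proof.
have mU : measurable (\bigcup_n EN n) by exact: bigcupT_measurable.
pose G n w : \bar R := (\1_(EN n) w : R)%:E * mecke_sum w.
have G0 n w : 0 <= G n w by rewrite mule_ge0 ?lee_fin// mecke_sum_ge0.
have mG n : measurable_fun setT (G n).
  apply: emeasurable_funM; last exact: measurable_mecke_sum.
  by apply/measurable_EFinP; exact: measurable_indic.
have GE n w : EN n w -> \sum_(k <oo) G k w = mecke_sum w.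
  move=> wn; rewrite (@nneseries_seq _ [:: n])//.
    by rewrite big_seq1 /G indicE mem_set// mul1e.
  move=> k; rewrite inE => kn; rewrite /G indicE memNset ?mul0e// => wk.
  move: wn wk; rewrite /EN /= => -> [/eqP]; rewrite eqr_nat eq_sym.
  by rewrite (negbTE kn).
transitivity (\int[P]_w \sum_(n <oo) G n w).
  apply: ge0_ae_eq_integral => //.
  - exact: measurable_mecke_sum.
  - exact: (ge0_emeasurable_sum (h := G) (P := xpredT)).
  - by move=> w _; exact: mecke_sum_ge0.
  - by move=> w _; exact: nneseries_ge0.
  exists (~` \bigcup_n EN n); split; first exact: measurableC.
    exact: point_count_ae.
  by move=> w /= H [n _ wn]; apply: H => _; rewrite (GE n).
rewrite integral_nneseries//.
pose e := expR (- (lambda * fine (area W))).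
pose kap p := fine (nu (~` xsection B p)).
have mxB p : measurable (xsection B p) by exact: measurable_xsection.
have kapE p : nu (~` xsection B p) = (kap p)%:E.
  by rewrite /kap fineK// fin_num_measure//; exact: measurableC.
have kap0 p : (0 <= kap p)%R by exact: fine_ge0.
have mkap : measurable_fun setT kap.
  rewrite /kap; apply: measurableT_comp => //.
  rewrite (_ : (fun p => _) = nu \o xsection (~` B)).
    by apply: measurable_fun_xsection; exact: measurableC.
  apply/funext => p /=; congr (nu _).
  by apply/seteqP; split=> x; rewrite /= /xsection /= !inE.
pose h q p : \bar R := ((u p * e) * ((lambda * kap p) ^+ q / q`!%:R))%:E.
have mh q : measurable_fun setT (h q).
  apply/measurable_EFinP; apply: measurable_funM.
    by apply: measurable_funM => //; exact: measurable_cst.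
  apply: measurable_funM; last exact: measurable_cst.
  by apply: measurable_funX; apply: measurable_funM => //; exact: measurable_cst.
have h0 q p : 0 <= h q p.
  by rewrite lee_fin !mulr_ge0 ?expR_ge0 ?exprn_ge0 ?mulr_ge0.
have term (q : nat) : \int[P]_w G (3 + q)%N w = (lambda ^+ 3)%:E * \int[m3]_p h q p.
  have fq : (q`!%:R != 0 :> R)%R by rewrite pnatr_eq0 -lt0n fact_gt0.
  have on_event (b : bool) (x y : \bar R) : (b -> q`!%:R%:E * x = y) ->
      b%:R%:E * x = (q`!%:R^-1)%:E * (b%:R%:E * y).
    case: b => [/(_ isT) <-|_]; last by rewrite !mul0e mule0.
    by rewrite !mul1e muleA -EFinM mulVf// mul1e.
  transitivity ((q`!%:R^-1)%:E * \int[P]_w ((\1_(EN (3 + q)%N) w : R)%:E *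
     nsum (3 + q) [::] (fun s => (inW s w)%:R%:E * Psi (powpt (z ^~ w) (3 + q) s)))).
    rewrite -ge0_integralZl//; last 2 first.
    - apply: emeasurable_funM.
        by apply/measurable_EFinP; exact: measurable_indic.
      apply: (measurable_nsum (3 + q) [::] (G := fun s w =>
          (inW s w)%:R%:E * Psi (powpt (z ^~ w) (3 + q) s))).
        by move=> s w; rewrite mule_ge0 ?lee_fin// Psi_ge0.
      move=> s; apply: emeasurable_funM; first exact: measurable_inW.
      apply: (measurableT_comp (f := @Psi q)); first exact: measurable_Psi.
      exact: measurable_powpt.
    - move=> w _; rewrite mule_ge0 ?lee_fin// nsum_ge0// => s.
      by rewrite mule_ge0 ?lee_fin// Psi_ge0.
    apply: eq_integral => w _; rewrite /G indicE.
    by apply: on_event => /set_mem wn; exact: mecke_sum_tuples.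
  rewrite janossy_integral; [|exact: Psi_ge0|exact: measurable_Psi].
  pose g p : \bar R := (u p * kap p ^+ q)%:E.
  have mg : measurable_fun setT g.
    apply/measurable_EFinP; apply: measurable_funM => //.
    exact: measurable_funX.
  have g0 p : 0 <= g p by rewrite lee_fin mulr_ge0 ?exprn_ge0.
  rewrite integral_Psi muleA -EFinM.
  rewrite (eq_integral g) => [|p _]; last by rewrite kapE -EFin_expe -EFinM.
  rewrite [in RHS](eq_integral (fun p => (e * lambda ^+ q / q`!%:R)%:E * g p)) => [|p _]; last first.
    by rewrite /h /g -EFinM exprMn; congr EFin; field.
  rewrite ge0_integralZl//; last first.
    by rewrite lee_fin !mulr_ge0 ?expR_ge0 ?exprn_ge0.
  rewrite muleA -EFinM; congr (_%:E * _); rewrite /e exprD; field.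
  exact: fq.
rewrite (nneseries_split 0%N 3%N)//; last by move=> k _; exact: integral_ge0.
rewrite add0n big_nat big1 ?add0e; last first.
  move=> n /andP[_ n3]; apply: integral0_eq => w _; rewrite /G indicE.
  case: (boolP (w \in EN n)) => [/set_mem wn|_]; last by rewrite mul0e.
  by rewrite (mecke_sum_small n3 wn) mule0.
rewrite -nneseries_addn; last by move=> k; exact: integral_ge0.
under eq_eseriesr do rewrite addnC term.
rewrite nneseriesZl; last by move=> q _; exact: integral_ge0.
congr (_ * _); rewrite -integral_nneseries//; apply: eq_integral => p _.
rewrite /h; under eq_eseriesr do rewrite EFinM.
rewrite nneseriesZl; last by move=> q _; rewrite lee_fin mulr_ge0 ?exprn_ge0 ?mulr_ge0.
rewrite nneseries_exp ?mulr_ge0// -!EFinM -mulrA -expRD; congr ((_ * expR _)%:E).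
have -> : area W = (fine (nu (xsection B p)) + kap p)%:E.
  rewrite -site_lawT -(setUv (xsection B p)) measureU//; last 2 first.
  - exact: measurableC.
  - by rewrite setICr.
  have nuB : nu (xsection B p) \is a fin_num by exact: fin_num_measure.
  exact: (etrans (congr2 +%E (esym (fineK nuB)) (kapE p)) (esym (EFinD _ _))).
have cancel (c k : R) : (- (lambda * fine (c + k)%:E) + lambda * k = - (lambda * c))%R.
  by rewrite /= mulrDr opprD -addrA addNr addr0.
exact: cancel.
Qed.

End mecke_window.

(** * P8 *)
Section affine_lebesgue.
Context (R : realType).
Local Notation mu := (@lebesgue_measure R).
Local Open Scope ereal_scope.

Lemma measurable_affine (c a : R) : measurable_fun setT (fun x : measurableTypeR R => (c * x + a : measurableTypeR R)%R).
Proof.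
by apply: measurable_funD => //; apply: measurable_funM => //; exact: measurable_cst.
Qed.

Lemma integral_affine (c a : R) (f : measurableTypeR R -> \bar R) : (0 < c)%R ->
  (forall x, 0 <= f x) -> measurable_fun setT f ->
  \int[mu]_x f x = c%:E * \int[mu]_x f (c * x + a)%R.
Proof.
move=> c0 f0 mf.
have mT := measurable_affine c a.
pose k : {nonneg R} := NngNum (ltW c0).
pose pf : {measure set (measurableTypeR R) -> \bar R} :=
  measure_function_pushforward__canonical__measure_function_Measure mu mT.
transitivity (\int[mscale k pf]_x f x).
  apply: eq_measure_integral => A mA _; apply: lebesgue_measure_unique => // _ [[u w] uw <-].
  rewrite /= /mscale /pf /= /pushforward.
  have -> : (fun x : R => c * x + a)%R @^-1` `]u, w]%classic =
      `]((u - a) / c)%R, ((w - a) / c)%R]%classic.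
    apply/seteqP; split=> x /=; rewrite !in_itv /= ltr_pdivrMr// ler_pdivlMr//;
      by rewrite ltrBlDr lerBrDr [(x * c)%R]mulrC.
  rewrite !lebesgue_measure_itv /= !lte_fin ltr_pM2r ?invr_gt0// ltrD2r.
  case: ifPn => _; last by rewrite mule0.
  rewrite -!EFinD -EFinM -mulrBl opprB addrA subrK mulrC divfK//; exact: lt0r_neq0.
rewrite ge0_integral_mscale// ge0_integral_pushforward//.
Qed.

End affine_lebesgue.

Section area_measure.
Context (R : realType).
Local Notation mu := (@lebesgue_measure R).
Local Open Scope ereal_scope.

Definition square (r : R) : set (plane R) :=
  `[(- r)%R, r]%classic `*` `[(- r)%R, r]%classic.

Lemma measurable_square r : measurable (square r).
Proof. by apply: measurableX; exact: measurable_itv. Qed.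

Lemma area_square r : area (square r) < +oo.
Proof.
rewrite area_setX; [|exact: measurable_itv|exact: measurable_itv].
rewrite lebesgue_measure_itv; case: ifP => _; last by rewrite mule0.
by rewrite -EFinD -EFinM ltry.
Qed.

Let area_sigma_finite : sigma_finite setT (@area R).
Proof.
exists (fun n => square n%:R); last first.
  by move=> n; split; [exact: measurable_square|exact: area_square].
apply/seteqP; split=> // -[x y] _.
have [n nx] : exists n : nat, (Num.max `|x| `|y| <= n%:R)%R.
  exists (Num.bound (Num.max `|x| `|y|)%R); apply/ltW/archi_boundP.
  by rewrite le_max normr_ge0.
exists n => //; move: nx; rewrite ge_max => /andP[].
by rewrite !ler_norml => nx ny; split; rewrite /= in_itv.
Qed.

HB.instance Definition _ := Measure_isSigmaFinite.Build _ _ _ (@area R) area_sigma_finite.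

Definition affine (c : R) (a : plane R) (x : plane R) : plane R :=
  (c * x.1 + a.1, c * x.2 + a.2)%R.

Lemma measurable_affine2 c a : measurable_fun setT (affine c a).
Proof.
by apply: measurable_fun_pair; apply: (measurableT_comp (measurable_affine _ _)).
Qed.

Lemma integral_area (f : plane R -> \bar R) : (forall x, 0 <= f x) -> measurable_fun setT f ->
  \int[@area R]_x f x = \int[mu]_x \int[mu]_y f (x, y).
Proof. by move=> f0 mf; rewrite /area fubini_tonelli1. Qed.

Lemma area_affine (c : R) a (f : plane R -> \bar R) : (0 < c)%R ->
  (forall x, 0 <= f x) -> measurable_fun setT f ->
  \int[@area R]_x f x = (c ^+ 2)%:E * \int[@area R]_x f (affine c a x).
Proof.
move=> c0 f0 mf.
have mfa : measurable_fun setT (fun x => f (affine c a x)).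
  by apply: (measurableT_comp mf); exact: measurable_affine2.
rewrite !integral_area//.
rewrite (integral_affine a.1 c0); last 2 first.
- by move=> x; exact: integral_ge0.
- exact: measurable_fun_fubini_tonelli_F.
rewrite expr2 EFinM -muleA; congr (_ * _).
rewrite -ge0_integralZl//; last 3 first.
- exact: (measurable_fun_fubini_tonelli_F (m2 := mu) (fun x => f (affine c a x))).
- by move=> x _; exact: integral_ge0.
- by rewrite lee_fin ltW.
apply: eq_integral => x _; rewrite (integral_affine a.2 c0)//.
by apply: (measurableT_comp mf); exact: measurable_fun_pair.
Qed.

End area_measure.

(** * P9 *)
Section radial.
Context (R : realType).
Local Notation leb := (@lebesgue_measure R).
Local Open Scope ereal_scope.

Definition sqn (x : plane R) : R := (x.1 ^+ 2 + x.2 ^+ 2)%R.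

Lemma sqn_ge0 x : (0 <= sqn x)%R.
Proof. by rewrite addr_ge0 ?sqr_ge0. Qed.

Lemma measurable_sqn : measurable_fun setT sqn.
Proof.
apply: measurable_funD; apply: measurable_funX.
  exact: (@measurable_fst _ _ (measurableTypeR R) (measurableTypeR R)).
exact: (@measurable_snd _ _ (measurableTypeR R) (measurableTypeR R)).
Qed.

Let msqn : measurable_fun setT (sqn : plane R -> measurableTypeR R) := measurable_sqn.

Let disk s := [set x : plane R | (sqn x < s)%R].

Let mdisk s : measurable (disk s).
Proof.
have -> : disk s = setT `&` sqn @^-1` `]-oo, s[%classic.
  by apply/seteqP; split=> x; rewrite /disk /= in_itv /=; [|move=> []].
by apply: measurable_sqn => //; exact: measurable_itv.
Qed.

Let disk_scale s : (0 < s)%R -> area (disk s) = s%:E * area (disk 1%R).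
Proof.
move=> s0; pose c := Num.sqrt s; pose o : plane R := (0%R : R, 0%R : R).
have c0 : (0 < c)%R by rewrite sqrtr_gt0.
rewrite -[in LHS](setIT (disk s)) -[in RHS](setIT (disk 1%R)) -!integral_indic//.
rewrite (area_affine o c0); last 2 first.
- by move=> x; rewrite lee_fin.
- by apply/measurable_EFinP; exact: measurable_indic.
rewrite sqr_sqrtr ?ltW//; congr (_ * _); apply: eq_integral => x _.
rewrite !indicE; congr ((nat_of_bool _)%:R%:E).
have -> : (affine c o x \in disk s) = (sqn (affine c o x) < s)%R.
  by apply/idP/idP; rewrite inE.
have -> : (x \in disk 1%R) = (sqn x < 1)%R by apply/idP/idP; rewrite inE.
rewrite /sqn /affine /= !addr0 !exprMn -mulrDr sqr_sqrtr ?ltW//.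
by rewrite -[ltRHS](mulr1 s) ltr_pM2l.
Qed.

Let disk_fin : area (disk 1%R) \is a fin_num.
Proof.
rewrite ge0_fin_numE//; apply: le_lt_trans (area_square 1).
apply: le_measure; rewrite ?inE; [exact: mdisk|exact: measurable_square|].
move=> [x y]; rewrite /disk /sqn /= => xy.
split; rewrite /= in_itv /= -ler_norml -[leRHS]sqrtr1 -sqrtr_sqr ler_wsqrtr// ltW//.
  by apply: le_lt_trans xy; rewrite lerDl sqr_ge0.
by apply: le_lt_trans xy; rewrite lerDr sqr_ge0.
Qed.

Let A := fine (area (disk 1%R)).
Let A0 : (0 <= A)%R. Proof. exact: fine_ge0. Qed.
Let halfline : set (measurableTypeR R) := `[0%R, +oo[%classic.
Let mhalf : measurable halfline. Proof. exact: measurable_itv. Qed.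

Let radial_law (S : set (measurableTypeR R)) : measurable S ->
  pushforward (@area R) sqn S = A%:E * leb (S `&` halfline).
Proof.
move=> mS.
pose pf : {measure set (measurableTypeR R) -> \bar R} :=
  measure_function_pushforward__canonical__measure_function_Measure (@area R) msqn.
pose k : {nonneg R} := NngNum A0.
pose m2 : {measure set (measurableTypeR R) -> \bar R} := mscale k (mrestr leb mhalf).
rewrite -[LHS]/(pf S) -[RHS]/(m2 S).
pose G : set (set (measurableTypeR R)) := @RGenInftyO.G R.
have pfG x : pf `]-oo, x[%classic = (A * Num.max 0 x)%:E.
  have -> : pf `]-oo, x[%classic = area (disk x).
    suff -> : disk x = sqn @^-1` `]-oo, x[%classic by [].
    by apply/seteqP; split=> y; rewrite /disk /= in_itv.
  have [x0|x0] := leP x 0%R.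
    rewrite mulr0; have -> : disk x = set0; last by rewrite measure0.
    apply/seteqP; split=> y //; rewrite /disk /= => yx.
    by have := lt_le_trans yx x0; rewrite ltNge sqn_ge0.
  by rewrite disk_scale// -(fineK disk_fin) -EFinM mulrC.
apply: (measure_unique G (fun n => `]-oo, (n%:R : R)[%classic)) => //.
- exact: RGenInftyO.measurableE.
- move=> _ _ [x ->] [y ->]; exists (Num.min x y).
  by apply/seteqP; split=> z /=; rewrite !in_itv /= lt_min; [move=> [-> ->]|move/andP].
- by move=> n; exists n%:R.
- apply/seteqP; split=> // x _.
  exists (Num.bound `|x|) => //=; rewrite in_itv /=.
  by apply: le_lt_trans (ler_norm x) _; exact: archi_boundP.
- move=> _ [x ->]; rewrite pfG /= /mscale /= EFinM; congr (_ * _).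
  rewrite /mrestr; have -> : `]-oo, x[%classic `&` halfline = `[0%R, x[%classic.
    apply/seteqP; split=> y /=; rewrite /halfline /= !in_itv /= ?andbT.
      by move=> [-> ->].
    by move=> /andP[-> ->].
  rewrite lebesgue_measure_itv /= lte_fin; have [x0|x0] := ltP 0%R x.
    by rewrite -EFinD subr0.
  by [].
- by move=> n; rewrite pfG ltry.
Qed.

Lemma radialA (phi : R -> \bar R) : (forall s, 0 <= phi s) -> measurable_fun setT phi ->
  \int[@area R]_x phi (sqn x) = A%:E * \int[leb]_(s in `[0%R, +oo[) phi s.
Proof.
move=> phi0 mphi.
have := @ge0_integral_pushforward _ _ _ _ _ _ msqn (@area R) setT phi measurableT mphi.
rewrite preimage_setT => <-; last by move=> y _; exact: phi0.
pose k : {nonneg R} := NngNum A0.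
rewrite (@eq_measure_integral _ _ _ _ (mscale k (mrestr leb mhalf))); last first.
  by move=> S mS _; rewrite [LHS]radial_law.
rewrite ge0_integral_mscale//; congr (_ * _).
rewrite integral_mrestr// [RHS]integral_mkcond; apply: eq_integral => x _.
by rewrite patchE indicE; case: (x \in _); rewrite ?mul1e ?mul0e.
Qed.

Lemma integral_expN : \int[leb]_(s in `[0%R, +oo[) (expR (- s))%:E = 1.
Proof.
rewrite -(@integral_exponential_pdf R 1 ltr01) [LHS]integral_mkcond.
apply: eq_integral => x _; rewrite /exponential_pdf !patchE.
case: ifP => //; rewrite mul1r mulN1r//.
Qed.

Lemma disk_area : A = pi.
Proof.
have mexp : measurable_fun setT (fun s : R => (expR (- s))%:E).
  by apply/measurable_EFinP; apply: measurableT_comp.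
have := @radialA (fun s => (expR (- s))%:E) _ mexp.
rewrite integral_expN mule1 => /(_ (fun=> _)) H.
apply: EFin_inj; rewrite -H; last by move=> s; rewrite lee_fin expR_ge0.
rewrite integral_area; last 2 first.
- by move=> x; rewrite lee_fin expR_ge0.
- by apply: (measurableT_comp mexp); exact: measurable_sqn.
rewrite (eq_integral (fun x : measurableTypeR R => (gauss_fun x)%:E * (Num.sqrt pi)%:E)); last first.
  move=> x _; rewrite -integralT_gauss -ge0_integralZl//.
  - apply: eq_integral => y _.
    by rewrite -EFinM /gauss_fun -expRD /sqn /= opprD.
  - by apply/measurable_EFinP; exact: measurable_gauss_fun.
  - by move=> y _; rewrite lee_fin gauss_fun_ge0.
  - by rewrite lee_fin gauss_fun_ge0.
rewrite ge0_integralZr//.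
- by rewrite integralT_gauss -EFinM -expr2 sqr_sqrtr// pi_ge0.
- by apply/measurable_EFinP; exact: measurable_gauss_fun.
- by move=> y _; rewrite lee_fin gauss_fun_ge0.
Qed.

Lemma integral_radial (phi : R -> \bar R) :
  (forall s, 0 <= phi s) -> measurable_fun setT phi ->
  \int[@area R]_x phi (sqn x) = pi%:E * \int[leb]_(s in `[0%R, +oo[) phi s.
Proof. by move=> phi0 mphi; rewrite radialA// disk_area. Qed.

End radial.

(** * P10 *)
Section sigma_finite_product.
Context d1 d2 (T1 : measurableType d1) (T2 : measurableType d2) (R : realType).
Variables (m1 : {sigma_finite_measure set T1 -> \bar R})
  (m2 : {sigma_finite_measure set T2 -> \bar R}).
Local Open Scope ereal_scope.

Definition sigprod : set (T1 * T2) -> \bar R := m1 \x m2.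

HB.instance Definition _ := Measure.on sigprod.

Let sigprod_sigma_finite : sigma_finite setT sigprod.
Proof.
have /sigma_finiteP[F [FT ndF Foo]] := sigma_finiteT m1.
have /sigma_finiteP[G [GT ndG Goo]] := sigma_finiteT m2.
exists (fun n => F n `*` G n); last first.
  move=> n; have [mF Fn] := Foo n; have [mG Gn] := Goo n.
  split; first exact: measurableX.
  by rewrite /sigprod product_measure1E// lte_mul_pinfty// ge0_fin_numE.
apply/seteqP; split=> // -[x y] _.
have [i _ Fi] : (\bigcup_i F i) x by rewrite -FT.
have [j _ Gj] : (\bigcup_i G i) y by rewrite -GT.
exists (maxn i j) => //; split=> /=.
  by move: x Fi; exact/subsetPset/ndF/leq_maxl.
by move: y Gj; exact/subsetPset/ndG/leq_maxr.
Qed.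

HB.instance Definition _ := Measure_isSigmaFinite.Build _ _ _ sigprod sigprod_sigma_finite.

Lemma integral_sigprod (f : T1 * T2 -> \bar R) : (forall x, 0 <= f x) ->
  measurable_fun setT f ->
  \int[sigprod]_x f x = \int[m1]_x \int[m2]_y f (x, y).
Proof. by move=> f0 mf; rewrite /sigprod fubini_tonelli1. Qed.

Lemma integral_sigprodC (f : T1 * T2 -> \bar R) : (forall x, 0 <= f x) ->
  measurable_fun setT f ->
  \int[sigprod]_x f x = \int[m2]_y \int[m1]_x f (x, y).
Proof. by move=> f0 mf; rewrite integral_sigprod// (fubini_tonelli (m1 := m1) (m2 := m2)). Qed.

End sigma_finite_product.

Section inverse_measurable.
Context d (T : measurableType d) (R : realType).

Lemma measurable_inv (f : T -> R) :
  measurable_fun setT f -> measurable_fun setT (fun x => (f x)^-1).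
Proof.
move=> mf; rewrite (_ : (fun x => (f x)^-1) = (fun x => f x * (f x ^+ 2) `^ (-1))).
  apply: measurable_funM => //.
  apply: (measurableT_comp (measurable_powR (-1))).
  exact: measurable_funX.
apply/funext => x; rewrite powR_inv1 ?sqr_ge0//.
have [->|fx] := eqVneq (f x) 0; first by rewrite invr0 mul0r.
by rewrite expr2 invfM mulrA divff// mul1r.
Qed.

End inverse_measurable.

Section haar.
Context (R : realType).
Local Notation leb := (@lebesgue_measure R).
Local Open Scope ereal_scope.

Lemma integral_reflect (a : R) (f : measurableTypeR R -> \bar R) :
  (forall x, 0 <= f x) -> measurable_fun setT f ->
  \int[leb]_x f (a - x)%R = \int[leb]_x f x.
Proof.
move=> f0 mf.
have mg : measurable_fun setT (fun x : measurableTypeR R => f (1 * x + a)%R).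
  exact: (measurableT_comp mf (measurable_affine 1 a)).
rewrite [RHS](integral_affine a ltr01)// mul1e.
have mopp : measurable_fun setT (-%R : measurableTypeR R -> measurableTypeR R) by exact: oppr_measurable.
rewrite (@eq_measure_integral _ _ _ _ (pushforward leb (-%R : _ -> measurableTypeR R))); last first.
  by move=> A mA _; rewrite [RHS]lebesgue_measureN.
have mfa : measurable_fun setT (fun y : measurableTypeR R => f (a - y)%R).
  apply: (measurableT_comp (f := f) (g := fun y : measurableTypeR R => (a - y)%R : measurableTypeR R)) => //.
  by apply: measurable_funB => //; exact: measurable_cst.
rewrite ge0_integral_pushforward//; apply: eq_integral => x _ /=.
by rewrite mul1r opprK addrC.
Qed.

Context d (S : measurableType d) (Q : {sigma_finite_measure set S -> \bar R}).
Variables (tau G : S -> R).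
Hypotheses (mtau : measurable_fun setT tau) (mG : measurable_fun setT G).
Hypothesis G0 : forall x, (0 <= G x)%R.
Hypothesis Ginv : forall t (E : set (measurableTypeR R)), measurable E ->
  \int[Q]_x (G x * \1_E (tau x - t)%R)%:E = \int[Q]_x (G x * \1_E (tau x))%:E.

Let smear (A B : set (measurableTypeR R)) (xt : S * measurableTypeR R) : \bar R :=
  (G xt.1 * (\1_A xt.2 * \1_B (tau xt.1 - xt.2)%R))%:E.

Let smear0 A B xt : 0 <= smear A B xt.
Proof. by rewrite lee_fin !mulr_ge0. Qed.

Let msmear A B : measurable A -> measurable B -> measurable_fun setT (smear A B).
Proof.
move=> mA mB; apply/measurable_EFinP; apply: measurable_funM.
  by apply: measurableT_comp => //; exact: measurable_fst.
apply: measurable_funM.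
  apply: (measurableT_comp (f := \1_A : measurableTypeR R -> R)).
    exact: measurable_indic.
  exact: measurable_snd.
apply: (measurableT_comp (f := \1_B : measurableTypeR R -> R)
    (g := fun xt : S * measurableTypeR R => (tau xt.1 - xt.2)%R : measurableTypeR R)).
  exact: measurable_indic.
apply: measurable_funB; first by apply: measurableT_comp => //; exact: measurable_fst.
exact: measurable_snd.
Qed.

Let smear_int A B : measurable A -> measurable B ->
  \int[Q]_x \int[leb]_t smear A B (x, t) =
  leb A * \int[Q]_x (G x * \1_B (tau x))%:E.
Proof.
move=> mA mB.
rewrite -integral_sigprod//; last exact: msmear.
rewrite integral_sigprodC//; last exact: msmear.
have mQ t : measurable_fun setT (fun x => (G x * \1_B (tau x - t)%R)%:E).
  apply/measurable_EFinP; apply: measurable_funM => //.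
  apply: (measurableT_comp (f := \1_B : measurableTypeR R -> R)
    (g := fun x => (tau x - t)%R : measurableTypeR R)); first exact: measurable_indic.
  by apply: measurable_funB => //; exact: measurable_cst.
rewrite (eq_integral (fun t => (\1_A t)%:E * \int[Q]_x (G x * \1_B (tau x))%:E)).
  rewrite ge0_integralZr//.
  - by rewrite integral_indic// setIT.
  - by apply/measurable_EFinP; exact: measurable_indic.
  - by apply: integral_ge0 => x _; rewrite lee_fin mulr_ge0.
move=> t _; rewrite -(Ginv t)// -ge0_integralZl//.
- by apply: eq_integral => x _; rewrite /smear -EFinM /=; congr EFin; ring.
- by move=> x _; rewrite lee_fin mulr_ge0.
Qed.

Let smearC A B : measurable A -> measurable B ->
  \int[Q]_x \int[leb]_t smear A B (x, t) = \int[Q]_x \int[leb]_t smear B A (x, t).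
Proof.
move=> mA mB; apply: eq_integral => x _.
rewrite -(integral_reflect (tau x)).
- by apply: eq_integral => t _; rewrite /smear /= subKr; congr EFin; ring.
- by move=> t; exact: smear0.
- by apply: (measurableT_comp (msmear mA mB)); exact: measurable_fun_pair.
Qed.

Lemma stationary_lebesgue (E : set (measurableTypeR R)) : measurable E ->
  \int[Q]_x (G x * \1_E (tau x))%:E =
  leb E * \int[Q]_x (G x * \1_(`[0%R, 1%R]%classic) (tau x))%:E.
Proof.
move=> mE; have mI : measurable (`[0%R, 1%R]%classic : set (measurableTypeR R)).
  exact: measurable_itv.
rewrite -smear_int// smearC// smear_int// lebesgue_measure_itv/= lte_fin ltr01.
by rewrite -EFinD subr0 mul1e.
Qed.

End haar.

(** * P11 *)
Section kinematics.
Context (R : realType).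
Local Notation Z := (plane R * mark R)%type.
Implicit Types (z : Z) (p : Z * Z).

Definition slope z : R := z.1.1 * cos z.2 + z.1.2 * sin z.2.

Definition flow (v t : R) z : Z := (position v z.1 z.2 t, z.2).

Definition dilate (c : R) z : Z := ((c * z.1.1, c * z.1.2), z.2).

Definition sqdist (v : R) z (t : R) : R := sqn (position v z.1 z.2 t).

Definition meet_time v p : R :=
  (sqn p.2.1 - sqn p.1.1) / (2 * v * (slope p.1 - slope p.2)).

Definition meet_sq v p : R := sqdist v p.1 (meet_time v p).

Lemma sqdistE v z t : sqdist v z t = sqn z.1 + 2 * (v * t) * slope z + (v * t) ^+ 2.
Proof.
transitivity (sqn z.1 + 2 * (v * t) * slope z +
    (v * t) ^+ 2 * (cos z.2 ^+ 2 + sin z.2 ^+ 2)); last by rewrite cos2Dsin2 mulr1.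
rewrite /sqdist /sqn /slope /=; ring.
Qed.

Lemma slope_flow v t z : slope (flow v t z) = slope z + v * t.
Proof.
transitivity (slope z + v * t * (cos z.2 ^+ 2 + sin z.2 ^+ 2)); last first.
  by rewrite cos2Dsin2 mulr1.
rewrite /slope /flow /=; ring.
Qed.

Lemma sqn_flow v t z : sqn (flow v t z).1 = sqdist v z t.
Proof. by []. Qed.

Lemma sqdist_flow v t z s : sqdist v (flow v t z) s = sqdist v z (t + s).
Proof.
rewrite /sqdist /flow; congr sqn; rewrite /position /=.
by congr pair; ring.
Qed.

Lemma meet_iff v p t : v != 0 -> slope p.1 != slope p.2 ->
  sqdist v p.1 t = sqdist v p.2 t <-> t = meet_time v p.
Proof.
move=> v0 s0; rewrite !sqdistE /meet_time.
have s1 : slope p.1 - slope p.2 != 0 by rewrite subr_eq0.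
have d0 : 2 * v * (slope p.1 - slope p.2) != 0.
  by rewrite !mulf_neq0// pnatr_eq0.
split=> [H|->].
  apply: (mulIf d0); rewrite divfK//; move: H; lra.
field; rewrite s1 v0//.
Qed.

Lemma meet_sqE v p : v != 0 -> slope p.1 != slope p.2 ->
  meet_sq v p = sqdist v p.2 (meet_time v p).
Proof. by move=> v0 s0; apply/meet_iff. Qed.

Lemma meet_time_flow v t p : v != 0 -> slope p.1 != slope p.2 ->
  meet_time v (flow v t p.1, flow v t p.2) = meet_time v p - t.
Proof.
move=> v0 s0; apply/esym/meet_iff => //=.
  by rewrite !slope_flow (inj_eq (addIr _)).
by rewrite !sqdist_flow addrC subrK; apply/meet_iff.
Qed.

Lemma meet_sq_flow v t p : v != 0 -> slope p.1 != slope p.2 ->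
  meet_sq v (flow v t p.1, flow v t p.2) = meet_sq v p.
Proof.
by move=> v0 s0; rewrite /meet_sq meet_time_flow//= sqdist_flow addrC subrK.
Qed.

Lemma slope_dilate c z : slope (dilate c z) = c * slope z.
Proof. by rewrite /slope /dilate /=; ring. Qed.

Lemma sqn_dilate c z : sqn (dilate c z).1 = c ^+ 2 * sqn z.1.
Proof. by rewrite /sqn /dilate /=; ring. Qed.

Lemma meet_time_dilate c v p : c != 0 ->
  meet_time v (dilate c p.1, dilate c p.2) = c * meet_time v p.
Proof.
move=> c0; rewrite /meet_time /= !sqn_dilate !slope_dilate -!mulrBr.
set D := slope p.1 - slope p.2; set A := sqn _ - sqn _.
have -> : 2 * v * (c * D) = c * (2 * v * D) by ring.
have [->|E0] := eqVneq (2 * v * D) 0; first by rewrite mulr0 !invr0 !mulr0.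
by move: (2 * v * D) E0 => E E0; field; rewrite E0 c0.
Qed.

Lemma meet_sq_dilate c v p : c != 0 ->
  meet_sq v (dilate c p.1, dilate c p.2) = c ^+ 2 * meet_sq v p.
Proof.
move=> c0; rewrite /meet_sq meet_time_dilate//= !sqdistE slope_dilate sqn_dilate.
ring.
Qed.

Lemma sqdist_ge0 v z t : 0 <= sqdist v z t.
Proof. exact: sqn_ge0. Qed.

Lemma bs_distE v (x : nat -> plane R) (theta : nat -> R) i t :
  bs_dist v x theta i t = Num.sqrt (sqdist v (x i, theta i) t).
Proof. by []. Qed.

End kinematics.

Section measurability.
Context (R : realType).
Local Notation Z := (plane R * mark R)%type.

Lemma measurable_sin : measurable_fun setT (sin : measurableTypeR R -> R).
Proof. by apply: continuous_measurable_fun; exact: continuous_sin. Qed.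

Lemma measurable_cos : measurable_fun setT (cos : measurableTypeR R -> R).
Proof. by apply: continuous_measurable_fun; exact: continuous_cos. Qed.

Context d (S : measurableType d).

Lemma measurable_slope (f : S -> Z) : measurable_fun setT f ->
  measurable_fun setT (fun x => slope (f x)).
Proof.
move=> mf; have m1 : measurable_fun setT (fun x => (f x).1).
  by apply: (measurableT_comp measurable_fst).
have m2 : measurable_fun setT (fun x => (f x).2).
  by apply: (measurableT_comp measurable_snd).
apply: measurable_funD; apply: measurable_funM.
- by apply: (measurableT_comp measurable_fst).
- exact: (measurableT_comp measurable_cos).
- by apply: (measurableT_comp measurable_snd).
- exact: (measurableT_comp measurable_sin).
Qed.

Lemma measurable_position v (f : S -> Z) (t : S -> R) : measurable_fun setT f ->
  measurable_fun setT t ->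
  measurable_fun setT (fun x => position v (f x).1 (f x).2 (t x) : plane R).
Proof.
move=> mf mt; have m1 : measurable_fun setT (fun x => (f x).1).
  by apply: (measurableT_comp measurable_fst).
have m2 : measurable_fun setT (fun x => (f x).2).
  by apply: (measurableT_comp measurable_snd).
apply: measurable_fun_pair; apply: measurable_funD.
- by apply: (measurableT_comp measurable_fst).
- apply: measurable_funM; last exact: (measurableT_comp measurable_cos).
  by apply: measurable_funM => //; exact: measurable_cst.
- by apply: (measurableT_comp measurable_snd).
- apply: measurable_funM; last exact: (measurableT_comp measurable_sin).
  by apply: measurable_funM => //; exact: measurable_cst.
Qed.

Lemma measurable_sqdist v (f : S -> Z) (t : S -> R) : measurable_fun setT f ->
  measurable_fun setT t -> measurable_fun setT (fun x => sqdist v (f x) (t x)).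
Proof.
by move=> mf mt; apply: (measurableT_comp (@measurable_sqn R)); exact: measurable_position.
Qed.

Lemma measurable_meet_time v (f g : S -> Z) : measurable_fun setT f ->
  measurable_fun setT g -> measurable_fun setT (fun x => meet_time v (f x, g x)).
Proof.
move=> mf mg; apply: measurable_funM.
  apply: measurable_funB; apply: (measurableT_comp (@measurable_sqn R)).
    exact: (measurableT_comp measurable_fst).
  exact: (measurableT_comp measurable_fst).
apply: measurable_inv; apply: measurable_funM; first exact: measurable_cst.
by apply: measurable_funB; exact: measurable_slope.
Qed.

Lemma measurable_meet_sq v (f g : S -> Z) : measurable_fun setT f ->
  measurable_fun setT g -> measurable_fun setT (fun x => meet_sq v (f x, g x)).
Proof.
by move=> mf mg; apply: measurable_sqdist => //; exact: measurable_meet_time.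
Qed.

End measurability.

(** * P12 *)
Section site_measure.
Context (R : realType).
Local Notation Z := (plane R * mark R)%type.
Local Open Scope ereal_scope.

Definition site_measure : {sigma_finite_measure set Z -> \bar R} :=
  sigprod (@area R) (@angle_law R).

Lemma integral_site (f : Z -> \bar R) : (forall z, 0 <= f z) -> measurable_fun setT f ->
  \int[site_measure]_z f z = \int[@angle_law R]_th \int[@area R]_x f (x, th).
Proof. exact: integral_sigprodC. Qed.

Lemma measurable_flow v t : measurable_fun setT (@flow R v t).
Proof.
apply: measurable_fun_pair; last exact: measurable_snd.
apply: (@measurable_position R _ Z v id (fun=> t)); first exact: measurable_id.
exact: measurable_cst.
Qed.

Lemma measurable_dilate c : measurable_fun setT (@dilate R c).
Proof.
apply: measurable_fun_pair; last exact: measurable_snd.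
apply: measurable_fun_pair; apply: measurable_funM; do ?exact: measurable_cst.
  by apply: (measurableT_comp measurable_fst); exact: measurable_fst.
by apply: (measurableT_comp measurable_snd); exact: measurable_fst.
Qed.

Lemma site_measure_flow v t (f : Z -> \bar R) : (forall z, 0 <= f z) ->
  measurable_fun setT f ->
  \int[site_measure]_z f (flow v t z) = \int[site_measure]_z f z.
Proof.
move=> f0 mf; rewrite !integral_site//; last first.
  by apply: (measurableT_comp mf); exact: measurable_flow.
apply: eq_integral => th _.
rewrite [RHS](area_affine ((v * t * cos th)%R, (v * t * sin th)%R) ltr01)//.
  rewrite expr1n mul1e; apply: eq_integral => x _.
  by rewrite /affine /flow /position /= !mul1r.
by apply: (measurableT_comp mf); exact: measurable_fun_pair.
Qed.

Lemma site_measure_dilate c (f : Z -> \bar R) : (0 < c)%R -> (forall z, 0 <= f z) ->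
  measurable_fun setT f ->
  \int[site_measure]_z f z = (c ^+ 2)%:E * \int[site_measure]_z f (dilate c z).
Proof.
move=> c0 f0 mf.
have mfd : measurable_fun setT (fun z => f (dilate c z)).
  by apply: (measurableT_comp mf); exact: measurable_dilate.
have mfa (g : Z -> \bar R) : measurable_fun setT g ->
    measurable_fun setT (fun xt : mark R * plane R => g (xt.2, xt.1)).
  move=> mg; apply: (measurableT_comp mg).
  by apply: measurable_fun_pair; [exact: measurable_snd|exact: measurable_fst].
rewrite !integral_site// -ge0_integralZl//; last 3 first.
- exact: (measurable_fun_fubini_tonelli_G (m1 := @area R) (fun z => f (dilate c z))).
- by move=> th _; exact: integral_ge0.
- by rewrite lee_fin exprn_ge0// ltW.
apply: eq_integral => th _.
rewrite (area_affine ((0 : R)%R, (0 : R)%R) c0)//.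
  by congr (_ * _); apply: eq_integral => x _; rewrite /affine /dilate /= !addr0.
by apply: (measurableT_comp mf); exact: measurable_fun_pair.
Qed.

Lemma integral_site_law (W : set (plane R)) (mW : measurable W) (fW : area W < +oo)
    (f : Z -> \bar R) : (forall z, 0 <= f z) -> measurable_fun setT f ->
  \int[site_law mW fW]_z f z = \int[site_measure]_z ((\1_W z.1 : R)%:E * f z).
Proof.
move=> f0 mf; pose g z := (\1_W z.1 : R)%:E * f z.
have g0 z : 0 <= g z by rewrite mule_ge0 ?lee_fin.
have mg : measurable_fun setT g.
  apply: emeasurable_funM => //; apply/measurable_EFinP.
  apply: (measurableT_comp (f := \1_W : plane R -> R)); first exact: measurable_indic.
  exact: measurable_fst.
rewrite [RHS](integral_sigprod _ _ g0 mg).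
rewrite -[site_law mW fW : set _ -> _]/(warea mW fW \x @angle_law R).
rewrite [LHS](fubini_tonelli1 (m1 := warea mW fW) (m2 := @angle_law R) f mf f0).
have mF := measurable_fun_fubini_tonelli_F (m2 := @angle_law R) f mf f0.
have F0 x : 0 <= fubini_F (@angle_law R) f x by exact: integral_ge0.
rewrite [LHS](integral_mrestr (@area R) mW F0 mF).
apply: eq_integral => x _; rewrite -ge0_integralZl//.
  by apply: (measurableT_comp mf); exact: measurable_fun_pair.
Qed.

Definition pair_measure : {sigma_finite_measure set (Z * Z)%type -> \bar R} :=
  sigprod site_measure site_measure.

Lemma integral_pair (f : Z * Z -> \bar R) : (forall p, 0 <= f p) ->
  measurable_fun setT f ->
  \int[pair_measure]_p f p = \int[site_measure]_y \int[site_measure]_z f (y, z).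
Proof. exact: integral_sigprod. Qed.

Lemma pair_measure_flow v t (f : Z * Z -> \bar R) : (forall p, 0 <= f p) ->
  measurable_fun setT f ->
  \int[pair_measure]_p f (flow v t p.1, flow v t p.2) = \int[pair_measure]_p f p.
Proof.
move=> f0 mf.
have m1 : measurable_fun setT (fun p : Z * Z => f (flow v t p.1, flow v t p.2)).
  apply: (measurableT_comp mf); apply: measurable_fun_pair.
    by apply: (measurableT_comp (measurable_flow v t)); exact: measurable_fst.
  by apply: (measurableT_comp (measurable_flow v t)); exact: measurable_snd.
rewrite (integral_pair f0 mf) (integral_pair (fun=> f0 _) m1).
have mf1 z : measurable_fun setT (fun y => f (z, y)).
  by apply: (measurableT_comp mf); exact: measurable_fun_pair.
transitivity (\int[site_measure]_y \int[site_measure]_z f (flow v t y, z)).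
  apply: eq_integral => y _.
  exact: (@site_measure_flow v t (fun z => f (flow v t y, z)) (fun=> f0 _) (mf1 _)).
apply: (@site_measure_flow v t (fun z => \int[site_measure]_y f (z, y))).
  by move=> z; exact: integral_ge0.
exact: (measurable_fun_fubini_tonelli_F (m2 := site_measure) f).
Qed.

Lemma pair_measure_dilate c (f : Z * Z -> \bar R) : (0 < c)%R -> (forall p, 0 <= f p) ->
  measurable_fun setT f ->
  \int[pair_measure]_p f p =
  (c ^+ 4)%:E * \int[pair_measure]_p f (dilate c p.1, dilate c p.2).
Proof.
move=> c0 f0 mf.
have m1 : measurable_fun setT (fun p : Z * Z => f (p.1, dilate c p.2)).
  apply: (measurableT_comp mf); apply: measurable_fun_pair; first exact: measurable_fst.
  by apply: (measurableT_comp (measurable_dilate c)); exact: measurable_snd.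
have m2 : measurable_fun setT (fun p : Z * Z => f (dilate c p.1, dilate c p.2)).
  apply: (measurableT_comp mf); apply: measurable_fun_pair.
    by apply: (measurableT_comp (measurable_dilate c)); exact: measurable_fst.
  by apply: (measurableT_comp (measurable_dilate c)); exact: measurable_snd.
have c20 : (0 <= c ^+ 2)%R by rewrite exprn_ge0// ltW.
rewrite (integral_pair f0 mf) (integral_pair (fun=> f0 _) m2).
have mf1 z : measurable_fun setT (fun y => f (z, y)).
  by apply: (measurableT_comp mf); exact: measurable_fun_pair.
rewrite (eq_integral (fun z => (c ^+ 2)%:E * \int[site_measure]_y f (z, dilate c y))).
  rewrite ge0_integralZl//; last 2 first.
  - exact: (measurable_fun_fubini_tonelli_F (m2 := site_measure) (fun p => f (p.1, dilate c p.2))).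
  - by move=> z _; exact: integral_ge0.
  rewrite (@site_measure_dilate c (fun z => \int[site_measure]_y f (z, dilate c y)))//.
  - by rewrite muleA -EFinM -exprD.
  - by move=> z; exact: integral_ge0.
  - exact: (measurable_fun_fubini_tonelli_F (m2 := site_measure) (fun p => f (p.1, dilate c p.2))).
by move=> z _; rewrite (@site_measure_dilate c (fun y => f (z, y))).
Qed.

End site_measure.

(** * P13 *)
Section pair_integral.
Context (R : realType) (v : R).
Hypothesis v0 : 0 < v.
Local Notation Z := (plane R * mark R)%type.
Local Notation leb := (@lebesgue_measure R).
Local Notation I01 := (`[0%R, 1%R]%classic : set (measurableTypeR R)).
Local Open Scope ereal_scope.

Let vn0 : v != 0%R. Proof. exact: lt0r_neq0. Qed.

Definition pairw (a : R) (p : Z * Z) : R :=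
  ((slope p.2 < slope p.1)%R%:R * (meet_sq v p * expR (- a * meet_sq v p)))%R.

Definition pair_int a : \bar R :=
  \int[@pair_measure R]_p (pairw a p * \1_I01 (meet_time v p))%:E.

Lemma meet_sq_ge0 p : (0 <= meet_sq v p)%R. Proof. exact: sqdist_ge0. Qed.

Lemma pairw_ge0 a p : (0 <= pairw a p)%R.
Proof. by rewrite !mulr_ge0 ?expR_ge0 ?meet_sq_ge0. Qed.

Lemma measurable_meet_time1 : measurable_fun setT (meet_time v : Z * Z -> measurableTypeR R).
Proof.
rewrite (_ : meet_time v = fun p => meet_time v (p.1, p.2)).
  by apply: measurable_meet_time; [exact: measurable_fst|exact: measurable_snd].
by apply/funext => -[].
Qed.

Lemma measurable_meet_sq1 : measurable_fun setT (meet_sq v : Z * Z -> R).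
Proof.
rewrite (_ : meet_sq v = fun p => meet_sq v (p.1, p.2)).
  by apply: measurable_meet_sq; [exact: measurable_fst|exact: measurable_snd].
by apply/funext => -[].
Qed.

Lemma measurable_slope_lt : measurable_fun setT (fun p : Z * Z => (slope p.2 < slope p.1)%R).
Proof.
apply: measurable_fun_ltr; apply: measurable_slope.
  exact: measurable_snd.
exact: measurable_fst.
Qed.

Lemma measurable_bool_natr d (S : measurableType d) (b : S -> bool) :
  measurable_fun setT b -> measurable_fun setT (fun x => (b x)%:R : R).
Proof.
move=> mb; rewrite (_ : (fun x => _) = \1_(b @^-1` [set true])).
  by apply: measurable_indic; rewrite -[_ @^-1` _]setTI; exact: mb.
apply/funext => x; rewrite indicE; congr ((nat_of_bool _)%:R).
by apply/idP/idP; rewrite inE /=.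
Qed.

Lemma measurable_pairw a : measurable_fun setT (pairw a).
Proof.
apply: measurable_funM.
  by apply: measurable_bool_natr; exact: measurable_slope_lt.
apply: measurable_funM; first exact: measurable_meet_sq1.
apply: (measurableT_comp (@measurable_expR R)).
by apply: measurable_funM; [exact: measurable_cst|exact: measurable_meet_sq1].
Qed.

Lemma measurable_time_in (E : set (measurableTypeR R)) : measurable E ->
  measurable_fun setT (fun p : Z * Z => \1_E (meet_time v p) : R).
Proof.
move=> mE; apply: (measurableT_comp (f := \1_E : measurableTypeR R -> R)).
  exact: measurable_indic.
exact: measurable_meet_time1.
Qed.

Let mI : measurable I01. Proof. exact: measurable_itv. Qed.

Lemma pairw_shift a t (E : set (measurableTypeR R)) : measurable E ->
  \int[@pair_measure R]_p (pairw a p * \1_E (meet_time v p - t)%R)%:E =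
  \int[@pair_measure R]_p (pairw a p * \1_E (meet_time v p))%:E.
Proof.
move=> mE.
rewrite -[RHS](@pair_measure_flow R v t (fun p => (pairw a p * \1_E (meet_time v p))%:E)).
- apply: eq_integral => p _; congr EFin; rewrite /pairw /= !slope_flow ltrD2r.
  case: ltP => s12; last by rewrite !mul0r.
  have s0 : (slope p.1 != slope p.2)%R by rewrite gt_eqF.
  by rewrite meet_sq_flow// meet_time_flow.
- by move=> p; rewrite lee_fin mulr_ge0 ?pairw_ge0.
- apply/measurable_EFinP; apply: measurable_funM; first exact: measurable_pairw.
  exact: measurable_time_in.
Qed.

Lemma pair_int_stationary a (E : set (measurableTypeR R)) : measurable E ->
  \int[@pair_measure R]_p (pairw a p * \1_E (meet_time v p))%:E =
  leb E * pair_int a.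
Proof.
move=> mE; apply: (@stationary_lebesgue R _ _ (@pair_measure R) (meet_time v) (pairw a)) => //.
- exact: measurable_meet_time1.
- exact: measurable_pairw.
- exact: pairw_ge0.
- by move=> t E' mE'; exact: pairw_shift.
Qed.

Lemma pair_int_dilate c a : (0 < c)%R ->
  pair_int a = (c ^+ 5)%:E * pair_int (c ^+ 2 * a).
Proof.
move=> c0.
rewrite {1}/pair_int (@pair_measure_dilate R c (fun p => (pairw a p * \1_I01 (meet_time v p))%:E))//; last 2 first.
- by move=> p; rewrite lee_fin mulr_ge0 ?pairw_ge0.
- apply/measurable_EFinP; apply: measurable_funM; first exact: measurable_pairw.
  exact: measurable_time_in.
have cn0 := lt0r_neq0 c0.
pose E : set (measurableTypeR R) := `[0%R, (c^-1)%R]%classic.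
have mE : measurable E by exact: measurable_itv.
rewrite (eq_integral (fun p => (c ^+ 2)%:E *
    (pairw (c ^+ 2 * a) p * \1_E (meet_time v p))%:E)); last first.
  move=> p _; rewrite -EFinM; congr EFin.
  rewrite /pairw /= !slope_dilate ltr_pM2l// meet_sq_dilate// meet_time_dilate//.
  have -> : \1_I01 (c * meet_time v p)%R = \1_E (meet_time v p) :> R.
    rewrite !indicE; congr ((nat_of_bool _)%:R).
    have cle (x : R) : (x <= c^-1)%R = (c * x <= 1)%R by rewrite -[LHS](ler_pM2l c0) mulfV.
    have cge (x : R) : (0 <= c * x)%R = (0 <= x)%R by exact: pmulr_rge0.
    have H (x : R) : (0 <= c * x <= 1)%R = (0 <= x <= c^-1)%R by rewrite cge cle.
    by apply/idP/idP; rewrite !inE /= !in_itv /= H.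
  have -> : (- a * (c ^+ 2 * meet_sq v p) = - (c ^+ 2 * a) * meet_sq v p)%R by ring.
  ring.
rewrite ge0_integralZl//; last 3 first.
- apply/measurable_EFinP; apply: measurable_funM; first exact: measurable_pairw.
  exact: measurable_time_in.
- by move=> p _; rewrite lee_fin mulr_ge0 ?pairw_ge0.
- by rewrite lee_fin exprn_ge0// ltW.
rewrite pair_int_stationary// /E lebesgue_measure_itv/= lte_fin invr_gt0 c0.
rewrite -EFinD subr0 !muleA -!EFinM; congr (_%:E * _).
by field.
Qed.

Lemma pair_int_scale a : (0 < a)%R ->
  pair_int a = (a `^ (- (5 / 2)))%:E * pair_int 1.
Proof.
move=> a0; pose c : R := (a `^ (- 2^-1))%R.
have c0 : (0 < c)%R by exact: powR_gt0.
have cE n : (c ^+ n = a `^ (- 2^-1 * n%:R))%R.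
  by rewrite -powR_mulrn ?ltW// /c -powRrM.
rewrite (pair_int_dilate a c0); congr (_%:E * pair_int _).
  by rewrite cE; congr (_ `^ _)%R; field.
rewrite cE (_ : (- 2^-1 * 2%:R = -1)%R); last by field.
by rewrite powR_inv1 ?ltW// mulVf// gt_eqF.
Qed.

End pair_integral.

(** * P14 *)
Section pair_integral_bounds.
Context (R : realType) (v : R).
Hypothesis v0 : 0 < v.
Local Notation Z := (plane R * mark R)%type.
Local Notation leb := (@lebesgue_measure R).
Local Notation I01 := (`[0%R, 1%R]%classic : set (measurableTypeR R)).
Local Open Scope ereal_scope.

Lemma sqn_le_sqdist (z : Z) t : (sqn z.1 <= 2 * sqdist v z t + 2 * (v * t) ^+ 2)%R.
Proof.
rewrite -subr_ge0.
have -> : (2 * sqdist v z t + 2 * (v * t) ^+ 2 - sqn z.1 =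
    (z.1.1 + 2 * (v * t * cos z.2)) ^+ 2 + (z.1.2 + 2 * (v * t * sin z.2)) ^+ 2)%R.
  transitivity (2 * sqdist v z t +
    2 * ((v * t) ^+ 2 * (cos z.2 ^+ 2 + sin z.2 ^+ 2)) - sqn z.1)%R.
    by rewrite cos2Dsin2 mulr1.
  by rewrite /sqdist /sqn /position /=; ring.
by rewrite addr_ge0 ?sqr_ge0.
Qed.

Lemma integral_gauss_site : \int[@site_measure R]_z (expR (- sqn z.1))%:E = pi%:E.
Proof.
have mexp : measurable_fun setT (fun s : R => (expR (- s))%:E).
  by apply/measurable_EFinP; apply: measurableT_comp.
have mz : measurable_fun setT (fun z : Z => (expR (- sqn z.1))%:E).
  apply: (measurableT_comp mexp).
  by apply: (measurableT_comp (@measurable_sqn R)); exact: measurable_fst.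
have z0 (z : Z) : 0 <= (expR (- sqn z.1))%:E by rewrite lee_fin expR_ge0.
rewrite (integral_site z0 mz) /=.
rewrite (eq_integral (fun=> pi%:E)).
  by rewrite integral_cst// [X in _ * X]probability_setT mule1.
move=> th _; rewrite (@integral_radial R (fun s => (expR (- s))%:E) _ mexp).
  by rewrite integral_expN mule1.
by move=> s; rewrite lee_fin expR_ge0.
Qed.

Lemma pair_int_lty : pair_int v 1 < +oo.
Proof.
have Ebd : pair_int v 8 <= (expR (4 * v ^+ 2) * (pi * pi))%:E.
  have mg : measurable_fun setT (fun z : Z => (expR (- sqn z.1))%:E).
    apply/measurable_EFinP; apply: measurableT_comp => //.
    apply: measurableT_comp => //; apply: (measurableT_comp (@measurable_sqn R)).
    exact: measurable_fst.
  have mgg : measurable_fun setT (fun p : Z * Z => (expR (- sqn p.1.1))%:E * (expR (- sqn p.2.1))%:E).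
    apply: emeasurable_funM.
      by apply: (measurableT_comp mg); exact: measurable_fst.
    by apply: (measurableT_comp mg); exact: measurable_snd.
  have gg0 (p : Z * Z) : 0 <= (expR (- sqn p.1.1))%:E * (expR (- sqn p.2.1))%:E.
    by rewrite mule_ge0 ?lee_fin ?expR_ge0.
  apply: (@le_trans _ _ (\int[@pair_measure R]_p ((expR (4 * v ^+ 2))%:E *
      ((expR (- sqn p.1.1))%:E * (expR (- sqn p.2.1))%:E)))).
    apply: ge0_le_integral => //.
    - by move=> p _; rewrite lee_fin mulr_ge0 ?pairw_ge0.
    - apply/measurable_EFinP; apply: measurable_funM; first exact: measurable_pairw.
      by apply: measurable_time_in; exact: measurable_itv.
    - by apply: emeasurable_funM => //; exact: measurable_cst.
    move=> p _; rewrite -!EFinM lee_fin /pairw.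
    case: ltP => s12; last by rewrite !mul0r !mulr_ge0 ?expR_ge0.
    rewrite mul1r indicE.
    have [|_] := boolP (_ \in I01); last by rewrite mulr0 !mulr_ge0 ?expR_ge0.
    rewrite inE /= in_itv /= => /andP[t0 t1].
    have n1 := sqn_le_sqdist p.1 (meet_time v p).
    have n2 := sqn_le_sqdist p.2 (meet_time v p).
    rewrite -(meet_sqE (lt0r_neq0 v0)) ?gt_eqF// in n2.
    rewrite -/(meet_sq v p) in n1.
    have tv : ((v * meet_time v p) ^+ 2 <= v ^+ 2)%R.
      by rewrite exprMn ler_piMr ?sqr_ge0// expr_le1.
    have h0 := meet_sq_ge0 v p.
    have he : (meet_sq v p <= expR (4 * meet_sq v p))%R.
      by apply: le_trans (expR_ge1Dx _); lra.
    rewrite mulr1 -!expRD; apply: (le_trans (ler_wpM2r (expR_ge0 _) he)).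
    by rewrite -expRD ler_expR; lra.
  rewrite ge0_integralZl//.
  rewrite [X in _ * X](_ : _ = (pi * pi)%:E) ?EFinM//.
  rewrite (integral_pair gg0 mgg) /=.
  rewrite (eq_integral (fun y => (expR (- sqn y.1))%:E * pi%:E)); last first.
    move=> y _; rewrite ge0_integralZl ?lee_fin ?expR_ge0//.
    by rewrite integral_gauss_site.
  rewrite ge0_integralZr ?lee_fin ?pi_ge0//.
  by rewrite integral_gauss_site.
have a0 : (0 < (8 : R) `^ (- (5 / 2)))%R by apply: powR_gt0.
have K8 : pair_int v 8 < +oo by apply: le_lt_trans Ebd _; rewrite ltry.
have K0 : 0 <= pair_int v 1.
  by apply: integral_ge0 => p _; rewrite lee_fin mulr_ge0 ?pairw_ge0.
move: K8; rewrite pair_int_scale//; move: K0; case: (pair_int v 1) => [r|//|//] _.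
  by move=> _; rewrite ltry.
by rewrite gt0_muley ?lte_fin// ltxx.
Qed.

Lemma pair_int_gt0 : 0 < pair_int v 1.
Proof.
have vn0 := lt0r_neq0 v0.
rewrite lt0e; apply/andP; split; last first.
  by apply: integral_ge0 => p _; rewrite lee_fin mulr_ge0 ?pairw_ge0.
apply/eqP => K0.
have := @pair_int_stationary R v v0 1 setT measurableT; rewrite K0 mule0.
rewrite (eq_integral (fun p => `|(pairw v 1 p)%:E|)); last first.
  by move=> p _; rewrite indicT mulr1 gee0_abs// lee_fin pairw_ge0.
have mE : measurable_fun setT (fun p => (pairw v 1 p)%:E).
  by apply/measurable_EFinP; exact: measurable_pairw.
move=> /(ae_eq_integral_abs _ measurableT mE) [N [mN N0 subN]].
pose B1 : set Z := (`]0%R, 1%R[ `*` `](-1)%R, 0%R[)%classic `*` `]0%R, (pi / 2)%R[%classic.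
pose B2 : set Z := (`](- 11)%R, (- 10)%R[ `*` `](- 11)%R, (- 10)%R[)%classic `*` `]0%R, (pi / 2)%R[%classic.
have BN : B1 `*` B2 `<=` N.
  move=> p; rewrite /B1 /B2 /= !in_itv /=.
  move=> [[[/andP[xa xb] /andP[ya yb]] /andP[ta tb]] [[/andP[xa' xb'] /andP[ya' yb']] /andP[ta' tb']]].
  apply: subN => /= /(_ I) [] ; apply/eqP; rewrite gt_eqF//.
  have cp (t : R) : (0 < t)%R -> (t < pi / 2)%R -> (0 < cos t)%R.
    by move=> t0 t1; apply: cos_gt0_pihalf; rewrite t1 andbT (lt_trans _ t0)// oppr_lt0 divr_gt0// pi_gt0.
  have sp (t : R) : (0 < t)%R -> (t < pi / 2)%R -> (0 < sin t)%R.
    move=> t0 t1; apply: sin_gt0_pi; rewrite t0/= (lt_le_trans t1)// ler_pdivrMr//.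
    by rewrite ler_peMr ?pi_ge0// ler1n.
  have c1 := cp _ ta tb; have s1 := sp _ ta tb; have c2 := cp _ ta' tb'; have s2 := sp _ ta' tb'.
  have cs1 := cos2Dsin2 p.1.2; have cs2 := cos2Dsin2 p.2.2.
  have sl : (slope p.2 < slope p.1)%R.
    rewrite /slope; set a := cos p.1.2 in c1 cs1 *; set b := sin p.1.2 in s1 cs1 *.
    set a' := cos p.2.2 in c2 cs2 *; set b' := sin p.2.2 in s2 cs2 *.
    have b1 : (b <= 1)%R by nra.
    have ab : (1 <= a' + b')%R by nra.
    have h1 : (- 1 < p.1.1.1 * a + p.1.1.2 * b)%R by nra.
    have h2 : (p.2.1.1 * a' + p.2.1.2 * b' < - 10 * (a' + b'))%R by nra.
    nra.
  have hp : (0 < meet_sq v p)%R.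
    rewrite /meet_sq sqdistE; set t := (v * _)%R.
    have -> : (sqn p.1.1 + 2 * t * slope p.1 + t ^+ 2 =
      (t + slope p.1) ^+ 2 + (p.1.1.2 * cos p.1.2 - p.1.1.1 * sin p.1.2) ^+ 2)%R.
      transitivity (sqn p.1.1 * (cos p.1.2 ^+ 2 + sin p.1.2 ^+ 2) + 2 * t * slope p.1 + t ^+ 2)%R.
        by rewrite cs1 mulr1.
      by rewrite /sqn /slope; ring.
    rewrite ltr_wpDl ?sqr_ge0// exprn_even_gt0//= lt_eqF//.
    nra.
  by rewrite /pairw sl mul1r mulr_gt0 ?expR_gt0.
have mB1 : measurable B1.
  by apply: measurableX; [apply: measurableX|]; exact: measurable_itv.
have mB2 : measurable B2.
  by apply: measurableX; [apply: measurableX|]; exact: measurable_itv.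
have : @pair_measure R (B1 `*` B2) = 0.
  have mBB : measurable (B1 `*` B2) by exact: measurableX.
  by apply/eqP; rewrite -measure_le0 -N0 le_measure// inE.
have angle0 : 0 < (@angle_law R : set (mark R) -> \bar R) `]0%R, (pi / 2)%R[%classic.
  set Q : set (mark R) := `]0%R, (pi / 2)%R[%classic.
  have mQ : measurable Q by exact: measurable_itv.
  have -> : (@angle_law R : set (mark R) -> \bar R) Q =
      \int[uniform_prob (ltNpi R)]_x (\1_Q x : R)%:E.
    by rewrite integral_indic// setIT.
  have mQ1 : measurable_fun setT (fun x => (\1_Q x : R)%:E).
    by apply/measurable_EFinP; exact: measurable_indic.
  have Q0 x : 0 <= (\1_Q x : R)%:E by rewrite lee_fin.
  rewrite (integral_uniform (ltNpi R) mQ1 Q0).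
  rewrite integral_indic// setIidl; last first.
    move=> x; rewrite /= !in_itv /= => /andP[x0 x1].
    apply/andP; split; apply: ltW; first by rewrite (lt_trans _ x0)// oppr_lt0 pi_gt0.
    by rewrite (lt_trans x1)// ltr_pdivrMr// ltr_pMr ?pi_gt0// ltr1n.
  have LQ : leb Q = (pi / 2)%:E.
    by rewrite /Q lebesgue_measure_itv/= lte_fin divr_gt0 ?pi_gt0// -EFinD subr0.
  rewrite [X in _ * X]LQ mule_gt0// lte_fin; last by rewrite divr_gt0 ?pi_gt0.
  by rewrite invr_gt0 subr_gt0 ltNpi.
have site_box (a b c e : R) : (a < b)%R -> (c < e)%R ->
    0 < @site_measure R ((`]a, b[ `*` `]c, e[)%classic `*` `]0%R, (pi / 2)%R[%classic).
  move=> ab ce.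
  have m1 : measurable (`]a, b[%classic : set (mark R)) by exact: measurable_itv.
  have m2 : measurable (`]c, e[%classic : set (mark R)) by exact: measurable_itv.
  have m3 : measurable (`]0%R, (pi / 2)%R[%classic : set (mark R)) by exact: measurable_itv.
  rewrite -[@site_measure R : set _ -> _]/(@area R \x @angle_law R).
  rewrite (product_measure1E _ _ (measurableX m1 m2) m3) mule_gt0// [ltRHS](area_setX m1 m2).
  by rewrite !lebesgue_measure_itv/= !lte_fin ab ce -!EFinD mule_gt0// lte_fin subr_gt0.
rewrite -[@pair_measure R : set _ -> _]/(@site_measure R \x @site_measure R).
rewrite (product_measure1E _ _ mB1 mB2); apply/eqP; rewrite gt_eqF//.
by apply: mule_gt0; apply: site_box; lra.
Qed.

End pair_integral_bounds.

(** * P15 *)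
Section serving_integral.
Context (R : realType) (v : R).
Hypothesis v0 : 0 < v.
Local Notation Z := (plane R * mark R)%type.
Local Notation leb := (@lebesgue_measure R).
Local Notation I01 := (`[0%R, 1%R]%classic : set (measurableTypeR R)).
Local Notation J01 := (`[0%R, 1%R[%classic : set (measurableTypeR R)).
Local Open Scope ereal_scope.

Lemma integral_sqdist (phi : R -> \bar R) t : (forall s, 0 <= phi s) ->
  measurable_fun setT phi ->
  \int[@site_measure R]_z phi (sqdist v z t) =
  pi%:E * \int[leb]_(s in `[0%R, +oo[) phi s.
Proof.
move=> phi0 mphi.
have mz : measurable_fun setT (fun z : Z => phi (sqn z.1)).
  apply: (measurableT_comp mphi).
  by apply: (measurableT_comp (@measurable_sqn R)); exact: measurable_fst.
have z0 (z : Z) : 0 <= phi (sqn z.1) by [].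
rewrite -[LHS]/(\int[@site_measure R]_z (fun z => phi (sqn z.1)) (flow v t z)).
rewrite (site_measure_flow v t z0 mz) (integral_site z0 mz) /=.
rewrite (eq_integral (fun=> pi%:E * \int[leb]_(s in `[0%R, +oo[) phi s)).
  by rewrite integral_cst// [X in _ * X]probability_setT mule1.
by move=> th _; rewrite (integral_radial phi0 mphi).
Qed.

Lemma site_circle h t :
  \int[@site_measure R]_z ((sqdist v z t == h)%:R : R)%:E = 0.
Proof.
have mh : measurable ([set h] : set (measurableTypeR R)) by exact: measurable_set1.
have E1 (x : R) : ((x == h)%:R : R) = \1_([set h] : set (measurableTypeR R)) x.
  by rewrite indicE; congr ((nat_of_bool _)%:R); apply/eqP/idP; rewrite inE.
rewrite (integral_sqdist (phi := fun x => ((x == h)%:R : R)%:E)).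
- rewrite (eq_integral (fun x => (\1_([set h] : set (measurableTypeR R)) x : R)%:E)); last first.
    by move=> x _; rewrite E1.
  rewrite integral_indic//.
  have mI : measurable ([set h] `&` `[0%R, +oo[%classic : set (measurableTypeR R)).
    by apply: measurableI => //; exact: measurable_itv.
  rewrite [X in _ * X](_ : _ = 0) ?mule0//.
  by apply/eqP; rewrite -measure_le0 -(lebesgue_measure_set1 h) le_measure ?inE.
- by move=> s; rewrite lee_fin.
- apply/measurable_EFinP; apply: measurable_bool_natr.
  by apply: measurable_fun_eqr => //; exact: measurable_id.
Qed.

Lemma measurable_serving (h b : R) :
  measurable_fun setT (fun s : R => ((s < h)%R%:R * expR (- b * s))%:E).
Proof.
apply/measurable_EFinP; apply: measurable_funM.
  by apply: measurable_bool_natr; exact: measurable_fun_ltr.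
by apply: (measurableT_comp (@measurable_expR R)); exact: measurable_funM.
Qed.

Lemma serving_integral h b t : (0 <= h)%R ->
  \int[@site_measure R]_z ((sqdist v z t < h)%R%:R * expR (- b * sqdist v z t))%:E =
  pi%:E * \int[leb]_r (\1_J01 r * (h * expR (- (b * h * r))))%:E.
Proof.
move=> h0.
rewrite (integral_sqdist (phi := fun s => ((s < h)%R%:R * expR (- b * s))%:E)); last 2 first.
- by move=> s; rewrite lee_fin mulr_ge0 ?expR_ge0.
- exact: measurable_serving.
congr (_ * _).
have mJ : measurable J01 by exact: measurable_itv.
have [->|hn0] := eqVneq h 0%R.
  transitivity (0 : \bar R).
    apply: integral0_eq => s; rewrite /= in_itv/= andbT => s0.
    by rewrite ltNge s0/= mul0r.
  by apply/esym/integral0_eq => s _; rewrite mul0r mulr0.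
have hp : (0 < h)%R by rewrite lt_def hn0.
rewrite integral_mkcond.
pose g (s : measurableTypeR R) : \bar R := (((0 <= s)%R && (s < h)%R)%:R * expR (- b * s))%:E.
have mg : measurable_fun setT g.
  apply/measurable_EFinP; apply: measurable_funM; last first.
    by apply: (measurableT_comp (@measurable_expR R)); exact: measurable_funM.
  apply: measurable_bool_natr; apply: measurable_and.
    exact: measurable_fun_ler.
  exact: measurable_fun_ltr.
rewrite (eq_integral g); last first.
  move=> s _; rewrite /g patchE mem_setE in_itv/= andbT.
  by case: (0 <= s)%R => /=; last rewrite mul0r.
rewrite (integral_affine 0 hp _ mg); last first.
  by move=> s; rewrite lee_fin mulr_ge0 ?expR_ge0.
rewrite -ge0_integralZl_EFin ?lee_fin//; last 2 first.
- by move=> s _; rewrite lee_fin mulr_ge0 ?expR_ge0.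
- apply: (measurableT_comp mg); exact: measurable_affine.
apply: eq_integral => r _; rewrite /g addr0 -EFinM; congr EFin.
rewrite indicE pmulr_rge0// gtr_pMr//.
rewrite (_ : (r \in _) = (0 <= r < 1)%R); last first.
  by apply/idP/idP; rewrite inE /= in_itv.
rewrite mulrCA; congr (_ * (_ * expR _))%R; ring.
Qed.

End serving_integral.

(** * P16 *)
Section power_integral.
Context (R : realType).
Local Notation leb := (@lebesgue_measure R).
Local Notation J01 := (`[0%R, 1%R[%classic : set (measurableTypeR R)).

Lemma is_derive_powR_affine (c a b r : R) : 0 < a + b * r ->
  is_derive r (1 : R) (fun x => (a + b * x) `^ c) (b * (c * (a + b * r) `^ (c - 1))).
Proof.
move=> ab0.
have h : is_derive r (1 : R) (fun x : R => a + b * x) b.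
  apply: is_derive_eq; rewrite /GRing.scale/=; ring.
have := @is_derive1_comp R (@powR R ^~ c) (fun x => a + b * x) r _ _ (is_derive1_powR c ab0) h.
by rewrite mulrC.
Qed.

Lemma continuous_powR_affine (c a b r : R) : 0 < a + b * r ->
  {for r, continuous (fun x => (a + b * x) `^ c)}.
Proof.
move=> ab0; apply: differentiable_continuous; apply/derivable1_diffP.
by have [] := is_derive_powR_affine c ab0.
Qed.

Lemma integral_powR (a b : R) : 0 < a -> 0 <= b ->
  (\int[leb]_r (\1_J01 r * (a + b * r) `^ (- (5 / 2)))%:E =
  (if b == 0 then a `^ (- (5 / 2))
   else 2 / (3 * b) * (a `^ (- (3 / 2)) - (a + b) `^ (- (3 / 2))))%:E)%E.
Proof.
move=> a0 b0.
have pos (r : R) : 0 <= r -> 0 < a + b * r.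
  by move=> r0; rewrite ltr_wpDr// mulr_ge0.
rewrite (eq_integral (((fun r => ((a + b * r) `^ (- (5 / 2)))%:E) \_ J01)%E)); last first.
  move=> r _; rewrite patchE indicE; case: ifPn => _.
    by rewrite mul1r.
  by rewrite mul0r.
rewrite -integral_mkcond.
have [->|bn0] := eqVneq b 0.
  rewrite (eq_integral (fun=> (a `^ (- (5 / 2)))%:E)); last first.
    by move=> r _; rewrite mul0r addr0.
  have mJ : measurable J01 by exact: measurable_itv.
  rewrite integral_cst//.
  by rewrite [X in (_ * X)%E]lebesgue_measure_itv/= lte_fin ltr01 oppr0 adde0 mule1.
have mf : measurable_fun setT (fun r => (a + b * r) `^ (- (5 / 2)) : R).
  apply: (measurableT_comp (measurable_powR _)).
  by apply: measurable_funD => //; exact: measurable_funM.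
rewrite integral_itv_bndo_bndc; last first.
  by apply/measurable_EFinP; apply: measurable_funTS.
pose k := - (2 / (3 * b)).
pose F (r : R) := k * (a + b * r) `^ (- (3 / 2)).
have dF (r : R) : 0 <= r -> is_derive r (1 : R) F ((a + b * r) `^ (- (5 / 2))).
  move=> /pos r0; have h := is_derive_powR_affine (- (3 / 2)) r0.
  apply: is_derive_eq; rewrite /GRing.scale/= /k.
  rewrite (_ : - (3 / 2) - 1 = - (5 / 2)); last by lra.
  by field; rewrite bn0.
have cF (r : R) : 0 <= r -> {for r, continuous F}.
  move=> /dF h; apply: differentiable_continuous; apply/derivable1_diffP.
  by case: h.
rewrite (@continuous_FTC2 R (fun r => (a + b * r) `^ (- (5 / 2))) F 0 1)//.
- rewrite /F /k mulr0 addr0 mulr1 -EFinB; congr EFin.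
  by ring.
- apply: continuous_in_subspaceT => r; rewrite inE/= in_itv/= => /andP[r0 _].
  exact: continuous_powR_affine (pos _ r0).
- split.
  + by move=> r; rewrite in_itv/= => /andP[/ltW r0 _]; case: (dF _ r0).
  + by apply: cvg_at_right_filter; exact: cF.
  + by apply: cvg_at_left_filter; apply: cF.
- move=> r; rewrite in_itv/= => /andP[/ltW r0 _].
  by rewrite derive1E; case: (dF _ r0).
Qed.

Lemma joint_laplaceE (lambda gamma beta : R) : 0 < lambda -> 0 <= gamma ->
  0 <= beta ->
  joint_laplace lambda gamma beta =
  (lambda * pi) `^ (5 / 2) *
  (if beta == 0 then (lambda * pi + gamma) `^ (- (5 / 2)) else
   2 / (3 * beta) * ((lambda * pi + gamma) `^ (- (3 / 2)) -
                     (lambda * pi + gamma + beta) `^ (- (3 / 2)))).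
Proof.
move=> l0 g0 b0; pose c := lambda * pi.
have c0 : 0 < c by rewrite mulr_gt0// pi_gt0.
have cn0 := lt0r_neq0 c0.
rewrite -/c.
have split52 : c `^ (5 / 2) = c * c `^ (3 / 2).
  rewrite -{2}(powRr1 (ltW c0)) -powRD; last by rewrite cn0 implybT.
  by congr (_ `^ _); lra.
have normal (x : R) : 0 <= x ->
    (1 + x / c) `^ (- (3 / 2)) = c `^ (3 / 2) * (c + x) `^ (- (3 / 2)).
  move=> x0.
  have -> : 1 + x / c = c^-1 * (c + x) by rewrite mulrDr mulVf// mulrC.
  rewrite powRM ?invr_ge0 ?addr_ge0 ?(ltW c0)//; congr (_ * _).
  by rewrite -powR_inv1 ?(ltW c0)// -powRrM; congr (_ `^ _); lra.
have pos (b : R) : 0 < b -> laplace_pos lambda gamma b =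
    c `^ (5 / 2) * (2 / (3 * b) *
      ((c + gamma) `^ (- (3 / 2)) - (c + gamma + b) `^ (- (3 / 2)))).
  move=> bp; rewrite /laplace_pos -/c !normal ?addr_ge0 ?(ltW bp)//.
  rewrite -(mulrA 2) -/c.
  rewrite addrA split52; field; exact: lt0r_neq0.
rewrite /joint_laplace; case: ifPn => [_|bn0]; last first.
  by apply: pos; rewrite lt_def bn0.
apply/cvg_lim => //.
have h : is_derive (0 : R) (1 : R) (fun b => (c + gamma + 1 * b) `^ (- (3 / 2)))
    (1 * (- (3 / 2) * (c + gamma + 1 * 0) `^ (- (3 / 2) - 1))).
  by apply: is_derive_powR_affine; rewrite mulr0 addr0 ltr_wpDr.
have [dh vh] := h.
have := dh; rewrite /derivable => /cvg_dnbhs_at_right hh.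
rewrite /derive in vh; rewrite vh in hh.
have := cvgM (cvg_cst (- (2 / 3) * c `^ (5 / 2))) hh.
rewrite !mul1r !addr0 (_ : - (3 / 2) - 1 = - (5 / 2)); last by lra.
rewrite (_ : _ * (- (3 / 2) * _) = c `^ (5 / 2) * (c + gamma) `^ (- (5 / 2))); last by field.

move=> lim0; refine (cvg_trans _ (lim0 _ _)); apply: near_eq_cvg.
near=> b; rewrite pos; last by near: b; exact: nbhs_right_gt.
have bn0 : b != 0 by rewrite gt_eqF//; near: b; exact: nbhs_right_gt.
rewrite /= /GRing.scale /= mulr1 addr0 mul1r.
by field.
Unshelve. all: by end_near.
Qed.
End power_integral.

(** * P17 *)
Section triple_integral.
Context (R : realType) (v : R).
Hypothesis v0 : 0 < v.
Local Notation Z := (plane R * mark R)%type.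
Local Notation leb := (@lebesgue_measure R).
Local Notation I01 := (`[0%R, 1%R]%classic : set (measurableTypeR R)).
Local Notation J01 := (`[0%R, 1%R[%classic : set (measurableTypeR R)).
Local Open Scope ereal_scope.

Definition serving_sq (p : Z * (Z * Z)) : R := sqdist v p.1 (meet_time v p.2).

Definition handover_weight a b (p : Z * (Z * Z)) : R :=
  ((slope p.2.2 < slope p.2.1)%R%:R * \1_I01 (meet_time v p.2) *
   ((serving_sq p < meet_sq v p.2)%R%:R *
    expR (- a * meet_sq v p.2 - b * serving_sq p)))%R.

Lemma handover_weight_ge0 a b p : (0 <= handover_weight a b p)%R.
Proof. by rewrite !mulr_ge0 ?expR_ge0. Qed.

Lemma measurable_serving_sq : measurable_fun setT serving_sq.
Proof.
apply: (@measurable_sqdist R _ (Z * (Z * Z))%type v fst (fun p => meet_time v p.2)).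
  exact: measurable_fst.
apply: (measurableT_comp (@measurable_meet_time1 R v)).
exact: measurable_snd.
Qed.

Lemma measurable_meet_sq2 : measurable_fun setT (fun p : Z * (Z * Z) => meet_sq v p.2).
Proof. by apply: (measurableT_comp (@measurable_meet_sq1 R v)); exact: measurable_snd. Qed.

Lemma measurable_handover_weight a b : measurable_fun setT (handover_weight a b).
Proof.
have m1 := measurable_serving_sq; have m2 := measurable_meet_sq2.
apply: measurable_funM; apply: measurable_funM.
- apply: measurable_bool_natr; apply: (measurableT_comp (@measurable_slope_lt R)).
  exact: measurable_snd.
- have mI : measurable I01 by exact: measurable_itv.
  by apply: (measurableT_comp (measurable_time_in v mI)); exact: measurable_snd.
- by apply: measurable_bool_natr; exact: measurable_fun_ltr.
- apply: (measurableT_comp (@measurable_expR R)).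
  by apply: measurable_funB; exact: measurable_funM.
Qed.

Lemma integral_handover_weight a b : (0 < a)%R -> (0 <= b)%R ->
  \int[@pair_measure R]_q \int[@site_measure R]_z (handover_weight a b (z, q))%:E =
  pi%:E * (pair_int v 1 *
           \int[leb]_r (\1_J01 r * (a + b * r) `^ (- (5 / 2)))%:E).
Proof.
move=> a0 b0.
have pos (r : R) : (0 <= r)%R -> (0 < a + b * r)%R.
  by move=> r0; rewrite ltr_wpDr// mulr_ge0.
have mJ : measurable J01 by exact: measurable_itv.
have mI : measurable I01 by exact: measurable_itv.
pose G (y : (Z * Z) * measurableTypeR R) : \bar R :=
  (\1_J01 y.2 * (pairw v (a + b * y.2) y.1 * \1_I01 (meet_time v y.1)))%:E.
have G0 y : 0 <= G y by rewrite lee_fin mulr_ge0// mulr_ge0// pairw_ge0.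
have mG : measurable_fun setT G.
  apply/measurable_EFinP; apply: measurable_funM.
    apply: (measurableT_comp (f := \1_J01 : measurableTypeR R -> R)).
      exact: measurable_indic.
    exact: measurable_snd.
  apply: measurable_funM; last first.
    by apply: (measurableT_comp (measurable_time_in v mI)); exact: measurable_fst.
  have mq : measurable_fun setT (fun y : (Z * Z) * measurableTypeR R => meet_sq v y.1).
    by apply: (measurableT_comp (@measurable_meet_sq1 R v)); exact: measurable_fst.
  apply: measurable_funM.
    apply: measurable_bool_natr; apply: (measurableT_comp (@measurable_slope_lt R)).
    exact: measurable_fst.
  apply: measurable_funM => //.
  apply: (measurableT_comp (@measurable_expR R)).
  apply: measurable_funM => //; apply: measurableT_comp => //.
  by apply: measurable_funD => //; apply: measurable_funM => //; exact: measurable_snd.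
have mG1 (q : Z * Z) : measurable_fun setT (fun r => G (q, r)).
  by apply: (measurableT_comp mG); exact: pair1_measurable.
rewrite (eq_integral (fun q => pi%:E * \int[leb]_r G (q, r))); last first.
  move=> q _; rewrite /handover_weight /=.
  pose c : R := ((slope q.2 < slope q.1)%R%:R * \1_I01 (meet_time v q) *
    expR (- a * meet_sq v q))%R.
  have c0 : (0 <= c)%R by rewrite !mulr_ge0 ?expR_ge0.
  rewrite (eq_integral (fun z => c%:E * ((sqdist v z (meet_time v q) < meet_sq v q)%R%:R *
      expR (- b * sqdist v z (meet_time v q)))%:E)); last first.
    move=> z _; rewrite -EFinM; congr EFin; rewrite /c /serving_sq /= !mulNr expRD.
    ring.
  have mz : measurable_fun setT (fun z : Z => ((sqdist v z (meet_time v q) < meet_sq v q)%R%:R *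
      expR (- b * sqdist v z (meet_time v q)))%:E).
    apply: (measurableT_comp (measurable_serving (meet_sq v q) b)).
    apply: (@measurable_sqdist R _ Z v id (fun=> meet_time v q)).
      exact: measurable_id.
    exact: measurable_cst.
  rewrite ge0_integralZl//.
  rewrite (@serving_integral R v _ b (meet_time v q) (meet_sq_ge0 v q)).
  rewrite muleCA; congr (_ * _).
  have mr : measurable_fun setT (fun r : measurableTypeR R =>
      (\1_J01 r * (meet_sq v q * expR (- (b * meet_sq v q * r))))%:E).
    apply/measurable_EFinP; apply: measurable_funM; first exact: measurable_indic.
    apply: measurable_funM => //; apply: (measurableT_comp (@measurable_expR R)).
    by apply: measurableT_comp => //; exact: measurable_funM.
  rewrite -ge0_integralZl//; last first.
    by move=> r _; rewrite lee_fin !mulr_ge0 ?expR_ge0 ?meet_sq_ge0.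
  apply: eq_integral => r _; rewrite /G /= -EFinM; congr EFin.
  rewrite /c /pairw.
  have -> : (- (a + b * r) * meet_sq v q = - a * meet_sq v q - b * meet_sq v q * r)%R by ring.
  by rewrite expRD; ring.
rewrite ge0_integralZl//; last 3 first.
- exact: (measurable_fun_fubini_tonelli_F (m2 := leb) G mG G0).
- by move=> q _; exact: integral_ge0.
- by rewrite lee_fin pi_ge0.
congr (_ * _).
rewrite -(integral_sigprod (@pair_measure R) leb G0 mG) (integral_sigprodC _ _ G0 mG).
rewrite (eq_integral (fun r => (\1_J01 r * (a + b * r) `^ (- (5 / 2)))%:E * pair_int v 1)).
  rewrite ge0_integralZr// 1?muleC//.
  - apply/measurable_EFinP; apply: measurable_funM; first exact: measurable_indic.
    apply: (measurableT_comp (measurable_powR _)).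
    by apply: measurable_funD => //; exact: measurable_funM.
  - by move=> r _; rewrite lee_fin mulr_ge0 ?powR_ge0.
  - exact/ltW/pair_int_gt0.
move=> r _; rewrite /G /= indicE.
case: (boolP (r \in J01)) => rJ; last first.
  by rewrite mul0r mul0e; apply: integral0_eq => q _; rewrite mul0r.
have r0 : (0 <= r)%R by move: rJ; rewrite inE /= in_itv/= => /andP[].
rewrite mul1r -pair_int_scale ?pos//.
by apply: eq_integral => q _; rewrite mul1r.
Qed.

End triple_integral.

(** * P18 *)
Section null_change.
Import HBNNSimple.
Context d (T : measurableType d) (R : realType)
  (mu : {measure set T -> \bar R}).
Local Open Scope ereal_scope.

Lemma ge0_integral_null_change (f g : T -> \bar R) (N : set T) :
  measurable N -> mu N = 0 -> (forall x, 0 <= f x) -> (forall x, 0 <= g x) ->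
  measurable_fun setT g -> (forall x, ~ N x -> f x = g x) ->
  \int[mu]_x f x = \int[mu]_x g x.
Proof.
move=> mN N0 f0 g0 mg fg; apply/eqP; rewrite eq_le; apply/andP; split.
  rewrite (ge0_integralTE mu f0); apply: ge_ereal_sup => _ [h hf <-].
  have mh : measurable_fun setT (fun x => (h x)%:E).
    by apply/measurable_EFinP; exact: measurable_funPT.
  have h0 x : setT x -> 0 <= (h x)%:E by rewrite lee_fin.
  have <- : \int[mu]_x (h x)%:E = sintegral mu h by rewrite integral_nnsfun// patch_setT.
  rewrite (ge0_negligible_integral mN _ mh h0 N0)//.
  rewrite (ge0_negligible_integral mN _ mg _ N0)//.
  have mTN : measurable (setT `\` N) by exact: measurableD.
  apply: ge0_le_integral => //; do ?exact: measurable_funTS.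
    by move=> x _; exact: h0.
  by move=> x [_ Nx]; rewrite -fg.
rewrite (ge0_negligible_integral mN _ mg _ N0)// integral_mkcond.
have gN0 x : 0 <= (g \_ (setT `\` N)) x by rewrite patchE; case: ifPn.
rewrite (ge0_integralTE mu gN0) (ge0_integralTE mu f0).
apply: le_ereal_sup => _ [h hg <-]; exists h => // x.
apply: le_trans (hg x) _; rewrite patchE; case: ifPn => //.
by rewrite inE => -[_ Nx]; rewrite fg.
Qed.

End null_change.

Section distinct_esum.
Context (R : realType).
Local Open Scope ereal_scope.

Definition index_list (s : nat * (nat * nat)) : seq nat := [:: s.1; s.2.1; s.2.2].

Lemma nsum3_esum (G : seq nat -> \bar R) : (forall s, 0 <= G s) ->
  nsum 3 [::] G =
  \esum_(s in [set s | uniq (index_list s)]) G (index_list s).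
Proof.
move=> G0.
pose G' (s : nat * (nat * nat)) : \bar R :=
  if uniq (index_list s) then G (index_list s) else 0.
have G'0 s : 0 <= G' s by rewrite /G'; case: ifP.
transitivity (\esum_(i in [set: nat]) \esum_(j in [set: nat])
    \esum_(k in [set: nat]) G' (i, (j, k))).
  rewrite /= -nneseries_esumT; last by move=> i; do 2 apply: esum_ge0 => *.
  apply: eq_eseriesr => i _; rewrite -nneseries_esumT; last first.
    by move=> j; apply: esum_ge0 => *.
  apply: eq_eseriesr => j _; rewrite -nneseries_esumT//.
  rewrite inE; case: eqVneq => [->|ji].
    by rewrite eseries0// => k _ _; rewrite /G' /index_list /= inE eqxx.
  apply: eq_eseriesr => k _; rewrite /G' /index_list /= !inE.
  rewrite (eq_sym i j) (negbTE ji) (eq_sym i k) (eq_sym j k).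
  by case: (k == j); case: (k == i).
transitivity (\esum_(i in [set: nat]) \esum_(q in [set: nat * nat]) G' (i, q)).
  apply: eq_esum => i _.
  rewrite (@esum_esum R nat nat setT (fun=> setT) (fun j k => G' (i, (j, k))))//.
  rewrite (_ : _ `*`` _ = setT); last by apply/seteqP; split.
  by apply: eq_esum => -[].
rewrite (@esum_esum R nat (nat * nat)%type setT (fun=> setT) (fun i q => G' (i, q)))//.
rewrite (_ : _ `*`` _ = setT); last by apply/seteqP; split.
rewrite [RHS]esum_mkcond; apply: eq_esum => -[i q] _ /=; rewrite /G'.
by congr (if _ then _ else _); apply/idP/idP; rewrite inE.
Qed.

End distinct_esum.

(** * P19 *)
Section finite_product_swap.
Local Open Scope ereal_scope.

Lemma integral_finprodC (R : realType) d1 d2 (T1 : measurableType d1) (T2 : measurableType d2)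
    (m1 : {finite_measure set T1 -> \bar R})
    (m2 : {finite_measure set T2 -> \bar R}) (f : T1 * T2 -> \bar R) :
  (forall p, 0 <= f p) -> measurable_fun setT f ->
  \int[finprod m1 m2]_p f p = \int[m2]_y \int[m1]_x f (x, y).
Proof.
move=> f0 mf; rewrite integral_finprod//.
exact: (fubini_tonelli (m1 := m1) (m2 := m2) f mf f0).
Qed.

End finite_product_swap.

Section triple_law_integral.
Context (R : realType).
Local Notation Z := (plane R * mark R)%type.
Local Notation U := (Z * (Z * Z))%type.
Local Open Scope ereal_scope.
Variables (W : set (plane R)) (mW : measurable W) (fW : area W < +oo).
Local Notation nu := (site_law mW fW).

Lemma measurable_in_first (W' : set (plane R)) : measurable W' ->
  measurable_fun setT (fun z : Z => (\1_W' z.1 : R)%:E).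
Proof.
move=> mW'; apply/measurable_EFinP.
apply: (measurableT_comp (f := \1_W' : plane R -> R)); first exact: measurable_indic.
exact: measurable_fst.
Qed.

Lemma integral_triple_law (f : U -> \bar R) : (forall p, 0 <= f p) ->
  measurable_fun setT f ->
  \int[finprod nu (finprod nu nu)]_p f p =
  \int[@pair_measure R]_q \int[@site_measure R]_z
    ((\1_W z.1 * (\1_W q.1.1 * \1_W q.2.1))%R%:E * f (z, q)).
Proof.
move=> f0 mf.
rewrite (integral_finprodC _ _ f0 mf).
pose g (q : Z * Z) : \bar R := \int[@site_measure R]_z ((\1_W z.1)%:E * f (z, q)).
have mfz (q : Z * Z) : measurable_fun setT (fun z => f (z, q)).
  by apply: (measurableT_comp mf); exact: pair2_measurable.
have mWf : measurable_fun setT (fun p : U => (\1_W p.1.1 : R)%:E * f p).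
  apply: emeasurable_funM => //.
  by apply: (measurableT_comp (measurable_in_first mW)); exact: measurable_fst.
have Wf0 (p : U) : 0 <= (\1_W p.1.1 : R)%:E * f p by rewrite mule_ge0 ?lee_fin.
have mWfz (q : Z * Z) : measurable_fun setT (fun z => (\1_W z.1 : R)%:E * f (z, q)).
  by apply: emeasurable_funM => //; exact: measurable_in_first.
have g0 q : 0 <= g q by apply: integral_ge0 => z _; exact: Wf0 (z, q).
have mg : measurable_fun setT g.
  exact: (measurable_fun_fubini_tonelli_G (m1 := @site_measure R) _ mWf Wf0).
have mgy (y : Z) : measurable_fun setT (fun y' => g (y, y')).
  by apply: (measurableT_comp mg); exact: pair1_measurable.
transitivity (\int[finprod nu nu]_q g q).
  apply: eq_integral => q _.
  exact: (integral_site_law mW fW (fun z => f0 (z, q)) (mfz q)).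
transitivity (\int[nu]_y \int[nu]_y' g (y, y')).
  exact: (@integral_finprod R _ _ _ _ nu nu g g0 mg).
pose k (q : Z * Z) : \bar R := (\1_W q.2.1 : R)%:E * g q.
have k0 q : 0 <= k q by rewrite mule_ge0 ?lee_fin.
have mk : measurable_fun setT k.
  apply: emeasurable_funM => //.
  by apply: (measurableT_comp (measurable_in_first mW)); exact: measurable_snd.
transitivity (\int[nu]_y \int[@site_measure R]_y' k (y, y')).
  apply: eq_integral => y _.
  exact: (integral_site_law mW fW (fun y' => g0 (y, y')) (mgy y)).
have mK : measurable_fun setT (fun y => \int[@site_measure R]_y' k (y, y')).
  exact: (measurable_fun_fubini_tonelli_F (m2 := @site_measure R) _ mk k0).
have K0 y : 0 <= \int[@site_measure R]_y' k (y, y') by exact: integral_ge0.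
apply: (etrans (integral_site_law mW fW K0 mK)).
pose k1 (q : Z * Z) : \bar R := (\1_W q.1.1 : R)%:E * k q.
have k10 q : 0 <= k1 q by rewrite mule_ge0 ?lee_fin.
have mk1 : measurable_fun setT k1.
  apply: emeasurable_funM => //.
  by apply: (measurableT_comp (measurable_in_first mW)); exact: measurable_fst.
transitivity (\int[@pair_measure R]_q k1 q).
  rewrite (integral_pair k10 mk1); apply: eq_integral => y _.
  have mky : measurable_fun setT (fun y' => k (y, y')).
    by apply: (measurableT_comp mk); exact: pair1_measurable.
  have i0 : 0 <= (\1_W y.1 : R)%:E by rewrite lee_fin.
  exact: (esym (ge0_integralZl _ measurableT mky (fun y' _ => k0 (y, y')) i0)).
apply: eq_integral => q _; rewrite /k1 /k /g muleA -EFinM.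
have i0 : 0 <= (\1_W q.1.1 * \1_W q.2.1 : R)%:E by rewrite lee_fin mulr_ge0.
apply: (etrans (esym (ge0_integralZl _ measurableT (mWfz q) (fun z _ => Wf0 (z, q)) i0))).
by apply: eq_integral => z _; rewrite muleA -EFinM [X in X%:E * _ = _]mulrC.
Qed.

End triple_law_integral.

(** * P20 *)
Section windows.
Context (R : realType) (v : R).
Local Notation Z := (plane R * mark R)%type.
Local Notation U := (Z * (Z * Z))%type.
Local Notation leb := (@lebesgue_measure R).

Definition window m : set (plane R) := square (2 * m.+1%:R + 2 * v ^+ 2 + 1).

Lemma measurable_window m : measurable (window m).
Proof. exact: measurable_square. Qed.

Lemma area_window m : (area (window m) < +oo)%E.
Proof. exact: area_square. Qed.

Lemma sqn_square (x : plane R) r : 1 <= r -> sqn x <= r -> square r x.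
Proof.
move=> r1; rewrite /sqn => xr; have h1 := sqr_ge0 x.1; have h2 := sqr_ge0 x.2.
by rewrite /square /= !in_itv /=; split; apply/andP; split; nra.
Qed.

Lemma sqdist_window (z : Z) t m : 0 <= t <= 1 -> sqdist v z t < m.+1%:R ->
  window m z.1.
Proof.
move=> /andP[t0 t1] zm.
have v2 := sqr_ge0 v; have m0 : 0 <= m%:R :> R by [].
have mS : m.+1%:R = m%:R + 1 :> R by rewrite -natr1.
have h := sqn_le_sqdist v z t.
have vt : (v * t) ^+ 2 <= v ^+ 2 by rewrite exprMn ler_piMr// expr_le1.
by apply: sqn_square; lra.
Qed.

Definition nearer : set (U * Z) :=
  [set y | serving_sq v (y.2, y.1.2) < meet_sq v y.1.2].

Lemma measurable_nearer : measurable nearer.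
Proof.
have mU : measurable_fun setT (fun y : U * Z => y.1.2).
  by apply: (measurableT_comp measurable_snd); exact: measurable_fst.
rewrite -[nearer]setTI.
rewrite (_ : nearer = (fun y => serving_sq v (y.2, y.1.2) < meet_sq v y.1.2) @^-1` [set true]).
  have m : measurable_fun setT (fun y : U * Z => serving_sq v (y.2, y.1.2) < meet_sq v y.1.2).
    apply: measurable_fun_ltr.
      apply: (measurableT_comp (@measurable_serving_sq R v)).
      by apply: measurable_fun_pair => //; exact: measurable_snd.
    by apply: (measurableT_comp (@measurable_meet_sq1 R v)).
  exact: m.
by apply/seteqP; split=> y /=.
Qed.

Definition layer m (p : U) : R := (Num.truncn (meet_sq v p.2) == m)%:R.

Lemma measurable_layer m : measurable_fun setT (layer m).
Proof.
apply: measurable_bool_natr.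
rewrite (_ : (fun p : U => _) = (fun p => (m%:R <= meet_sq v p.2) && (meet_sq v p.2 < m.+1%:R))).
  have mq := measurable_meet_sq2 v.
  apply: measurable_and; first exact: measurable_fun_ler.
  exact: measurable_fun_ltr.
by apply/funext => p; rewrite truncn_eq ?meet_sq_ge0.
Qed.

Lemma sum_layer (p : U) (c : R) : 0 <= c ->
  (\sum_(m <oo) (c * layer m p)%:E)%E = c%:E.
Proof.
move=> c0; rewrite (@nneseries_seq _ [:: Num.truncn (meet_sq v p.2)])//.
- by rewrite big_seq1 /layer eqxx mulr1.
- by move=> m; rewrite lee_fin mulr_ge0.
- by move=> m; rewrite inE eq_sym /layer => /negbTE ->; rewrite mulr0.
Qed.

Lemma disk_integral (h t : R) : 0 <= h ->
  (\int[@site_measure R]_z ((sqdist v z t < h)%R%:R : R)%:E = (pi * h)%R%:E)%E.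
Proof.
move=> h0.
rewrite (eq_integral (fun z => ((sqdist v z t < h)%R%:R * expR (- 0 * sqdist v z t))%R%:E)); last first.
  by move=> z _; rewrite oppr0 mul0r expR0 mulr1.
rewrite (serving_integral v 0 t h0) EFinM; congr (_ * _)%E.
have mJ : measurable (`[0%R, 1%R[%classic : set (measurableTypeR R)) by exact: measurable_itv.
rewrite (eq_integral (fun r => h%:E * (\1_(`[0%R, 1%R[%classic : set (measurableTypeR R)) r : R)%:E)%E); last first.
  by move=> r _; rewrite !mul0r oppr0 expR0 mulr1 -EFinM mulrC.
rewrite ge0_integralZl//; last by apply/measurable_EFinP; exact: measurable_indic.
rewrite integral_indic// setIT.
by rewrite [X in (_ * X)%E]lebesgue_measure_itv/= lte_fin ltr01 oppr0 adde0 mule1.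
Qed.

Lemma handover_weight_window a b p m : v != 0 -> handover_weight v a b p * layer m p != 0 ->
  [/\ window m p.1.1, window m p.2.1.1, window m p.2.2.1 &
    forall z, serving_sq v (z, p.2) < meet_sq v p.2 -> window m z.1].
Proof.
move=> v0; rewrite !mulf_eq0 !negb_or => /andP[/andP[/andP[sl tI] /andP[ss _]] lay].
have slt : slope p.2.2 < slope p.2.1 by move: sl; rewrite pnatr_eq0 eqb0 negbK.
have t01 : 0 <= meet_time v p.2 <= 1.
  by move: tI; rewrite indicE pnatr_eq0 eqb0 negbK inE /= in_itv.
have st : serving_sq v p < meet_sq v p.2 by move: ss; rewrite pnatr_eq0 eqb0 negbK.
have hm : meet_sq v p.2 < m.+1%:R.
  move: lay; rewrite /layer pnatr_eq0 eqb0 negbK.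
  by rewrite truncn_eq ?meet_sq_ge0// => /andP[].
split.
- exact: (sqdist_window t01 (lt_trans st hm)).
- exact: (sqdist_window t01 hm).
- by apply: (sqdist_window t01); rewrite -meet_sqE// gt_eqF.
- by move=> z zs; exact: (sqdist_window t01 (lt_trans zs hm)).
Qed.

Lemma handover_weight_shift a b c p :
  handover_weight v a b p * expR (- (c * meet_sq v p.2)) = handover_weight v (a + c) b p.
Proof.
rewrite /handover_weight -!mulrA -expRD; do 2 congr (_ * _); congr (_ * expR _).
by ring.
Qed.

End windows.

(** * P21 *)
Lemma integral_indicT d (T : measurableType d) (R : realType)
    (m : {measure set T -> \bar R}) (A : set T) : measurable A ->
  (\int[m]_x (\1_A x : R)%:E = m A)%E.
Proof. by move=> mA; rewrite integral_indic// setIT. Qed.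

Section all_windows.
Context d (T : measurableType d) (R : realType) (P : probability T R).
Variables (lambda v : R) (X : nat -> {RV P >-> plane R})
  (Theta : nat -> {RV P >-> measurableTypeR R}).
Hypothesis lambda0 : 0 < lambda.
Hypothesis v0 : 0 < v.
Hypothesis poisX : homogeneous_poisson P lambda X.
Hypothesis unifTheta : iid_uniform_angles Theta.
Hypothesis indXTheta : independent_sequences P X Theta.
Local Notation Z := (plane R * mark R)%type.
Local Notation U := (Z * (Z * Z))%type.
Local Open Scope ereal_scope.

Definition unblocked s : set T := clear X Theta setT (nearer v) s.

Definition handover_sum a b w : \bar R := nsum 3 [::] (fun s =>
  (handover_weight v a b (triple X Theta s w) * \1_(unblocked s) w)%R%:E).

Lemma handover_sum_ge0 a b w : 0 <= handover_sum a b w.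
Proof. by apply: nsum_ge0 => s; rewrite lee_fin mulr_ge0 ?handover_weight_ge0. Qed.

Lemma measurable_handover_sum a b : measurable_fun setT (handover_sum a b).
Proof.
apply: (measurable_nsum 3 [::] (G := fun s w =>
  (handover_weight v a b (triple X Theta s w) * \1_(unblocked s) w)%R%:E)).
  by move=> s w; rewrite lee_fin mulr_ge0 ?handover_weight_ge0.
move=> s; apply/measurable_EFinP; apply: measurable_funM.
  apply: (measurableT_comp (@measurable_handover_weight R v a b)).
  exact: measurable_triple.
apply: measurable_indic; apply: measurable_clear; first exact: measurableT.
exact: measurable_nearer.
Qed.

Variables (a b : R).
Let u m (p : U) : R := (handover_weight v a b p * layer v m p)%R.
Let mW m := measurable_window v m.
Let fW m := area_window v m.

Let u0 m p : (0 <= u m p)%R. Proof. by rewrite mulr_ge0 ?handover_weight_ge0. Qed.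

Let mu m : measurable_fun setT (u m).
Proof.
apply: measurable_funM; first exact: measurable_handover_weight.
exact: measurable_layer.
Qed.

Lemma handover_sum_windows w : handover_sum a b w =
  \sum_(m <oo) mecke_sum X Theta (window v m) (u m) (nearer v) w.
Proof.
have vn0 : v != 0%R by exact: lt0r_neq0.
rewrite /mecke_sum -nsum_nneseries; last first.
  by move=> m s; rewrite mule_ge0 ?mule_ge0 ?lee_fin ?u0.
apply: eq_nsum => s; case: s => [|i [|j [|k []]]]//= _ _ _.
set p := triple X Theta [:: i; j; k] w.
have hw0 : (0 <= handover_weight v a b p * \1_(unblocked [:: i; j; k]) w)%R.
  by rewrite mulr_ge0 ?handover_weight_ge0.
rewrite -(@sum_layer R v p _ hw0); apply: eq_eseriesr => m _.
rewrite -!EFinM; congr EFin; rewrite mulrAC -/(u m p).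
have [->|un0] := eqVneq (u m p) 0%R; first by rewrite !mul0r mulr0.
have [Wi Wj Wk Wz] := handover_weight_window vn0 un0.
rewrite !mem_set//= mul1r; congr (_ * _)%R; rewrite !indicE.
congr (nat_of_bool _)%:R; apply/idP/idP; rewrite !inE => H l ls.
  by move=> _; exact: H.
by move=> _ Bl; exact: (H l ls (Wz _ Bl) Bl).
Qed.

Lemma integral_handover_sum : \int[P]_w handover_sum a b w =
  (lambda ^+ 3)%:E * \int[@pair_measure R]_q \int[@site_measure R]_z
    (handover_weight v (a + lambda * pi) b (z, q))%:E.
Proof.
have vn0 : v != 0%R by exact: lt0r_neq0.
have mB := measurable_nearer v.
rewrite (eq_integral (fun w => \sum_(m <oo)
    mecke_sum X Theta (window v m) (u m) (nearer v) w)); last first.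
  by move=> w _; exact: handover_sum_windows.
rewrite integral_nneseries//; last 2 first.
- by move=> m; exact: measurable_mecke_sum.
- by move=> m w _; exact: mecke_sum_ge0.
pose F m (p : U) : \bar R := (handover_weight v (a + lambda * pi) b p * layer v m p)%R%:E.
have F0 m p : 0 <= F m p by rewrite lee_fin mulr_ge0 ?handover_weight_ge0.
have mF m : measurable_fun setT (F m).
  apply/measurable_EFinP; apply: measurable_funM; first exact: measurable_handover_weight.
  exact: measurable_layer.
have FE m p : F m p = (u m p * expR (- (lambda * pi * meet_sq v p.2)))%R%:E.
  by rewrite /F -handover_weight_shift mulrAC.
have window_term m : \int[P]_w mecke_sum X Theta (window v m) (u m) (nearer v) w =
    (lambda ^+ 3)%:E * \int[@pair_measure R]_q \int[@site_measure R]_z F m (z, q).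
  rewrite (mecke_window (ltW lambda0) poisX unifTheta indXTheta (mW m) (fW m) (u0 m) (mu m) mB).
  congr (_ * _).
  set nu := site_law (mW m) (fW m).
  pose f p : \bar R := (u m p)%:E *
    (expR (- (lambda * fine (nu (xsection (nearer v) p)))))%:E.
  have f0 p : 0 <= f p by rewrite mule_ge0 ?lee_fin ?expR_ge0 ?u0.
  have mf : measurable_fun setT f.
    apply: emeasurable_funM; apply/measurable_EFinP => //.
    apply: (measurableT_comp (@measurable_expR R)).
    have mnu : measurable_fun setT (fun p => fine (nu (xsection (nearer v) p))).
      apply: (measurableT_comp (f := fine)); first exact: fine_measurable.
      exact: measurable_fun_xsection.
    by apply: measurableT_comp => //; exact: measurable_funM.
  apply: (etrans (integral_triple_law (mW m) (fW m) f0 mf)).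
  apply: eq_integral => q _; apply: eq_integral => z _.
  rewrite FE /f; set p := (z, q).
  have [->|un0] := eqVneq (u m p) 0%R; first by rewrite !mul0r mul0e mule0.
  have [Wi Wj Wk Wz] := handover_weight_window vn0 un0.
  rewrite !indicE !mem_set// !mul1r mul1e -EFinM; congr ((_ * expR (- _))%R%:E).
  rewrite -mulrA; congr (_ * _)%R.
  have mxB : measurable (xsection (nearer v) p) by exact: measurable_xsection.
  have -> : nu (xsection (nearer v) p) =
      \int[nu]_z' (\1_(xsection (nearer v) p) z' : R)%:E.
    exact: (esym (integral_indicT _ mxB)).
  have m1 : measurable_fun setT (fun z' : Z => (\1_(xsection (nearer v) p) z' : R)%:E).
    by apply/measurable_EFinP; exact: measurable_indic.
  have i0 (z' : Z) : 0 <= (\1_(xsection (nearer v) p) z' : R)%:E by rewrite lee_fin.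
  rewrite (integral_site_law (mW m) (fW m) i0 m1).
  rewrite (eq_integral (fun z' : Z => ((sqdist v z' (meet_time v q) < meet_sq v q)%R%:R : R)%:E)).
    by rewrite (disk_integral v _ (meet_sq_ge0 v q)).
  move=> z' _; rewrite -EFinM; congr EFin; rewrite !indicE.
  rewrite (_ : (z' \in xsection _ _) = (sqdist v z' (meet_time v q) < meet_sq v q)%R); last first.
    apply/idP/idP => [/set_mem/set_mem //|H].
    by apply/mem_set/mem_set.
  case: ltP => [lt|_]; last by rewrite mulr0.
  by rewrite mem_set ?mul1r//; exact: Wz.
under eq_eseriesr do rewrite window_term.
rewrite nneseriesZl; last first.
  by move=> m _; apply: integral_ge0 => q _; apply: integral_ge0.
congr (_ * _); rewrite -integral_nneseries//; last 2 first.
- move=> m.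
  exact: (measurable_fun_fubini_tonelli_G (m1 := @site_measure R) _ (mF m) (F0 m)).
- by move=> m q _; apply: integral_ge0.
apply: eq_integral => q _; rewrite -integral_nneseries//; last first.
  by move=> m; apply: (measurableT_comp (mF m)); exact: pair2_measurable.
apply: eq_integral => z _; rewrite /F sum_layer//; exact: handover_weight_ge0.
Qed.

End all_windows.

(** * P22 *)
Section no_collision.
Context d (T : measurableType d) (R : realType) (P : probability T R).
Variables (lambda v : R) (X : nat -> {RV P >-> plane R})
  (Theta : nat -> {RV P >-> measurableTypeR R}).
Hypothesis lambda0 : 0 < lambda.
Hypothesis poisX : homogeneous_poisson P lambda X.
Hypothesis unifTheta : iid_uniform_angles Theta.
Hypothesis indXTheta : independent_sequences P X Theta.
Local Notation Z := (plane R * mark R)%type.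
Local Notation U := (Z * (Z * Z))%type.
Local Open Scope ereal_scope.

Let coll (p : U) : R := (serving_sq v p == meet_sq v p.2)%R%:R.

Let coll0 p : (0 <= coll p)%R. Proof. by []. Qed.

Let mcoll : measurable_fun setT coll.
Proof.
apply: measurable_bool_natr; apply: measurable_fun_eqr.
  exact: measurable_serving_sq.
exact: measurable_meet_sq2.
Qed.

Let mW m := measurable_window v m.
Let fW m := area_window v m.
Let S m w := mecke_sum X Theta (window v m) coll set0 w.

Let mS m : measurable_fun setT (S m).
Proof. exact: measurable_mecke_sum. Qed.

Let S0 m w : 0 <= S m w. Proof. exact: mecke_sum_ge0. Qed.

Lemma integral_collision m : \int[P]_w S m w = 0.
Proof.
rewrite /S (mecke_window (ltW lambda0) poisX unifTheta indXTheta (mW m) (fW m) coll0 mcoll measurable0).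
set nu := site_law (mW m) (fW m).
pose f (p : U) : \bar R := (coll p)%:E *
  (expR (- (lambda * fine (nu (xsection (set0 : set (U * Z)) p)))))%:E.
have f0 p : 0 <= f p by rewrite mule_ge0 ?lee_fin ?expR_ge0.
have mf : measurable_fun setT f.
  apply: emeasurable_funM; apply/measurable_EFinP => //.
  apply: (measurableT_comp (@measurable_expR R)).
  have mnu : measurable_fun setT (fun p => fine (nu (xsection (set0 : set (U * Z)) p))).
    apply: (measurableT_comp (f := fine)); first exact: fine_measurable.
    exact: measurable_fun_xsection.
  by apply: measurableT_comp => //; exact: measurable_funM.
have -> : \int[finprod nu (finprod nu nu)]_p f p = 0; last by rewrite mule0.
apply: (etrans (integral_triple_law (mW m) (fW m) f0 mf)).
apply: integral0_eq => q _; apply/eqP; rewrite eq_le; apply/andP; split; last first.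
  by apply: integral_ge0 => z _; rewrite mule_ge0 ?lee_fin ?mulr_ge0.
rewrite -(@site_circle R v (meet_sq v q) (meet_time v q)).
have mfz : measurable_fun setT (fun z => f (z, q)).
  by apply: (measurableT_comp mf); exact: pair2_measurable.
have mcz : measurable_fun setT (fun z => coll (z, q)).
  by apply: (measurableT_comp mcoll); exact: pair2_measurable.
apply: ge0_le_integral => //.
- by move=> z _; rewrite mule_ge0 ?lee_fin ?mulr_ge0.
- apply: emeasurable_funM => //; apply/measurable_EFinP; apply: measurable_funM => //.
  by apply/measurable_EFinP; exact: measurable_in_first.
- exact/measurable_EFinP.
move=> z _; rewrite /f -!EFinM lee_fin -[X in (_ <= X)%R]/(coll (z, q)).
rewrite mulrCA ler_piMr// !mulr_ile1 ?mulr_ge0 ?expR_ge0//.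
by rewrite -expR0 ler_expR oppr_le0 mulr_ge0 ?(ltW lambda0)// fine_ge0.
Qed.

Lemma window_cover (x : plane R) : exists m0, forall m, (m0 <= m)%N -> window v m x.
Proof.
exists (Num.truncn (sqn x)) => m m0.
have v2 := sqr_ge0 v.
have mS' : (m.+1%:R = m%:R + 1 :> R)%R by rewrite -natr1.
have mR : (0 <= m%:R :> R)%R by [].
have : (sqn x < m.+1%:R)%R.
  by apply: (lt_le_trans (truncnS_gt _)); rewrite ler_nat.
by move=> xm; apply: sqn_square; lra.
Qed.

Lemma no_collision : exists N : set T, [/\ measurable N, P N = 0 &
  forall w, ~ N w -> forall i j k, uniq [:: i; j; k] ->
    serving_sq v (triple X Theta [:: i; j; k] w) <>
    meet_sq v (triple X Theta [:: i; j; k] w).2].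
Proof.
have null m : P.-negligible [set w | S m w <> 0].
  have : \int[P]_w `|S m w| = 0.
    by rewrite -(integral_collision m); apply: eq_integral => w _; rewrite gee0_abs.
  move=> /(ae_eq_integral_abs _ measurableT (mS m)) [N [mN N0 subN]].
  exists N; split => // w Sw; apply: subN => /= H; apply: Sw; exact: H.
have [N [mN N0 subN]] := negligible_bigcup null.
exists N; split => // w Nw i j k uijk coll_w.
have [mi Hi] := window_cover (X i w).
have [mj Hj] := window_cover (X j w).
have [mk Hk] := window_cover (X k w).
pose m := (maxn mi (maxn mj mk)).
have Sm0 : S m w = 0.
  by apply: contra_notP Nw => Sm; apply: subN; exists m.
have /= := nsum_eq0 _ Sm0 (s := [:: i; j; k]) erefl uijk.
rewrite !mem_set/=; last 3 first.
- by apply: Hk; rewrite !leq_max leqnn !orbT.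
- by apply: Hj; rewrite !leq_max leqnn !orbT.
- by apply: Hi; rewrite !leq_max leqnn.
rewrite /coll coll_w eqxx indicE mem_set; last by move=> l _ _ [].
move=> /(_ _ _) H; have /eqP : 1 * (1 * 1) = 0 :> \bar R.
  by apply: H => // s; rewrite mule_ge0 ?mule_ge0 ?lee_fin.
by rewrite !mul1e onee_eq0.
Qed.

End no_collision.

(** * P23 *)
Section configuration.
Context (R : realType) (v : R) (x : nat -> plane R) (theta : nat -> R).
Hypothesis v0 : 0 < v.
Local Notation Z := (plane R * mark R)%type.
Let z i : Z := (x i, theta i).
Let D := bs_dist v x theta.
Local Notation I01 := (`[0%R, 1%R]%classic : set R).

Hypothesis generic : forall i j k, uniq [:: i; j; k] ->
  sqdist v (z i) (meet_time v (z j, z k)) <> meet_sq v (z j, z k).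

Definition pair_of (s : nat * (nat * nat)) : Z * Z := (z s.2.1, z s.2.2).
Definition handover_time s := meet_time v (pair_of s).

Definition handover_triples : set (nat * (nat * nat)) :=
  [set s | [/\ uniq (index_list s), slope (z s.2.2) < slope (z s.2.1),
    I01 (handover_time s), sqdist v (z s.1) (handover_time s) < meet_sq v (pair_of s) &
    forall k, k \notin index_list s ->
      ~ sqdist v (z k) (handover_time s) < meet_sq v (pair_of s)]].

Let vn0 : v != 0. Proof. exact: lt0r_neq0. Qed.

Lemma DE i t : D i t = Num.sqrt (sqdist v (z i) t).
Proof. exact: bs_distE. Qed.

Lemma D_eq i t c : 0 <= c -> D i t = Num.sqrt c <-> sqdist v (z i) t = c.
Proof.
move=> c0; rewrite DE; split=> [/eqP|->//].
by rewrite eqr_sqrt ?sqdist_ge0// => /eqP.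
Qed.

Lemma D_lt i t c : 0 <= c -> (D i t < Num.sqrt c) = (sqdist v (z i) t < c).
Proof.
rewrite le_eqVlt DE => /predU1P[<-|c0]; last by rewrite ltr_sqrt.
by rewrite sqrtr0 !ltNge sqrtr_ge0 sqdist_ge0.
Qed.

Lemma meet_second s : handover_triples s ->
  sqdist v (z s.2.2) (handover_time s) = meet_sq v (pair_of s).
Proof. by move=> [_ sl _ _ _]; rewrite meet_sqE// gt_eqF. Qed.

Lemma handover_triple_spec s : handover_triples s ->
  interference_handover D (handover_time s) (Num.sqrt (meet_sq v (pair_of s)))
    (Num.sqrt (sqdist v (z s.1) (handover_time s))).
Proof.
move=> Ss; have [us sl _ near far] := Ss.
have h0 := meet_sq_ge0 v (pair_of s).
split.
  exists s.2.1, s.2.2; split.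
    by move=> eqij; rewrite eqij ltxx in sl.
  by split; [exact: DE|apply/(D_eq _ _ h0); exact: meet_second].
exists s.1; split; last exact: DE.
split; first by rewrite (D_lt _ _ h0).
move=> k; rewrite (D_lt _ _ h0) => kn.
have [ks|/far//] := boolP (k \in index_list s).
move: ks; rewrite !inE => /or3P[/eqP->//|/eqP ki|/eqP kj].
  by move: kn; rewrite ki ltxx.
by move: kn; rewrite kj meet_second// ltxx.
Qed.

Lemma handover_distE s : handover_triples s ->
  handover_dist D (handover_time s) ^+ 2 = meet_sq v (pair_of s).
Proof.
move=> /handover_triple_spec H; rewrite /handover_dist.
rewrite (@xget_unique _ 0 _ (Num.sqrt (meet_sq v (pair_of s)))).
- by rewrite sqr_sqrtr// meet_sq_ge0.
- by eexists; exact: H.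
- by move=> h [r H']; have [] := interference_handover_unique H' H.
Qed.

Lemma serving_distE s : handover_triples s ->
  serving_dist D (handover_time s) ^+ 2 = sqdist v (z s.1) (handover_time s).
Proof.
move=> /handover_triple_spec H; rewrite /serving_dist.
rewrite (@xget_unique _ 0 _ (Num.sqrt (sqdist v (z s.1) (handover_time s)))).
- by rewrite sqr_sqrtr// sqdist_ge0.
- by eexists; exact: H.
- by move=> h [r H']; have [] := interference_handover_unique H' H.
Qed.

Lemma slope_neq i j t : i <> j -> sqdist v (z i) t = sqdist v (z j) t ->
  slope (z i) != slope (z j).
Proof.
move=> /eqP ij e; apply/eqP => es.
have ee t' : sqdist v (z i) t' = sqdist v (z j) t'.
  by move: e; rewrite !sqdistE es => e; lra.
pose k := (maxn i j).+1.
have ki : k != i by rewrite /k gtn_eqF// ltnS leq_maxl.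
have kj : k != j by rewrite /k gtn_eqF// ltnS leq_maxr.
apply: (@generic j i k); last by rewrite -ee.
by rewrite /= !inE negb_or (eq_sym j i) ij (eq_sym j k) kj (eq_sym i k) ki.
Qed.

Lemma handover_time_surj t : interference_times D t -> I01 t ->
  exists2 s, handover_triples s & handover_time s = t.
Proof.
move=> [h [r [[i0 [j0 [nij [hi0 hj0]]]] [l [[lh ul] _]]]]] It.
wlog: i0 j0 nij hi0 hj0 / slope (z j0) < slope (z i0) => [wl|sl].
  have e : sqdist v (z i0) t = sqdist v (z j0) t.
    apply/(D_eq i0 t (sqdist_ge0 v (z j0) t)).
    by rewrite hi0 -hj0; exact: DE.
  have : slope (z i0) != slope (z j0) by exact: slope_neq e.
  by rewrite neq_lt => /orP[|] sl; [apply: (wl j0 i0) => // /esym|exact: (wl i0 j0)].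
have e : sqdist v (z i0) t = sqdist v (z j0) t.
  apply/(D_eq i0 t (sqdist_ge0 v (z j0) t)).
  by rewrite hi0 -hj0; exact: DE.
have tE : t = meet_time v (z i0, z j0).
  by apply/(@meet_iff R v (z i0, z j0) t vn0); rewrite ?gt_eqF.
have hE : h = Num.sqrt (meet_sq v (z i0, z j0)).
  by rewrite -hi0 DE /meet_sq -tE.
have h0 := meet_sq_ge0 v (z i0, z j0).
have li : l <> i0 by move=> li; move: lh; rewrite li hi0 ltxx.
have lj : l <> j0 by move=> lj; move: lh; rewrite lj hj0 ltxx.
exists (l, (i0, j0)); last by rewrite /handover_time /pair_of.
split => /=.
- rewrite !inE negb_or; move: li lj nij => /eqP -> /eqP -> /eqP ->//.
- exact: sl.
- by rewrite /handover_time /pair_of /= -tE.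
- by rewrite /handover_time /pair_of /= -tE -D_lt// -hE.
- move=> k; rewrite /handover_time /pair_of /= -tE -(D_lt k t h0) -hE => kl /ul lk.
  by move: kl; rewrite lk inE eqxx.
Qed.

Lemma handover_time_inj s s' : handover_triples s -> handover_triples s' ->
  handover_time s = handover_time s' -> s = s'.
Proof.
move=> Ss Ss' ee.
have H := handover_triple_spec Ss; have := handover_triple_spec Ss'.
rewrite -ee => H'; have [hh _] := interference_handover_unique H H'.
have h0 := meet_sq_ge0 v (pair_of s); have h0' := meet_sq_ge0 v (pair_of s').
have {}hh : meet_sq v (pair_of s) = meet_sq v (pair_of s').
  by apply/eqP; rewrite -eqr_sqrt//; apply/eqP.
have [us sl _ near far] := Ss; have [us' sl' _ near' far'] := Ss'.
have e2 := meet_second Ss'.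
have pairE k : sqdist v (z k) (handover_time s) = meet_sq v (pair_of s) ->
    k = s.2.1 \/ k = s.2.2.
  move=> kh; have [|ki] := eqVneq k s.2.1; first by left.
  have [|kj] := eqVneq k s.2.2; first by right.
  exfalso; apply: (@generic k s.2.1 s.2.2) kh.
  move: us; rewrite /index_list /= !inE !negb_or ki kj /= andbT.
  by move=> /andP[].
have servE : s'.1 = s.1.
  apply/eqP; apply: contraT => ne.
  have [ks|/far/(_ _)] := boolP (s'.1 \in index_list s); last first.
    by rewrite ee hh => /(_ near').
  move: ks; rewrite !inE (negbTE ne) /= => /orP[/eqP ki|/eqP kj].
    by move: near'; rewrite -ee -hh ki ltxx.
  by move: near'; rewrite -ee -hh kj meet_second// ltxx.
have i' : s'.2.1 = s.2.1 \/ s'.2.1 = s.2.2.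
  by apply: pairE; rewrite ee hh.
have j' : s'.2.2 = s.2.1 \/ s'.2.2 = s.2.2.
  by apply: pairE; rewrite ee hh.
move: i' j' servE sl sl'; clear.
case: s s' => [l [i j]] [l' [i' j']] /= [-> | ->] [-> | ->] -> //.
- by move=> _; rewrite ltxx.
- by move=> /lt_trans H /H; rewrite ltxx.
- by move=> _; rewrite ltxx.
Qed.

Lemma handover_time_bij : set_bij handover_triples
  (interference_times D `&` I01) handover_time.
Proof.
split.
- move=> s Ss; split; last by case: Ss.
  by exists (Num.sqrt (meet_sq v (pair_of s))); eexists; exact: handover_triple_spec.
- by move=> s s' /set_mem Ss /set_mem Ss'; exact: handover_time_inj.
- by move=> t [Nt It]; have [s Ss <-] := handover_time_surj Nt It; exists s.
Qed.

End configuration.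

(** * P24 *)
Section palm.
Context d (T : measurableType d) (R : realType) (P : probability T R).
Variables (lambda v : R) (X : nat -> {RV P >-> plane R})
  (Theta : nat -> {RV P >-> measurableTypeR R}).
Hypothesis lambda0 : 0 < lambda.
Hypothesis v0 : 0 < v.
Hypothesis poisX : homogeneous_poisson P lambda X.
Hypothesis unifTheta : iid_uniform_angles Theta.
Hypothesis indXTheta : independent_sequences P X Theta.
Local Notation leb := (@lebesgue_measure R).
Local Notation J01 := (`[0%R, 1%R[%classic : set (measurableTypeR R)).
Local Open Scope ereal_scope.

Let D w := bs_dist v (fun i => X i w) (fun i => Theta i w).
Let mark_laplace gamma beta w t : R := expR (- gamma * handover_dist (D w) t ^+ 2
  - beta * serving_dist (D w) t ^+ 2).

Lemma esum_handover_sum gamma beta w :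
  (forall i j k, uniq [:: i; j; k] ->
    serving_sq v (triple X Theta [:: i; j; k] w) <>
    meet_sq v (triple X Theta [:: i; j; k] w).2) ->
  \esum_(t in interference_times (D w) `&` `[0%R, 1%R]) (mark_laplace gamma beta w t)%:E =
  handover_sum v X Theta gamma beta w.
Proof.
move=> generic.
pose x i : plane R := X i w; pose theta i : R := Theta i w.
have gen i j k : uniq [:: i; j; k] ->
    sqdist v (x i, theta i) (meet_time v ((x j, theta j), (x k, theta k))) <>
    meet_sq v ((x j, theta j), (x k, theta k)) := generic i j k.
rewrite (@reindex_esum R _ _ (handover_triples v x theta) _
  (handover_time v x theta) _ (handover_time_bij v0 gen)).
rewrite /handover_sum nsum3_esum; last first.
  by move=> s; rewrite lee_fin mulr_ge0 ?handover_weight_ge0.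
rewrite esum_mkcond [RHS]esum_mkcond; apply: eq_esum => s _.
case: ifPn => [/set_mem Ss|nS].
  rewrite /mark_laplace (handover_distE v0 Ss) (serving_distE v0 Ss).
  have [us sl tI near far] := Ss.
  rewrite mem_set// /handover_weight /triple /serving_sq /= !indicE.
  rewrite sl near !mem_set ?mul1r ?mulr1//.
  by move=> k ks _; exact: far.
case: ifPn => // /set_mem us; apply/esym/eqP; rewrite eqe; apply: contraT.
rewrite !mulf_eq0 !negb_or !indicE !pnatr_eq0 !eqb0 !negbK.
move=> /andP[/andP[/andP[sl /set_mem tI] /andP[near _]] /set_mem far].
by exfalso; move/negP: nS; apply; apply/mem_set; split => // k ks; exact: far.
Qed.

Lemma mean_sum_laplace gamma beta : (0 <= gamma)%R -> (0 <= beta)%R ->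
  mean_sum P (fun w => interference_times (D w)) (mark_laplace gamma beta) =
  (lambda ^+ 3)%:E * (pi%:E * (pair_int v 1 *
    \int[leb]_r (\1_J01 r * (lambda * pi + gamma + beta * r) `^ (- (5 / 2)))%:E)).
Proof.
move=> g0 b0.
have [N [mN N0 generic]] := no_collision v lambda0 poisX unifTheta indXTheta.
have h0 w : 0 <= \esum_(t in interference_times (D w) `&` `[0%R, 1%R])
    (mark_laplace gamma beta w t)%:E.
  by apply: esum_ge0 => t _; rewrite lee_fin expR_ge0.
rewrite /mean_sum (ge0_integral_null_change mN N0 h0
  (handover_sum_ge0 v X Theta gamma beta) (measurable_handover_sum v X Theta gamma beta)); last first.
  by move=> w /generic; exact: esum_handover_sum.
rewrite (integral_handover_sum lambda0 v0 poisX unifTheta indXTheta).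
have a0 : (0 < gamma + lambda * pi)%R by rewrite ltr_wpDl// mulr_gt0// pi_gt0.
by rewrite (integral_handover_weight v0 a0 b0) (addrC gamma).
Qed.

End palm.

Theorem proposition6 (R : realType) (d : measure_display)
    (T : measurableType d) (P : probability T R) (lambda v : R)
    (X : nat -> {RV P >-> plane R})
    (Theta : nat -> {RV P >-> measurableTypeR R}) (beta gamma : R) :
  0 < lambda -> 0 < v ->
  homogeneous_poisson P lambda X ->
  iid_uniform_angles Theta ->
  independent_sequences P X Theta ->
  0 <= beta -> 0 <= gamma ->
  let D w := bs_dist v (fun i => X i w) (fun i => Theta i w) in
  palm_expectation P (fun w => interference_times (D w))
    (fun w t => expR (- gamma * handover_dist (D w) t ^+ 2
                      - beta * serving_dist (D w) t ^+ 2)) =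
  (joint_laplace lambda gamma beta)%:E.
Proof.
move=> l0 v0 poisX unifTheta indXTheta b0 g0 D.
have lp0 : 0 < lambda * pi by rewrite mulr_gt0// pi_gt0.
have mean_sumE := mean_sum_laplace l0 v0 poisX unifTheta indXTheta.
have intensityE : intensity P (fun w => interference_times (D w)) =
    ((lambda ^+ 3)%:E * (pi%:E * (pair_int v 1 *
      ((lambda * pi) `^ (- (5 / 2)))%:E)))%E.
  have := mean_sumE 0 0 (lexx 0) (lexx 0).
  rewrite addr0 integral_powR// eqxx => <-; rewrite /intensity; congr mean_sum.
  by apply/funext => w; apply/funext => t; rewrite oppr0 !mul0r subr0 expR0.
have [K K0 KE] : exists2 K : R, 0 < K & pair_int v 1 = K%:E.
  have := pair_int_gt0 v0; have := pair_int_lty v0.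
  by case: (pair_int v 1) => // K _ K0; exists K.
rewrite /palm_expectation intensityE (mean_sumE _ _ g0 b0).
rewrite integral_powR ?ltr_wpDr// KE -!EFinM/=; congr EFin.
rewrite joint_laplaceE//.
have -> : (lambda * pi) `^ (- (5 / 2)) = ((lambda * pi) `^ (5 / 2))^-1.
  by rewrite powRN.
set J := (if _ then _ else _).
have c0 := powR_gt0 (5 / 2) lp0.
have cancel (l p k c y : R) : l != 0 -> p != 0 -> k != 0 -> c != 0 ->
    (l ^+ 3 * (p * (k / c)))^-1 * (l ^+ 3 * (p * (k * y))) = c * y.
  by move=> l_neq0 p_neq0 k_neq0 c_neq0; field; rewrite c_neq0 k_neq0 p_neq0.
by apply: cancel; rewrite gt_eqF// pi_gt0.
Qed.
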